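(* Let $d\ge1$ and $n\ge1$ be integers. Consider the discontinuous piecewise polynomial differential system $$\dot x=-y+\varepsilon P_a(x,y,z),\quad \dot y=x+\varepsilon P_b(x,y,z),\quad \dot z_\ell=\varepsilon P_{c_\ell}(x,y,z)\qquad\text{if } y>0,$$ $$\dot x=-y+\varepsilon Q_a(x,y,z),\quad \dot y=x+\varepsilon Q_b(x,y,z),\quad \dot z_\ell=\varepsilon Q_{c_\ell}(x,y,z)\qquad\text{if } y<0,$$ ($\ell=1,\dots,d$), with $(x,y,z)\in\mathbb{R}\times\mathbb{R}\times\mathbb{R}^d$, where $P_a=\sum a_{ijk}x^iy^jz^k$, $P_b=\sum b_{ijk}x^iy^jz^k$, $Q_a=\sum\alpha_{ijk}x^iy^jz^k$, $Q_b=\sum\beta_{ijk}x^iy^jz^k$, $P_{c_\ell}$ and $Q_{c_\ell}$ are real polynomials of degree at most $n$, and suppose additionally that $a_{00k}=b_{00k}=\alpha_{00k}=\beta_{00k}=0$ for all multi-indices $k$. Then, using the averaging theory of first order, for $|\varepsilon|\neq0$ sufficiently small the number of limit cycles of this system bifurcating from the periodic orbits of the system with $\varepsilon=0$ is at most $n^d(n-1)$, and this number is reached; furthermore the limit cycles can be chosen as close to the origin of $\mathbb{R}^{d+2}$ as we want. Explicitly, with the averaged function $f:(0,\infty)\times\mathbb{R}^d\to\mathbb{R}^{d+1}$ and the notion of admissible zero defined in the context: (1) for every choice of such polynomials (with $a_{00k}=b_{00k}=\alpha_{00k}=\beta_{00k}=0$ for all $k$), $f$ has at most $n^d(n-1)$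 admissible zeros in $(0,\infty)\times\mathbb{R}^d$; (2) for every $\delta>0$ there is a choice of such polynomials (with $a_{00k}=b_{00k}=\alpha_{00k}=\beta_{00k}=0$ for all $k$) for which $f$ has exactly $n^d(n-1)$ admissible zeros in $(0,\infty)\times\mathbb{R}^d$ and, for all $\varepsilon\ne0$ with $|\varepsilon|$ sufficiently small, the system has $n^d(n-1)$ distinct limit cycles associated with these zeros, all contained in the ball of radius $\delta$ centered at the origin of $\mathbb{R}^{d+2}$.
   Context: Here $k=(k_1,\dots,k_d)$ is a multi-index, $z^k=z_1^{k_1}\cdots z_d^{k_d}$, and the sums run over all $i,j,k$ with $i+j+k_1+\dots+k_d\le n$; $a_{00k},b_{00k},\alpha_{00k},\beta_{00k}$ are the coefficients of the monomials $z^k$ not involving $x,y$. Solutions of the discontinuous system that cross the hyperplane $y=0$ transversally are continuous concatenations of solutions of the two polynomial systems. A limit cycle is a periodic orbit that is isolated in the set of all periodic orbits of the system. For $\varepsilon=0$ the non-equilibrium orbits are the periodic orbits $\{x^2+y^2=r^2,\ z=\text{const}\}$, $r>0$. Averaged function of first order: in the coordinates $x=r\cos\theta$, $y=r\sin\theta$, $z=z$ with $r>0$, taking $\theta$ as the new independent variable, the system becomes $r'=\varepsilon F_1+O(\varepsilon^2)$, $z_\ell'=\varepsilon F_{\ell+1}+O(\varepsilon^2)$ if $\sin\theta>0$, and $r'=\varepsilon G_1+O(\varepsilon^2)$, $z_\ell'=\varepsilon G_{\ell+1}+O(\varepsilon^2)$ if $\sin\theta<0$, where $$F_1(\theta,r,z)=\cos\theta\,P_a(r\cos\theta,r\sin\theta,z)+\sin\theta\,P_b(r\cos\theta,r\sin\theta,z),\quad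 F_{\ell+1}(\theta,r,z)=P_{c_\ell}(r\cos\theta,r\sin\theta,z),$$ $$G_1(\theta,r,z)=\cos\theta\,Q_a(r\cos\theta,r\sin\theta,z)+\sin\theta\,Q_b(r\cos\theta,r\sin\theta,z),\quad G_{\ell+1}(\theta,r,z)=Q_{c_\ell}(r\cos\theta,r\sin\theta,z).$$ The averaged function is $f=(f_1,\dots,f_{d+1})$ with $f_m(r,z)=\int_0^{\pi}F_m(\theta,r,z)\,d\theta+\int_\pi^{2\pi}G_m(\theta,r,z)\,d\theta$. A zero $p$ of $f$ is called admissible here if there is a bounded open neighborhood $U$ of $p$ with $\overline U\subset(0,\infty)\times\mathbb{R}^d$ such that $f\neq0$ on $\overline U\setminus\{p\}$ and the Brouwer degree $d_B(f,U,0)$ is nonzero (in particular, a zero at which the Jacobian determinant of $f$ is nonzero is admissible). The limit cycles obtained ''using the averaging theory of first order'' are those associated with the admissible zeros $(r^*,z^* )$ of $f$ with $r^*>0$; the limit cycle associated with such a zero converges as $\varepsilon\to0$ to the periodic orbit $\{x^2+y^2=(r^* )^2,\ z=z^*\}$ of the unperturbed system. *)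

(* Defs.v *)
From HB Require Import structures.
From mathcomp Require Import all_boot all_order all_algebra.
From mathcomp Require Import all_classical all_reals all_analysis.
(* The notations of mpoly clash with those of MathComp-Analysis. *)
From mathcomp Require Import (coercions,canonicals) mpoly.

Set Implicit Arguments.
Unset Strict Implicit.
Unset Printing Implicit Defensive.

Import Order.TTheory GRing.Theory Num.Theory.
Import numFieldNormedType.Exports.

Local Open Scope classical_set_scope.
Local Open Scope ring_scope.

(* A point (x, y, z_1, ..., z_d) of R^(d+2) is a row vector u : 'rV[R]_d.+2,  *)
(* and a point (r, z_1, ..., z_d) of R^(d+1) is p : 'rV[R]_d.+1, with         *)
(* p 0 0 = r. A system (P_a, P_b, P_c1, ..., P_cd) is a family of             *)
(* polynomials in d+2 variables indexed like the coordinates of R^(d+2).      *)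

Definition ix {d : nat} : 'I_d.+2 := ord0.
Definition iy {d : nat} : 'I_d.+2 := lift ord0 ord0.
Definition iz {d : nat} (l : 'I_d) : 'I_d.+2 := lift ord0 (lift ord0 l).

Section Defs.
Variables (R : realType) (d : nat).

Notation poly_family := ('I_d.+2 -> mpoly.mpoly d.+2 R).

Definition no_pure_z (p : mpoly.mpoly d.+2 R) : Prop :=
  forall m : mpoly.multinom d.+2,
    m ix = 0%N -> m iy = 0%N ->
    mpoly.mcoeff m p = 0.

(* msize is the total degree plus one (and 0 for the zero polynomial). *)
Definition perturbation (n : nat) (P : poly_family) : Prop :=
  [/\ forall i, (mpoly.msize (P i) <= n.+1)%N,
      no_pure_z (P ix) & no_pure_z (P iy)].

Definition peval (p : mpoly.mpoly d.+2 R) (u : 'rV[R]_d.+2) : R :=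
  mpoly.meval (fun i => u ord0 i) p.

Definition vfield (eps : R) (P : poly_family) (u : 'rV[R]_d.+2) : 'rV[R]_d.+2 :=
  \row_i ((if i == ix then - u ord0 iy
           else if i == iy then u ord0 ix else 0) + eps * peval (P i) u).

(* The set-valued right-hand side associated by Filippov's convention with    *)
(* the field X on y > 0 and Y on y < 0.                                       *)
Definition filippov (X Y : 'rV[R]_d.+2 -> 'rV[R]_d.+2) (u : 'rV[R]_d.+2) :
    set 'rV[R]_d.+2 :=
  [set v | [/\ 0 < u ord0 iy -> v = X u,
               u ord0 iy < 0 -> v = Y u &
               u ord0 iy = 0 -> exists2 c : R, 0 <= c <= 1 &
                 v = c *: X u + (1 - c) *: Y u]].

(* Absolutely continuous solutions of the differential inclusion, written as  *)
(* indefinite integrals of their velocity v, which may be chosen everywhere   *)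
(* (not only almost everywhere) in the nonempty right-hand side. A solution   *)
(* that crosses y = 0 transversally is a continuous concatenation of          *)
(* solutions of u' = X u in y > 0 and of u' = Y u in y < 0.                   *)
Definition is_solution (X Y : 'rV[R]_d.+2 -> 'rV[R]_d.+2)
    (g : R -> 'rV[R]_d.+2) : Prop :=
  exists v : R -> 'rV[R]_d.+2,
    (forall t, filippov X Y (g t) (v t)) /\
    forall (i : 'I_d.+2) (s t : R), s <= t ->
      (@lebesgue_measure R).-integrable `[s, t] (fun w => (v w ord0 i)%:E) /\
      g t ord0 i - g s ord0 i =
        \int[@lebesgue_measure R]_(w in `[s, t]) v w ord0 i.

Definition periodic_orbit (X Y : 'rV[R]_d.+2 -> 'rV[R]_d.+2)
    (G : set 'rV[R]_d.+2) : Prop :=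
  exists (g : R -> 'rV[R]_d.+2) (T : R),
    [/\ is_solution X Y g, 0 < T, forall t, g (t + T) = g t,
        exists t, g t <> g 0 & G = range g].

Definition limit_cycle (X Y : 'rV[R]_d.+2 -> 'rV[R]_d.+2)
    (G : set 'rV[R]_d.+2) : Prop :=
  periodic_orbit X Y G /\
  exists W : set 'rV[R]_d.+2, [/\ open W, G `<=` W &
    forall G', periodic_orbit X Y G' -> G' `<=` W -> G' = G].

Definition polar (theta : R) (p : 'rV[R]_d.+1) : 'rV[R]_d.+2 :=
  \row_i (if i == ix then p ord0 ord0 * cos theta
          else if unlift ord0 i is Some j then
            if j == ord0 then p ord0 ord0 * sin theta else p ord0 j
          else 0).

(* First-order terms of (r', z') with respect to theta: component 0 is F_1,   *)
(* component l >= 1 is F_(l+1).                                               *)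
Definition polar_rhs (P : poly_family) (theta : R) (p : 'rV[R]_d.+1) :
    'rV[R]_d.+1 :=
  \row_m (if m == ord0 then
            cos theta * peval (P ix) (polar theta p) +
            sin theta * peval (P iy) (polar theta p)
          else peval (P (lift ord0 m)) (polar theta p)).

Definition averaged (P Q : poly_family) (p : 'rV[R]_d.+1) : 'rV[R]_d.+1 :=
  \row_m (\int[@lebesgue_measure R]_(th in `[0, pi]) polar_rhs P th p ord0 m +
          \int[@lebesgue_measure R]_(th in `[pi, 2 * pi])
             polar_rhs Q th p ord0 m).

Definition C1_on (U : set 'rV[R]_d.+1) (f : 'rV[R]_d.+1 -> 'rV[R]_d.+1) : Prop :=
  (forall x, U x -> differentiable f x) /\
  (forall x, U x -> {for x, continuous (fun w => jacobian f w)}).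

Definition jac_det (f : 'rV[R]_d.+1 -> 'rV[R]_d.+1) (x : 'rV[R]_d.+1) : R :=
  \det (jacobian f x).

Definition regular_value (f : 'rV[R]_d.+1 -> 'rV[R]_d.+1)
    (U : set 'rV[R]_d.+1) (v : 'rV[R]_d.+1) : Prop :=
  forall x, U x -> f x = v -> jac_det f x != 0.

(* The analytic definition of the Brouwer degree of a map f that is C^1 on    *)
(* the bounded open set U and continuous on its closure, at a value           *)
(* y \notin f(dU): the sum of the signs of the Jacobian determinants over the *)
(* (finite) fibre in U of any regular value v with |v - y| < dist(y, f(dU)).  *)
(* Regular values v of this kind exist by Sard's theorem, and the sum does    *)
(* not depend on v nor on the norm (here the sup norm).                       *)
Definition is_brouwer_degree (f : 'rV[R]_d.+1 -> 'rV[R]_d.+1)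
    (U : set 'rV[R]_d.+1) (y : 'rV[R]_d.+1) (k : int) : Prop :=
  [/\ open U /\ bounded_set U,
      C1_on U f /\ {within closure U, continuous f},
      (forall x, (closure U `\` U) x -> f x <> y) &
      forall v, regular_value f U v ->
        (forall x, (closure U `\` U) x -> `|v - y| < `|f x - y|) ->
        \sum_(x \in U `&` f @^-1` [set v]) sgz (jac_det f x) = k].

(* The value is 0 when the degree is not defined. *)
Definition brouwer_degree (f : 'rV[R]_d.+1 -> 'rV[R]_d.+1)
    (U : set 'rV[R]_d.+1) (y : 'rV[R]_d.+1) : int :=
  xget 0 [set k | is_brouwer_degree f U y k].

Definition half_space : set 'rV[R]_d.+1 := [set p | 0 < p ord0 ord0].

Definition admissible_zero (f : 'rV[R]_d.+1 -> 'rV[R]_d.+1)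
    (p : 'rV[R]_d.+1) : Prop :=
  [/\ half_space p, f p = 0 &
      exists U : set 'rV[R]_d.+1,
        [/\ open U /\ bounded_set U, U p, closure U `<=` half_space,
            (forall q, closure U q -> q <> p -> f q <> 0) &
            brouwer_degree f U 0 != 0]].

Definition enorm (u : 'rV[R]_d.+2) : R := Num.sqrt (\sum_i u ord0 i ^+ 2).

Definition circle (p : 'rV[R]_d.+1) : set 'rV[R]_d.+2 :=
  [set u | u ord0 ix ^+ 2 + u ord0 iy ^+ 2 = p ord0 ord0 ^+ 2 /\
           forall l : 'I_d, u ord0 (iz l) = p ord0 (lift ord0 l)].

(* Convergence of G eps to C in the Hausdorff distance as eps -> 0, eps != 0. *)
Definition tends_to (G : R -> set 'rV[R]_d.+2) (C : set 'rV[R]_d.+2) : Prop :=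
  forall eta : R, 0 < eta -> \forall eps \near (0 : R)^',
    (forall u, G eps u -> exists2 w, C w & enorm (u - w) < eta) /\
    (forall w, C w -> exists2 u, G eps u & enorm (u - w) < eta).

End Defs.

(* Main.v *)
Require Import Defs.
From HB Require Import structures.
From mathcomp Require Import all_boot all_order all_algebra.
From mathcomp Require Import all_classical all_reals all_analysis.
From mathcomp Require Import (coercions,canonicals) mpoly.
From mathcomp Require Import -(notations) mpoly.
From mathcomp Require Import zify ring lra.

Set Implicit Arguments.
Unset Strict Implicit.
Unset Printing Implicit Defensive.

Import Order.TTheory GRing.Theory Num.Theory.
Import numFieldNormedType.Exports.

Local Open Scope classical_set_scope.
Local Open Scope ring_scope.

(** The upper bound. Integrating in theta shows that the averaged function is
    (r * g0, g), where g0 has degree at most n - 1 and the d components of g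
    have degree at most n (averaged_polynomial). A zero of nonzero degree
    cannot disappear when the right-hand side is moved: by the very definition
    of the degree, a small value that is not taken would be a regular value
    with an empty fibre. So the averaged function is open at each admissible
    zero (admissible_zero_open).

    It remains to prove that N zeros with r > 0 at which such a map is open
    satisfy N <= n ^ d * (n - 1). This is done by comparing dimensions instead
    of eliminating variables. Near the zeros, every small w is taken N times
    by g on g0 = 0, at points separated by a linear form l. It follows that
    the products l ^ j * g0 ^ k * g ^ b with j < N are linearly independent
    (fibre_monomials_independent). For large T those of degree at most T are
    about N / ((n - 1) * n ^ d) times as numerous as all monomials of degree
    at most T, so that quotient is at most 1 (bezout_count, bezout_fibres,
    open_zeros_bound).

    The example. Take P_a = x * S, P_b = y * S and Q_a, Q_b similarly, where S
    is a polynomial of degree n - 1 in the absolute value of y, and let every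
    z_l follow eps * q(z_l), where q has n simple zeros. Then theta = t exactly,
    z decouples, and the radius obeys r' = eps * r * S(r * |sin t|). The
    coefficients of S are chosen so that the mean of the right-hand side is
    r * g(r), with n - 1 prescribed simple zeros of g (radial_average). The
    averaged function has n ^ d * (n - 1) zeros, all simple, and simple zeros
    are admissible (decoupled_admissible).

    The limit cycles come from averaging for a scalar periodic equation. Near
    a simple zero of the mean there is a periodic solution, the fixed point of
    a contraction that adjusts the initial value so that the mean vanishes
    (periodic_solution_exists). It is unique, because the difference of two
    solutions, once a periodic factor is removed, has a logarithmic derivative
    close to a nonzero constant and so cannot be periodic unless it vanishes
    (periodic_rigidity, periodic_solution_unique). A periodic orbit that stays
    close to a cycle has constant z for the same reason, and in polar
    coordinates its radius solves the radial equation, so it is that cycle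
    (orbit_limit_cycle). Choosing the prescribed zeros small puts all cycles
    near the origin (sharp_example). *)

Local Notation msize := (mmeasure mdeg).
Local Notation ev x := (meval (fun i => x ord0 i)).

(** * Counting monomials *)

Lemma mpoly_dependence (K : fieldType) (m D : nat) (I : finType)
    (F : I -> mpoly m K) :
  (forall i, (msize (F i) <= D)%N) -> (#|{: bmultinom m D}| < #|I|)%N ->
  exists2 c : I -> K, (exists i, c i != 0) & \sum_i c i *: F i = 0.
Proof.
move=> szF ltDI.
pose A := \matrix_(i < #|I|, j < #|{: bmultinom m D}|)
  mcoeff (enum_val j : bmultinom m D) (F (enum_val i)).
have /rowV0Pn[v /sub_kermxP vA v0] : kermx A != 0.
  rewrite kermx_eq0; apply: contraL ltDI => /eqP rA; rewrite -leqNgt -rA.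
  exact: rank_leq_col.
exists (fun i => v ord0 (enum_rank i)).
  have /existsP[j vj] : [exists j, v ord0 j != 0].
    apply: contraNT v0; rewrite negb_exists => /forallP v0.
    by apply/eqP/rowP => j; rewrite mxE; apply/eqP; rewrite -[_ == _]negbK v0.
  by exists (enum_val j); rewrite enum_valK.
apply/mpolyP => k; rewrite raddf_sum mcoeff0 /=.
have [ltkD|leDk] := ltnP (mdeg k) D; last first.
  apply: big1 => i _; rewrite mcoeffZ memN_msupp_eq0 ?mulr0//.
  by apply: msize_mdeg_ge; apply: leq_trans (szF i) leDk.
have := congr1 (fun B : 'rV_ _ => B ord0 (enum_rank (BMultinom ltkD))) vA.
rewrite mxE [in X in _ = X -> _]mxE; apply: etrans.
rewrite (reindex_onto enum_val enum_rank) /=; last by move=> i _; rewrite enum_rankK.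
apply: eq_big => [i|i _]; first by rewrite enum_valK eqxx.
by rewrite mcoeffZ mxE enum_valK enum_rankK.
Qed.

(** By Bernoulli's inequality N ^ B is at least 2 * B ^ B, so the quotient
    of the two exponentials doubles whenever k grows by B. *)
Lemma exp_beats_poly (N B m : nat) : (B < N)%N ->
  exists k, (B ^ k * (k * N).+1 ^ m < N ^ k)%N.
Proof.
move=> ltBN.
have N0 : (0 < N)%N by exact: leq_ltn_trans ltBN.
have [->|B0] := posnP B; first by exists 1%N; rewrite !expn1 mul0n.
have [->|m0] := posnP m.
  by exists 1%N; rewrite expn0 !expn1 muln1.
have h2 : (2 * B ^ B <= N ^ B)%N.
  apply: (@leq_trans (B.+1 ^ B)); last by rewrite leq_exp2r.
  have bern j : ((B + j) * B ^ j <= B * B.+1 ^ j)%N.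
    elim: j => [|j IH]; first by rewrite addn0 !expn0.
    rewrite !expnS mulnCA [X in (_ <= X)%N]mulnCA -[leqRHS]/(B.+1 * (B * B.+1 ^ j))%N.
    apply: leq_trans (leq_mul (leqnn B.+1) IH); nia.
  by rewrite -(leq_pmul2l B0) (leq_trans _ (bern B))// addnn -mul2n mulnA [(B * 2)%N]mulnC.
have h3 s : (2 ^ s * B ^ (B * s) <= N ^ (B * s))%N.
  by case: s => [|s]; rewrite ?muln0 ?expn0 // !expnM -expnMn leq_exp2r.
(* With k = B * (s * m) the claim follows from C * s + 1 < 2 ^ s, which
   holds for s = 4 * C because 2 * C < 2 ^ (2 * C). *)
pose C := (B * m * N)%N.
have C0 : (0 < C)%N by rewrite /C !muln_gt0 B0 m0 N0.
pose s := (2 * (2 * C))%N.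
have h4 : ((C * s).+1 < 2 ^ s)%N.
  have h5 : ((2 * C).+1 * (2 * C).+1 <= 2 ^ s)%N.
    have -> : s = (2 * C + 2 * C)%N by rewrite /s; lia.
    by rewrite expnD leq_mul// ltn_expl.
  rewrite (leq_trans _ h5)// /s; nia.
exists (B * (s * m))%N.
apply: (@leq_trans (2 ^ (s * m) * B ^ (B * (s * m))))%N; last exact: h3.
rewrite mulnC ltn_pmul2r ?expn_gt0 ?B0// expnM ltn_exp2r//.
by apply: leq_trans h4; rewrite /C; nia.
Qed.

(** The exponents (k, b) of the products g0 ^ k * g ^ b of degree at most
    T, when g0 has degree e and each component of g has degree n. *)
Definition weighted_exponents (d e n T : nat) :
    {set 'I_T.+1 * bmultinom d T.+1} :=
  [set x : 'I_T.+1 * bmultinom d T.+1 | e * x.1 + n * mdeg x.2 <= T]%N%SET.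

Lemma card_bmultinom_le (m T : nat) : (#|{: bmultinom m T.+1}| <= T.+1 ^ m)%N.
Proof.
rewrite -[in leqRHS](card_ord m) -[X in (X ^ _)%N](card_ord T.+1) -card_ffun.
pose f (a : bmultinom m T.+1) : {ffun 'I_m -> 'I_T.+1} := [ffun i => inord (a i)].
apply: (@leq_card _ _ f) => a b /ffunP ab; apply: val_inj; apply/mnmP => i.
have lt (c : bmultinom m T.+1) j : (c j < T.+1)%N.
  by apply: leq_ltn_trans (bmdeg c); rewrite mdegE (bigD1 j)//= leq_addr.
by have := congr1 val (ab i); rewrite !ffunE /= !inordK.
Qed.

(** Dividing the first exponent of a monomial by e and the others by n
    leaves quotients that form a weighted exponent and remainders that take e *
    n ^ d values. *)
Lemma card_bmultinom_weighted (d e n T : nat) : (0 < e)%N -> (0 < n)%N ->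
  (#|{: bmultinom d.+1 T.+1}| <= #|weighted_exponents d e n T| * (e * n ^ d))%N.
Proof.
case: e => // e _; case: n => // n _.
have -> : (#|weighted_exponents d e.+1 n.+1 T| * (e.+1 * n.+1 ^ d) =
    #|finset.setX (weighted_exponents d e.+1 n.+1 T)
       (finset.setT : {set 'I_e.+1 * {ffun 'I_d -> 'I_n.+1}})|)%N.
  by rewrite cardsX cardsT card_prod card_ffun !card_ord.
pose q (a : multinom d.+1) : multinom d :=
  Multinom [tuple (a (lift ord0 i) %/ n.+1)%N | i < d].
pose f (a : bmultinom d.+1 T.+1) :=
  ((inord (a ord0 %/ e.+1) : 'I_T.+1, insubd (bm0 : bmultinom d T.+1) (q a)),
   (inord (a ord0 %% e.+1) : 'I_e.+1,
    [ffun i : 'I_d => (inord (a (lift ord0 i) %% n.+1) : 'I_n.+1)])).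
have lea (a : bmultinom d.+1 T.+1) :
    (a ord0 + \sum_i a (lift ord0 i) <= T)%N.
  by have := bmdeg a; rewrite mdegE big_ord_recl ltnS.
have qE (a : multinom d.+1) i : q a i = (a (lift ord0 i) %/ n.+1)%N.
  by rewrite /q multinomE tnth_mktuple.
have nq (a : multinom d.+1) : (n.+1 * mdeg (q a) <= \sum_i a (lift ord0 i))%N.
  rewrite mdegE big_distrr /=; apply: leq_sum => i _.
  by rewrite qE mulnC leq_trunc_div.
have ltq (a : bmultinom d.+1 T.+1) : (mdeg (q a) < T.+1)%N.
  rewrite ltnS (leq_trans _ (lea a))// (leq_trans _ (leq_addl _ _))//.
  by rewrite (leq_trans _ (nq a))// leq_pmull.
have vq (a : bmultinom d.+1 T.+1) : val (insubd (bm0 : bmultinom d T.+1) (q a)) = q a.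
  by rewrite insubdK// /in_mem /= ltq.
have lt0 (a : bmultinom d.+1 T.+1) : (a ord0 %/ e.+1 < T.+1)%N.
  by rewrite ltnS (leq_trans (leq_div _ _))// (leq_trans _ (lea a))// leq_addr.
have f_inj : injective f.
  move=> a b [/(congr1 val)/= + /(congr1 val) + /(congr1 val)/= + /ffunP rab].
  rewrite !inordK// ?ltn_pmod// !vq => q0 qab r0.
  apply: val_inj; apply/mnmP => i; case: (unliftP ord0 i) => [j|] ->; last first.
    by rewrite (divn_eq (a ord0) e.+1) (divn_eq (b ord0) e.+1) q0 r0.
  have := congr1 (fun c : multinom d => c j) qab; rewrite !qE => qj.
  have := congr1 val (rab j); rewrite !ffunE /= !inordK ?ltn_pmod// => rj.
  by rewrite (divn_eq (a _) n.+1) (divn_eq (b _) n.+1) qj rj.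
rewrite -(card_imset _ f_inj) subset_leq_card//.
apply/fintype.subsetP => _ /imsetP[a _ ->]; rewrite !inE /= andbT inordK//.
rewrite (leq_trans _ (lea a))// leq_add ?[(e.+1 * _)%N]mulnC ?leq_trunc_div//.
have -> : mdeg (insubd (bm0 : bmultinom d T.+1) (q a)) = mdeg (q a).
  by rewrite -[in RHS]vq.
exact: nq.
Qed.

(** If B = e * n ^ d were smaller than N, the number M(T) of monomials of
    degree at most T would satisfy N * M(T) <= B * M(T + N), hence grow
    exponentially along multiples of N, whereas it is bounded by a polynomial
    in T. *)
Lemma bezout_count (N d e n : nat) : (0 < e)%N -> (0 < n)%N ->
  (forall T, N * #|weighted_exponents d e n T| <= #|{: bmultinom d.+1 (T + N).+1}|)%N ->
  (N <= e * n ^ d)%N.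
Proof.
move=> e0 n0 NT; rewrite leqNgt; apply/negP => ltBN.
pose B := (e * n ^ d)%N; pose M T := #|{: bmultinom d.+1 T.+1}|.
have NM T : (N * M T <= B * M (T + N))%N.
  apply: (@leq_trans (N * (#|weighted_exponents d e n T| * B))).
    by rewrite leq_mul2l card_bmultinom_weighted ?orbT.
  by rewrite mulnA [leqRHS]mulnC leq_mul2r NT orbT.
have NMk k T : (N ^ k * M T <= B ^ k * M (T + k * N))%N.
  elim: k T => [|k IH] T; first by rewrite mul0n addn0.
  rewrite !expnS -mulnA mulnCA -[leqRHS]mulnA [leqRHS]mulnCA.
  apply: (@leq_trans (N ^ k * (B * M (T + N)))).
    by rewrite leq_mul2l NM orbT.
  by rewrite mulnCA [leqRHS]mulnCA leq_mul2l mulSn addnA IH orbT.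
have [k] := exp_beats_poly d.+1 ltBN; rewrite ltnNge => /negP; apply.
have M0 : (0 < M 0)%N by apply/card_gt0P; exists (bm0 : bmultinom d.+1 1).
apply: (@leq_trans (N ^ k * M 0)); first by rewrite leq_pmulr.
apply: (leq_trans (NMk k 0%N)); rewrite add0n leq_mul2l.
by rewrite (card_bmultinom_le d.+1) orbT.
Qed.

(** * Independence of products of polynomials *)

Lemma poly_eq0_near0 (R : realFieldType) (p : {poly R}) (h : R) : 0 < h ->
  (forall t, 0 < t < h -> p.[t] = 0) -> p = 0.
Proof.
move=> h0 ph; pose s := [seq h / i.+2%:R | i <- iota 0 (size p)].
have div_inj : injective (fun i : nat => h / i.+2%:R).
  move=> i j /= /(mulfI (lt0r_neq0 h0)) /invr_inj /eqP.
  by rewrite eqr_nat => /eqP[].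
apply: (@roots_geq_poly_eq0 _ _ s).
- apply/allP => _ /mapP[i _ ->]; apply/rootP/ph.
  by rewrite divr_gt0//= ltr_pdivrMr// ltr_pMr// ltr1n.
- by rewrite map_inj_uniq ?iota_uniq.
- by rewrite size_map size_iota.
Qed.

Lemma base_expansion_inj (D n : nat) (f g : nat -> nat) :
  (forall i, f i < D)%N -> (forall i, g i < D)%N ->
  (\sum_(i < n) f i * D ^ i = \sum_(i < n) g i * D ^ i)%N ->
  forall i, (i < n)%N -> f i = g i.
Proof.
elim: n f g => [//|n IH] f g fD gD.
rewrite !big_ord_recl !expn0 !muln1.
have shift (h : nat -> nat) : (\sum_(i < n) h (bump 0 i) * D ^ bump 0 i =
    (\sum_(i < n) h i.+1 * D ^ i) * D)%N.
  by rewrite big_distrl; apply: eq_bigr => i _; rewrite /bump add1n expnSr mulnA.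
rewrite !shift => eqfg.
have D0 : (0 < D)%N by apply: leq_ltn_trans (fD 0%N).
have e0 : f 0%N = g 0%N.
  have := congr1 (modn^~ D) eqfg.
  by rewrite ![(_ + _ * D)%N]addnC !modnMDl !modn_small.
move: eqfg; rewrite e0 => /eqP; rewrite eqn_add2l eqn_pmul2r// => /eqP eqfg.
by case=> [//|i] ltin; apply: (IH (fun i => f i.+1) (fun i => g i.+1)).
Qed.

(** Kronecker's substitution w_i = t ^ (D ^ i), with D larger than every
    exponent, keeps distinct monomials distinct: it turns q into a polynomial
    in t with the same coefficients and infinitely many zeros. *)
Lemma mpoly_eq0_near0 (R : realFieldType) (d : nat) (q : mpoly d R) (h : R) :
  0 < h -> (forall w : 'I_d -> R, (forall i, `|w i| < h) -> meval w q = 0) ->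
  q = 0.
Proof.
move=> h0 qh; pose D := (msize q).+1.
pose e (m : multinom d) := (\sum_(i < d) m i * D ^ i)%N.
pose P := \sum_(m : bmultinom d D) mcoeff m q *: 'X^(e m).
have ltD (m : bmultinom d D) i : (m i < D)%N.
  by apply: leq_ltn_trans (bmdeg m); rewrite mdegE (bigD1 i)//= leq_addr.
have e_inj (m k : bmultinom d D) : e m = e k -> m = k.
  move=> emk; apply: val_inj; apply/mnmP => i.
  pose ext (m : bmultinom d D) (i : nat) :=
    if insub i is Some j then m j else 0%N.
  have extE m' (j : 'I_d) : ext m' j = m' j by rewrite /ext valK.
  rewrite -!extE; apply: (@base_expansion_inj D d) => //.
  - by move=> j; rewrite /ext; case: insub.
  - by move=> j; rewrite /ext; case: insub.
  - by transitivity (e m); [|rewrite emk]; apply: eq_bigr => j _; rewrite extE.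
have P0 : P = 0.
  pose h' := Num.min h 1.
  apply: (@poly_eq0_near0 _ _ h'); first by rewrite lt_min h0 ltr01.
  move=> t /andP[t0]; rewrite lt_min => /andP[th t1].
  have D0 (i : 'I_d) : (0 < D ^ i)%N by rewrite expn_gt0.
  rewrite -(qh (fun i : 'I_d => t ^+ (D ^ i))); last first.
    move=> i; rewrite ger0_norm ?exprn_ge0 ?ltW// (le_lt_trans _ th)//.
    by rewrite -(prednK (D0 i)) exprS ler_piMr ?(ltW t0)// exprn_ile1 ?ltW.
  rewrite [in RHS](mpolywE (leqnSn (msize q))) raddf_sum horner_sum /=.
  apply: eq_bigr => m _; rewrite mevalZ mevalX hornerZ hornerXn; congr (_ * _).
  by rewrite -prodrXr; apply: eq_bigr => i _; rewrite -exprM mulnC.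
apply/mpolyP => m; rewrite mcoeff0.
have [ltmD|leDm] := ltnP (mdeg m) D; last first.
  by apply/memN_msupp_eq0/msize_mdeg_ge; apply: leq_trans (leqnSn _) leDm.
have := congr1 (fun P : {poly R} => P`_(e m)) P0.
rewrite coef0 coef_sum (bigD1 (BMultinom ltmD))//= coefZ coefXn eqxx mulr1.
rewrite big1 ?addr0// => k km; rewrite coefZ coefXn.
case: eqP => [/esym ekm|_]; last by rewrite mulr0.
by move: km; rewrite (e_inj k (BMultinom ltmD) ekm) eqxx.
Qed.

Lemma powers_independent (F : fieldType) (N : nat) (a c : 'I_N -> F) :
  injective a -> (forall i, \sum_(j < N) a i ^+ j * c j = 0) -> forall j, c j = 0.
Proof.
move=> a_inj ac j.
pose P := \poly_(k < N) (if insub k is Some j then c j else 0).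
have P0 : P = 0.
  apply: (@roots_geq_poly_eq0 _ _ [seq a i | i : 'I_N]).
  - apply/allP => _ /mapP[i _ ->]; apply/rootP; rewrite horner_poly.
    apply: etrans (ac i); apply: eq_bigr => k _; by rewrite valK mulrC.
  - by rewrite map_inj_uniq ?enum_uniq.
  - by rewrite size_map size_enum_ord size_poly.
have := congr1 (fun P : {poly F} => P`_j) P0.
by rewrite coef0 coef_poly ltn_ord valK.
Qed.

(** On the points x i lying over w the polynomial g0 vanishes, so only the
    terms with k = 0 survive there; the values of l on these points being
    distinct, each C 0 j vanishes at w. As this holds for all small w, C 0 j is
    zero, and the remaining sum can be divided by g0. *)
Lemma fibre_monomials_independent (R : realFieldType) (m d N : nat) (h : R)
    (l g0 : mpoly m R) (g : d.-tuple (mpoly m R)) :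
  0 < h -> g0 != 0 ->
  (forall w : 'I_d -> R, (forall i, `|w i| < h) ->
    exists x : 'I_N -> 'I_m -> R,
      [/\ forall i, meval (x i) g0 = 0,
          forall i k, meval (x i) (tnth g k) = w k &
          injective (fun i => meval (x i) l)]) ->
  forall (K : nat) (C : nat -> 'I_N -> mpoly d R),
    \sum_(k < K) g0 ^+ k * (\sum_(j < N) l ^+ j * comp_mpoly g (C k j)) = 0 ->
    forall k j, (k < K)%N -> C k j = 0.
Proof.
move=> h0 g00 fib; elim=> [//|K IH] C.
rewrite big_ord_recl expr0 mul1r => sum0.
pose S := \sum_(k < K) g0 ^+ k * (\sum_(j < N) l ^+ j * comp_mpoly g (C k.+1 j)).
have {}sum0 : \sum_(j < N) l ^+ j * comp_mpoly g (C 0%N j) + g0 * S = 0.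
  rewrite -[RHS]sum0; congr (_ + _); rewrite /S mulr_sumr; apply: eq_bigr => k _.
  by rewrite mulrA -exprS.
have C0 j : C 0%N j = 0.
  apply: (mpoly_eq0_near0 h0) => w wh; have [x [xg0 xg xl]] := fib w wh.
  apply: (powers_independent xl (c := fun j => meval w (C 0%N j))) => i.
  have := congr1 (meval (x i)) sum0.
  rewrite mevalD mevalM xg0 mul0r addr0 meval0 raddf_sum; apply: etrans.
  apply: eq_bigr => k _; rewrite /= mevalM rmorphXn comp_mpoly_meval; congr (_ * _).
  by apply: meval_eq => a; rewrite xg.
have S0 : S = 0.
  apply/eqP; move: sum0; rewrite big1 ?add0r => [|j _]; last first.
    by rewrite C0 comp_mpoly0 mulr0.
  by move=> /eqP; rewrite mulf_eq0 (negPf g00).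
by case=> [|k] j ltk; [exact: C0 | exact: (IH (fun k => C k.+1))].
Qed.

(** * A Bezout bound for persistent zeros *)

Lemma mpoly_dependence_in (K : fieldType) (m D : nat) (I : finType)
    (A : {set I}) (F : I -> mpoly m K) :
  (forall i, i \in A -> (msize (F i) <= D)%N) ->
  (#|{: bmultinom m D}| < #|A|)%N ->
  exists c : I -> K, [/\ exists i, c i != 0, forall i, i \notin A -> c i = 0
    & \sum_i c i *: F i = 0].
Proof.
move=> szF ltDA.
have [] := @mpoly_dependence K m D 'I_#|A| (F \o enum_val).
- by move=> a; apply/szF/enum_valP.
- by rewrite card_ord.
move=> c [a ca] sumc; exists (fun i => \sum_(b | enum_val b == i) c b); split.
- exists (enum_val a); rewrite (big_pred1 a)// => b.
  by rewrite (inj_eq enum_val_inj).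
- move=> i iA; rewrite big_pred0// => b; apply: contraNF iA => /eqP <-.
  exact: enum_valP.
- under eq_bigr do rewrite scaler_suml.
  rewrite (exchange_big_dep predT)//= -[RHS]sumc; apply: eq_bigr => b _.
  by rewrite (big_pred1 (enum_val b))// => i; rewrite eq_sym.
Qed.

Section Degrees.
Variables (R : idomainType) (m : nat).
Implicit Types p q : mpoly m R.

Lemma msizeM_bound p q a b : (msize p <= a.+1)%N -> (msize q <= b.+1)%N ->
  (msize (p * q) <= (a + b).+1)%N.
Proof.
move=> pa qb.
have [->|p0] := eqVneq p 0; first by rewrite mul0r msize0.
have [->|q0] := eqVneq q 0; first by rewrite mulr0 msize0.
by rewrite msizeM//; have := leq_add pa qb; case: (_ + _)%N => //; lia.
Qed.

Lemma msizeX_bound p a k : (msize p <= a.+1)%N -> (msize (p ^+ k) <= (a * k).+1)%N.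
Proof.
move=> pa; elim: k => [|k IH]; first by rewrite expr0 msize1.
by rewrite exprS mulnS msizeM_bound.
Qed.

Lemma msize_prod_bound (I : finType) (F : I -> mpoly m R) (a : I -> nat) :
  (forall i, (msize (F i) <= (a i).+1)%N) ->
  (msize (\prod_i F i) <= (\sum_i a i).+1)%N.
Proof.
move=> Fa; elim/big_ind2: _ => [|p u q v pu qv|//]; first by rewrite msize1.
exact: msizeM_bound.
Qed.

End Degrees.

(** The products l ^ j * g0 ^ k * g ^ b with j < N are linearly
    independent. Those of degree at most T + N are thus not more numerous than
    the monomials of that degree, and the count of both for large T bounds N. *)
Lemma bezout_fibres (R : realFieldType) (d n N : nat) (h : R)
    (l g0 : mpoly d.+1 R) (g : d.-tuple (mpoly d.+1 R)) :
  (0 < n)%N -> (msize l <= 2)%N -> (msize g0 <= n)%N ->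
  (forall k, (msize (tnth g k) <= n.+1)%N) ->
  0 < h -> g0 != 0 ->
  (forall w : 'I_d -> R, (forall i, `|w i| < h) ->
    exists x : 'I_N -> 'I_d.+1 -> R,
      [/\ forall i, meval (x i) g0 = 0,
          forall i k, meval (x i) (tnth g k) = w k &
          injective (fun i => meval (x i) l)]) ->
  (N <= n ^ d * (n - 1))%N.
Proof.
move=> n0 sl sg0 sg h0 g00 fib.
have [->//|N0] := posnP N.
case: n n0 sg0 sg => [//|e] _ sg0 sg; rewrite subn1 mulnC /=.
(* A constant g0 with a zero would be zero; so g0 has positive degree. *)
have e0 : (0 < e)%N.
  rewrite lt0n; apply: contra g00 => /eqP e0.
  have [x [xg0 _ _]] := fib (fun=> 0) (fun=> eq_ind_r (fun r => r < h) h0 (normr0 _)).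
  rewrite e0 in sg0; rewrite (msize1_polyC sg0).
  have := xg0 (Ordinal N0).
  by rewrite (msize1_polyC sg0) mevalC mcoeffC eqxx mulr1 => ->; rewrite mpolyC0.
apply: bezout_count => // T; rewrite leqNgt; apply/negP.
pose F (y : 'I_N * ('I_T.+1 * bmultinom d T.+1)) : mpoly d.+1 R :=
  g0 ^+ y.2.1 * (l ^+ y.1 * comp_mpoly g (mpolyX R y.2.2)).
pose A := finset.setX (finset.setT : {set 'I_N}) (weighted_exponents d e e.+1 T).
have -> : (N * #|weighted_exponents d e e.+1 T| = #|A|)%N.
  by rewrite cardsX cardsT card_ord.
move=> /(mpoly_dependence_in (F := F))[].
  move=> [j [k b]]; rewrite !inE /= => kb.
  apply: (@leq_trans (e * k + (1 * j + e.+1 * mdeg b)).+1); last first.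
    by have := ltn_ord j; lia.
  apply: msizeM_bound; first exact: msizeX_bound.
  apply: msizeM_bound; first exact: msizeX_bound.
  rewrite comp_mpolyX mdegE big_distrr /=; apply: msize_prod_bound => i.
  exact: msizeX_bound.
move=> c [[[j [k b]] cjkb] _ sumc].
pose C (k : nat) (j : 'I_N) : mpoly d R :=
  \sum_(b : bmultinom d T.+1) c (j, (inord k, b)) *: mpolyX R b.
have C0 := fibre_monomials_independent h0 g00 fib (K := T.+1) (C := C).
have S0 : \sum_(k < T.+1) g0 ^+ k *
    (\sum_(j < N) l ^+ j * comp_mpoly g (C k j)) = 0.
  rewrite -[RHS]sumc.
  transitivity (\sum_(j < N) \sum_(k < T.+1) \sum_(b : bmultinom d T.+1)
      c (j, (k, b)) *: F (j, (k, b))); last first.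
    under eq_bigr do rewrite pair_bigA.
    by rewrite pair_bigA; apply: eq_bigr => -[? []].
  rewrite exchange_big /=.
  apply: eq_bigr => k' _; rewrite mulr_sumr; apply: eq_bigr => j' _.
  rewrite /C raddf_sum !mulr_sumr; apply: eq_bigr => b' _.
  by rewrite /= inord_val comp_mpolyZ -!scalerAr.
have := congr1 (mcoeff b) (C0 S0 k j (ltn_ord k)).
rewrite mcoeff0 raddf_sum (bigD1 b)//= mcoeffZ mcoeffX eqxx mulr1 inord_val.
rewrite big1 ?addr0 => [cE|b' b'b]; first by rewrite cE eqxx in cjkb.
by rewrite mcoeffZ mcoeffX (inj_eq val_inj) (negPf b'b) mulr0.
Qed.

Section DegreeOpen.
Variables (R : realType) (d : nat).
Implicit Types (f : 'rV[R]_d.+1 -> 'rV[R]_d.+1) (p : 'rV[R]_d.+1).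

(** A value v that is missed in U is vacuously a regular value, with an
    empty fibre. If it is also smaller than the values of f on the boundary of
    U, it makes the degree equal to 0. So no small v is missed, and since f is
    bounded away from 0 outside any neighborhood of p, the preimages lie close
    to p. *)
Lemma admissible_zero_open f p : continuous f -> admissible_zero f p ->
  forall V, nbhs p V -> nbhs (0 : 'rV[R]_d.+1) (f @` V).
Proof.
move=> fC [p0 fp0 [U [[oU bU] Up UH fU deg]]] V pV.
have [k [[_ _ _ degk] k0]] :
    exists k, is_brouwer_degree f U 0 k /\ k != 0.
  move: deg; rewrite /brouwer_degree; case: xgetP => [k _ kdeg k0|_].
    by exists k.
  by rewrite eqxx.
pose W := V° `&` U.
have Wp : W p by split; [exact: pV | exact: Up].
have oW : open W by apply: openI => //; exact: open_interior.
pose K := closure U `&` ~` W.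
have cK : compact K.
  apply: bounded_closed_compact.
    move: bU => [M [Mr MU]]; exists M; split=> // x Mx y [Uy _].
    have cB : closed [set z : 'rV[R]_d.+1 | `|z| <= x].
      by apply: closed_comp (@closed_le _ x) => ? _; exact: norm_continuous.
    have : closure U `<=` closure [set z : 'rV[R]_d.+1 | `|z| <= x].
      by apply: closure_subset => z Uz; exact: MU Mx z Uz.
    by rewrite -((closure_id _).1 cB) => /(_ y Uy).
  by apply: closedI; [exact: closed_closure | exact: open_closedC].
have cfK : closed (f @` K).
  apply: compact_closed; first exact: norm_hausdorff.
  by apply: continuous_compact => //; exact: continuous_subspaceT.
have : nbhs (0 : 'rV[R]_d.+1) (~` (f @` K)).
  apply: open_nbhs_nbhs; split; first exact: closed_openC.
  move=> [q [Uq Wq] fq0]; by apply: (fU q) => // qp; apply: Wq; rewrite qp; exact: Wp.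
move=> /nbhs_ballP[e /= e0 eK]; apply/nbhs_ballP; exists e => //= v ve.
apply: contrapT => vV.
have noU x : U x -> f x <> v.
  move=> Ux fxv; apply: (eK v) => //; exists x => //; split.
    exact: subset_closure.
  by move=> [/interior_subset Vx _]; apply: vV; exists x.
move: k0; rewrite -(degk v) ?fsbig1 ?eqxx//.
- by move=> x [Ux /= xv]; case: (noU _ Ux xv).
- by move=> x Ux xv; case: (noU _ Ux xv).
- move=> x [Ux Ux']; rewrite !subr0.
  have : ~ ball (0 : 'rV[R]_d.+1) e (f x).
    move=> /eK; apply; exists x => //; split=> //.
    by move=> [].
  move: ve; rewrite -!ball_normE /= !sub0r !normrN => ve /negP.
  by rewrite -leNgt; exact: lt_le_trans.
Qed.

End DegreeOpen.

Lemma continuous_meval (R : realType) (m : nat) (q : mpoly m R) :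
  continuous (fun x : 'rV[R]_m => meval (fun i => x ord0 i) q).
Proof.
rewrite (_ : (fun x => _) = fun x : 'rV[R]_m =>
    \sum_(k <- msupp q) mcoeff k q * \prod_i x ord0 i ^+ k i); last first.
  by apply/funext => x; rewrite mevalE.
apply: continuous_big => [|k _]; first exact: add_continuous.
have cprod : continuous (fun x : 'rV[R]_m => \prod_i x ord0 i ^+ k i).
  apply: continuous_big => [|i _]; first exact: mul_continuous.
  move=> x; apply: (@continuous_comp _ _ _ (fun x : 'rV[R]_m => x ord0 i) (fun t => t ^+ k i)).
    exact: coord_continuous.
  exact: exprn_continuous.
by move=> x; apply: continuousM; [exact: cst_continuous | exact: cprod].
Qed.

Lemma finite_gap (R : realType) (N : nat) (a : 'I_N -> R) : injective a ->
  exists2 e : R, 0 < e & forall i j, i != j -> e <= `|a i - a j|.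
Proof.
move=> a_inj.
have [e [e0 ae]] : exists e : R, 0 < e /\ forall i j, i != j -> e <= `|a i - a j|.
  near (0 : R)^'+ => e; exists e; split=> //.
  near: e; apply: filter_forall => i; apply: filter_forall => j.
  have [->|ij] := eqVneq i j; first exact: nearW.
  have aij : 0 < `|a i - a j|.
    by rewrite normr_gt0 subr_eq0 (inj_eq a_inj).
  by near=> e => _; near: e; exact: nbhs_right_le.
by exists e.
Unshelve. all: by end_near. Qed.

(** Two distinct points agree under the form sum_k x_k * t ^ k for finitely
    many t only. *)
Lemma separating_form (R : realType) (m N : nat) (p : 'I_N -> 'rV[R]_m) :
  injective p -> exists2 l : mpoly m R, (msize l <= 2)%N &
    injective (fun i => meval (fun k => p i ord0 k) l).
Proof.
move=> p_inj.
pose Q := \prod_(ij : 'I_N * 'I_N | ij.1 != ij.2) rVpoly (p ij.1 - p ij.2).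
have Q0 : Q != 0.
  apply/prodf_neq0 => -[i j] /= ij; apply: contra_neq ij => pij.
  apply: p_inj; apply/eqP; rewrite -subr_eq0; apply/eqP.
  by rewrite -[_ - _]rVpolyK pij linear0.
have [t Qt] : exists t, Q.[t] != 0.
  apply: contrapT => nt; move/eqP: Q0; apply; apply: (@poly_eq0_near0 _ _ 1) => // t _.
  by apply/eqP; apply: contrapT => /negP Qt; apply: nt; exists t.
exists (\sum_(k < m) t ^+ k *: mpolyX R (mnm1 k)).
  rewrite (leq_trans (msize_sum _ _ _))//; apply/bigmax_leqP => k _.
  by rewrite (leq_trans (msizeZ_le _ _))// msizeX mdeg1.
move=> i j; rewrite !raddf_sum /= => eqij.
apply/eqP; apply: contraNT Qt => ij; rewrite horner_prod.
apply/prodf_eq0; exists (i, j) => //=.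
rewrite /rVpoly horner_poly; apply/eqP.
rewrite (eq_bigr (fun k : 'I_m => t ^+ k * (p i ord0 k - p j ord0 k))) => [|k _]; last first.
  by rewrite valK !mxE mulrC.
under eq_bigr do rewrite mulrBr.
rewrite sumrB; apply/eqP; rewrite subr_eq0; apply/eqP.
move: eqij; congr (_ = _); apply: eq_bigr => k _; by rewrite /= mevalZ mevalXU.
Qed.

(** At each zero p i the map stays open, so near p i every small value
    whose first component is 0 is taken. There x_0 > 0, hence g0 = 0 and only
    the components of g are prescribed; this is why the degree of g0, and not
    that of x_0 * g0, enters the bound. *)
Lemma open_zeros_bound (R : realType) (d n N : nat) (g0 : mpoly d.+1 R)
    (g : d.-tuple (mpoly d.+1 R)) (f : 'rV[R]_d.+1 -> 'rV[R]_d.+1)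
    (p : 'I_N -> 'rV[R]_d.+1) :
  (0 < n)%N -> (msize g0 <= n)%N ->
  (forall k, (msize (tnth g k) <= n.+1)%N) ->
  (forall x, f x ord0 ord0 = x ord0 ord0 * ev x g0) ->
  (forall x k, f x ord0 (lift ord0 k) = ev x (tnth g k)) ->
  injective p -> (forall i, half_space (p i)) ->
  (forall i V, nbhs (p i) V -> nbhs (0 : 'rV[R]_d.+1) (f @` V)) ->
  (N <= n ^ d * (n - 1))%N.
Proof.
move=> n0 sg0 sg f0E fE p_inj pH pO.
have [l sl l_inj] := separating_form p_inj.
have [e e0 gap] := finite_gap l_inj.
pose V i := @half_space R d `&` [set x | `|ev x l - ev (p i) l| < e / 2].
have pV i : nbhs (p i) (V i).
  apply: filterI.
    have c0 : continuous (fun x : 'rV[R]_d.+1 => x ord0 ord0) by exact: coord_continuous.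
    apply: (c0 (p i) [set t | 0 < t]); exact: lt_nbhsr (pH i).
  have /cvgrPdist_lt/(_ (e / 2)) := @continuous_meval R _ l (p i).
  rewrite divr_gt0// => /(_ isT); apply: filterS => x /=.
  by rewrite distrC.
have [h [h0 hV]] : exists h : R, 0 < h /\ forall i, ball (0 : 'rV[R]_d.+1) h `<=` f @` V i.
  near (0 : R)^'+ => h; exists h; split=> //.
  near: h; apply: filter_forall => i.
  have /nbhs_ballP[h /= h0 hV] := pO i _ (pV i).
  apply: filterS (nbhs_right_le h0) => r rh.
  by apply: subset_trans hV; exact: le_ball.
have [->//|N0] := posnP N.
apply: (bezout_fibres (h := h) (l := l) (g0 := g0) (g := g)) => //.
(* The map also takes values with nonzero first component, so g0 is not
   zero. *)
- have : ball (0 : 'rV[R]_d.+1) h (const_mx (h / 2)).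
    split=> // i j; rewrite !mxE /ball /= sub0r normrN gtr0_norm ?divr_gt0//.
    by rewrite ltr_pdivrMr// ltr_pMr// ltr1n.
  move=> /(hV (Ordinal N0)) [x [xH _] /(congr1 (fun v : 'rV__ => v ord0 ord0))].
  rewrite f0E mxE; apply: contra_eqN => /eqP ->; rewrite meval0 mulr0 eq_sym.
  by rewrite gt_eqF// divr_gt0.
- move=> w wh.
  pose v : 'rV[R]_d.+1 := \row_k (if unlift ord0 k is Some j then w j else 0).
  have vh : ball (0 : 'rV[R]_d.+1) h v.
    split=> // i j; rewrite !mxE /ball /= sub0r normrN.
    by case: unliftP => [k _|_]; rewrite ?wh ?normr0.
  have /choice[x xP] : forall i, exists x, V i x /\ f x = v.
    by move=> i; have [x Vx xv] := hV i _ vh; exists x.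
  exists (fun i k => x i ord0 k); split.
  + move=> i; have [[xH _] /(congr1 (fun v : 'rV__ => v ord0 ord0))] := xP i.
    rewrite f0E mxE unlift_none => /eqP; rewrite mulf_eq0 gt_eqF//=.
    by move/eqP.
  + move=> i k; have [_ /(congr1 (fun v : 'rV__ => v ord0 (lift ord0 k)))] := xP i.
    by rewrite fE mxE liftK.
  + move=> i j /= lij; apply/eqP; apply: contraT => /gap.
    have [[_ /= xi] _] := xP i; have [[_ /= xj] _] := xP j.
    rewrite leNgt; case/negP.
    rewrite [e]splitr (le_lt_trans _ (ltrD xi xj))//.
    by rewrite lij [X in _ <= X + _]distrC (le_trans _ (ler_normD _ _))// addrA subrK.
Unshelve. all: by end_near. Qed.

(** * The averaged function is polynomial *)

Section ContinuousFunctions.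
Variables (R : realType) (T : topologicalType).
Implicit Types f g : T -> R.

Lemma continuous_add f g : continuous f -> continuous g ->
  continuous (fun x => f x + g x).
Proof. by move=> fC gC x; apply: continuousD; [exact: fC | exact: gC]. Qed.

Lemma continuous_sub f g : continuous f -> continuous g ->
  continuous (fun x => f x - g x).
Proof. by move=> fC gC x; apply: continuousB; [exact: fC | exact: gC]. Qed.

Lemma continuous_mul f g : continuous f -> continuous g ->
  continuous (fun x => f x * g x).
Proof. by move=> fC gC x; apply: continuousM; [exact: fC | exact: gC]. Qed.

Lemma continuous_expr f k : continuous f -> continuous (fun x => f x ^+ k).
Proof.
move=> fC x; apply: (@continuous_comp _ _ _ f (fun t => t ^+ k)).
  exact: fC.
exact: exprn_continuous.
Qed.

End ContinuousFunctions.

Section ContinuousIntegrals.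
Variable R : realType.
Implicit Types (f g : R -> R) (a b : R).
Local Notation mu := (@lebesgue_measure R).

Lemma continuous_integrable a b f : continuous f ->
  mu.-integrable `[a, b] (EFin \o f).
Proof.
move=> fC; apply: continuous_compact_integrable; first exact: segment_compact.
exact: continuous_subspaceT.
Qed.

Lemma Rintegral_sum (I : Type) (s : seq I) (F : I -> R -> R) a b :
  (forall i, continuous (F i)) ->
  \int[mu]_(x in `[a, b]) (\sum_(i <- s) F i x) =
  \sum_(i <- s) \int[mu]_(x in `[a, b]) F i x.
Proof.
move=> FC; elim: s => [|i s IH].
  rewrite big_nil -[RHS](mul0r (fine (mu `[a, b]))) -Rintegral_cst//.
  by apply: eq_Rintegral => x _; rewrite big_nil.
rewrite big_cons -IH -RintegralD//; try exact: continuous_integrable.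
  by apply: eq_Rintegral => x _; rewrite big_cons.
apply: continuous_integrable; apply: continuous_big => //.
exact: add_continuous.
Qed.

End ContinuousIntegrals.

Lemma continuous_matrix (R : realType) (T : topologicalType) (k l : nat)
    (f : 'I_k -> 'I_l -> T -> R) :
  (forall i j, continuous (f i j)) ->
  continuous (fun x => \matrix_(i, j) f i j x : 'M[R]_(k, l)).
Proof.
move=> fC x A [B Bx BA].
have Fx : Filter (nbhs x) := @nbhs_filter _ x.
have : nbhs x [set y | forall i j, B i j (f i j y)].
  apply: (@filter_forall _ _ (fun i y => forall j, B i j (f i j y)) (nbhs x) Fx) => i.
  apply: (@filter_forall _ _ (fun j y => B i j (f i j y)) (nbhs x) Fx) => j.
  apply: (fC i j x (B i j)).
  by have := Bx i j; rewrite mxE.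
by apply: filterS => y By; apply: BA => i j; rewrite mxE.
Qed.

Lemma continuous_row (R : realType) (T : topologicalType) (k : nat) (f : 'I_k -> T -> R) :
  (forall i, continuous (f i)) -> continuous (fun x => \row_i f i x : 'rV[R]_k).
Proof. by move=> fC; apply: (@continuous_matrix _ _ _ _ (fun=> f)). Qed.

Section PolarIntegral.
Variables (R : realType) (d : nat).
Local Notation mu := (@lebesgue_measure R).

(** The exponent of (r, z) produced by the monomial m of (x, y, z); e is
    the identity, or the predecessor once a factor r has been taken out. *)
Definition polar_exponent (e : nat -> nat) (m : multinom d.+2) : multinom d.+1 :=
  Multinom [tuple (if unlift ord0 i is Some l then m (iz l)
                   else e (m ix + m iy)%N) | i < d.+1].

Lemma meval_polar_exponent (e : nat -> nat) (m : multinom d.+2) (p : 'rV[R]_d.+1) :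
  ev p (mpolyX R (polar_exponent e m)) =
  p ord0 ord0 ^+ e (m ix + m iy)%N * \prod_l p ord0 (lift ord0 l) ^+ m (iz l).
Proof.
rewrite mevalX big_ord_recl multinomE tnth_mktuple unlift_none; congr (_ * _).
by apply: eq_bigr => l _; rewrite multinomE tnth_mktuple liftK.
Qed.

Lemma mdeg_polar_exponent (e : nat -> nat) (m : multinom d.+2) :
  (mdeg (polar_exponent e m) + (m ix + m iy) = mdeg m + e (m ix + m iy))%N.
Proof.
have mE (l : 'I_d) : polar_exponent e m (lift ord0 l) = m (iz l).
  by rewrite multinomE tnth_mktuple liftK.
rewrite !mdegE !big_ord_recl multinomE tnth_mktuple unlift_none -/ix -/iy.
rewrite (eq_bigr (fun l => m (iz l))) => [|l _]; last by rewrite -mE.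
have <- : (\sum_l m (iz l) = \sum_(i < d) m (lift ord0 (lift ord0 i)))%N by [].
by lia.
Qed.

Lemma peval_polar (q : mpoly d.+2 R) (t : R) (p : 'rV[R]_d.+1) :
  peval q (polar t p) = \sum_(m <- msupp q) mcoeff m q *
    (ev p (mpolyX R (polar_exponent id m)) * (cos t ^+ m ix * sin t ^+ m iy)).
Proof.
rewrite /peval mevalE; apply: eq_bigr => m _; congr (_ * _).
rewrite !big_ord_recl meval_polar_exponent exprD -/ix -/iy.
have -> : polar t p ord0 ix = p ord0 ord0 * cos t by rewrite mxE.
have -> : polar t p ord0 iy = p ord0 ord0 * sin t by rewrite mxE /= liftK.
rewrite (eq_bigr (fun l => p ord0 (lift ord0 l) ^+ m (iz l))); last first.
  by move=> l _; rewrite mxE /= liftK.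
by rewrite !exprMn; ring.
Qed.

Lemma Rintegral_polar (q : mpoly d.+2 R) (k : R -> R) (a b : R) (p : 'rV[R]_d.+1) :
  continuous k ->
  \int[mu]_(t in `[a, b]) (k t * peval q (polar t p)) =
  \sum_(m <- msupp q) mcoeff m q *
     (\int[mu]_(t in `[a, b]) (k t * (cos t ^+ m ix * sin t ^+ m iy))) *
     ev p (mpolyX R (polar_exponent id m)).
Proof.
move=> kC.
have kmC (m : multinom d.+2) : continuous (fun t => k t * (cos t ^+ m ix * sin t ^+ m iy)).
  apply: continuous_mul => //; apply: continuous_mul; apply: continuous_expr;
    [exact: continuous_cos | exact: continuous_sin].
under eq_Rintegral => t _ do rewrite peval_polar mulr_sumr.
have termE (m : multinom d.+2) t : k t * (mcoeff m q *
    (ev p (mpolyX R (polar_exponent id m)) * (cos t ^+ m ix * sin t ^+ m iy))) =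
    mcoeff m q * ev p (mpolyX R (polar_exponent id m)) *
    (k t * (cos t ^+ m ix * sin t ^+ m iy)) by ring.
under eq_Rintegral => t _ do under eq_bigr => m _ do rewrite termE.
rewrite Rintegral_sum; last first.
  by move=> m; apply: continuous_mul; [exact: cst_continuous | exact: kmC].
apply: eq_bigr => m _; rewrite RintegralZl//; last exact: continuous_integrable.
by rewrite mulrAC.
Qed.

(** Each monomial of q contributes a monomial of the same degree in (r, z),
    whose coefficient is a trigonometric integral. *)
Lemma polar_integral (q : mpoly d.+2 R) (k : R -> R) (a b : R) (n : nat) :
  continuous k -> (msize q <= n.+1)%N ->
  exists2 h : mpoly d.+1 R, (msize h <= n.+1)%N &
    forall p, \int[mu]_(t in `[a, b]) (k t * peval q (polar t p)) = ev p h.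
Proof.
move=> kC sq; exists (\sum_(m <- msupp q) (mcoeff m q *
     (\int[mu]_(t in `[a, b]) (k t * (cos t ^+ m ix * sin t ^+ m iy)))) *:
     mpolyX R (polar_exponent id m)).
  rewrite (leq_trans (msize_sum _ _ _))// big_seq_cond.
  apply/bigmax_leqP_seq => m; rewrite andbT => mq _.
  rewrite (leq_trans (msizeZ_le _ _))// msizeX (leq_trans _ sq)//.
  rewrite (leq_trans _ (msize_mdeg_lt mq))// ltnS.
  by have := mdeg_polar_exponent id m; lia.
move=> p; rewrite Rintegral_polar// raddf_sum /=; apply: eq_bigr => m _.
by rewrite mevalZ.
Qed.

(** Every monomial that occurs in q contains x or y, which provides the
    factor r. *)
Lemma polar_integral_no_pure_z (q : mpoly d.+2 R) (k : R -> R) (a b : R) (n : nat) :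
  continuous k -> (msize q <= n.+1)%N -> no_pure_z q ->
  exists2 h : mpoly d.+1 R, (msize h <= n)%N &
    forall p, \int[mu]_(t in `[a, b]) (k t * peval q (polar t p)) =
              p ord0 ord0 * ev p h.
Proof.
move=> kC sq qz; exists (\sum_(m <- msupp q) (mcoeff m q *
     (\int[mu]_(t in `[a, b]) (k t * (cos t ^+ m ix * sin t ^+ m iy)))) *:
     mpolyX R (polar_exponent predn m)).
  rewrite (leq_trans (msize_sum _ _ _))// big_seq_cond.
  apply/bigmax_leqP_seq => m; rewrite andbT => mq _.
  rewrite (leq_trans (msizeZ_le _ _))// msizeX.
  have := mdeg_polar_exponent predn m; have := msize_mdeg_lt mq.
  have : (0 < m ix + m iy)%N.
    rewrite lt0n addn_eq0; apply: contraTN mq => /andP[/eqP mx /eqP my].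
    by rewrite -mcoeff_eq0 qz ?eqxx.
  by move: sq; rewrite /=; lia.
move=> p; rewrite Rintegral_polar// raddf_sum /= mulr_sumr.
rewrite !big_seq; apply: eq_bigr => m mq; rewrite mevalZ !meval_polar_exponent.
have [s0|s0] := posnP (m ix + m iy)%N.
  move/eqP: s0; rewrite addn_eq0 => /andP[/eqP mx /eqP my].
  by rewrite qz// !mul0r mulr0.
by rewrite -[in LHS](prednK s0) exprS; ring.
Qed.

End PolarIntegral.

Section UpperBound.
Variables (R : realType) (d n : nat).
Implicit Types P Q : 'I_d.+2 -> mpoly d.+2 R.
Local Notation mu := (@lebesgue_measure R).

Lemma continuous_peval_polar (q : mpoly d.+2 R) (p : 'rV[R]_d.+1) :
  continuous (fun t => peval q (polar t p)).
Proof.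
move=> t; apply: (@continuous_comp _ _ _ (fun t => polar t p)); last exact: continuous_meval.
apply: continuous_row => i; case: (i == ix).
  by apply: continuous_mul; [exact: cst_continuous | exact: continuous_cos].
case: (unlift ord0 i) => [j|]; last exact: cst_continuous.
case: (j == ord0); last exact: cst_continuous.
by apply: continuous_mul; [exact: cst_continuous | exact: continuous_sin].
Qed.

Lemma half_averaged_radial P (a b : R) : perturbation n P ->
  exists2 h : mpoly d.+1 R, (msize h <= n)%N &
    forall p, \int[mu]_(t in `[a, b]) polar_rhs P t p ord0 ord0 =
      p ord0 ord0 * ev p h.
Proof.
move=> [sP Px Py].
have [hx shx hxE] := polar_integral_no_pure_z a b (@continuous_cos R) (sP ix) Px.
have [hy shy hyE] := polar_integral_no_pure_z a b (@continuous_sin R) (sP iy) Py.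
exists (hx + hy); first by rewrite (leq_trans (msizeD_le _ _))// geq_max shx.
move=> p; rewrite mevalD mulrDr -hxE -hyE -RintegralD//.
- by apply: eq_Rintegral => t _; rewrite mxE eqxx.
- apply: continuous_integrable; apply: continuous_mul; first exact: continuous_cos.
  exact: continuous_peval_polar.
- apply: continuous_integrable; apply: continuous_mul; first exact: continuous_sin.
  exact: continuous_peval_polar.
Qed.

Lemma half_averaged_z P (a b : R) (l : 'I_d) : perturbation n P ->
  exists2 h : mpoly d.+1 R, (msize h <= n.+1)%N &
    forall p, \int[mu]_(t in `[a, b]) polar_rhs P t p ord0 (lift ord0 l) = ev p h.
Proof.
move=> [sP _ _].
have [h sh hE] := polar_integral a b (@cst_continuous _ _ (1 : R)) (sP (iz l)).
exists h => // p; rewrite -hE; apply: eq_Rintegral => t _.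
by rewrite mxE /= mul1r.
Qed.

Lemma averaged_polynomial P Q : perturbation n P -> perturbation n Q ->
  exists (g0 : mpoly d.+1 R) (g : d.-tuple (mpoly d.+1 R)),
    [/\ (msize g0 <= n)%N, forall l, (msize (tnth g l) <= n.+1)%N &
        averaged P Q = fun p => \row_i (if unlift ord0 i is Some l then
            ev p (tnth g l) else p ord0 ord0 * ev p g0)].
Proof.
move=> hP hQ.
have [g0 sg0 g0E] := half_averaged_radial 0 pi hP.
have [g0' sg0' g0E'] := half_averaged_radial pi (2 * pi) hQ.
have /choice[g gP] : forall l, exists h : mpoly d.+1 R, (msize h <= n.+1)%N /\
    forall p, \int[mu]_(t in `[0, pi]) polar_rhs P t p ord0 (lift ord0 l) +
      \int[mu]_(t in `[pi, 2 * pi]) polar_rhs Q t p ord0 (lift ord0 l) = ev p h.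
  move=> l.
  have [h sh hE] := half_averaged_z 0 pi l hP.
  have [h' sh' hE'] := half_averaged_z pi (2 * pi) l hQ.
  exists (h + h'); split=> [|p]; last by rewrite mevalD hE hE'.
  by rewrite (leq_trans (msizeD_le _ _))// geq_max sh.
exists (g0 + g0'), (mktuple g); split.
- by rewrite (leq_trans (msizeD_le _ _))// geq_max sg0.
- by move=> l; rewrite tnth_mktuple; have [] := gP l.
apply/funext => p; apply/rowP => i; rewrite !mxE.
case: unliftP => [l ->|->]; first by rewrite tnth_mktuple; have [_ ->] := gP l.
by rewrite mevalD (mulrDr (p ord0 ord0)) g0E g0E'.
Qed.

(** An infinite set would contain arbitrarily large finite families of
    distinct points. *)
Lemma card_le_I (T : pointedType) (A : set T) (B : nat) :
  (forall (N : nat) (p : 'I_N -> T), injective p -> (forall i, A (p i)) -> (N <= B)%N) ->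
  (A #<= `I_B)%card.
Proof.
move=> AB.
have IA N : (`I_N #<= A)%card -> (N <= B)%N.
  move=> /pcard_leP[f]; apply: (AB N (fun i => f i)) => [i j fij|i].
    by apply: val_inj; apply: (@inj _ _ _ f); rewrite ?inE //= ltn_ord.
  by apply: (@funS _ _ _ _ f) => /=; rewrite ltn_ord.
have [/finite_setP[k Ak]|/infiniteP natA] := pselect (finite_set A).
  have [A_k k_A] := (card_eqPle _ _).1 Ak.
  apply: card_le_trans A_k _; apply: subset_card_le => i /=.
  by move=> /leq_trans; apply; exact: IA.
have /IA : (`I_B.+1 #<= A)%card.
  by apply: card_le_trans natA; exact: subset_card_le.
by rewrite ltnn.
Qed.

Theorem card_admissible_zeros P Q : (0 < n)%N -> perturbation n P -> perturbation n Q ->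
  ([set p | admissible_zero (averaged P Q) p] #<= `I_(n ^ d * (n - 1)))%card.
Proof.
move=> n0 hP hQ; have [g0 [g [sg0 sg fE]]] := averaged_polynomial hP hQ.
apply: card_le_I => N p p_inj pA.
apply: (@open_zeros_bound _ _ _ _ g0 g (averaged P Q) p) => //.
- by move=> x; rewrite fE mxE unlift_none.
- by move=> x k; rewrite fE mxE liftK.
- by move=> i; have [] := pA i.
- move=> i V; apply: admissible_zero_open; last exact: pA.
  rewrite fE; apply: continuous_row => j; case: unliftP => [l _|_].
    exact: continuous_meval.
  by apply: continuous_mul; [exact: coord_continuous | exact: continuous_meval].
Qed.

End UpperBound.

(** * Calculus on the line *)

Section Primitive.
Variable R : realType.
Implicit Types (f g h : R -> R) (a b s t : R).
Local Notation mu := (@lebesgue_measure R).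

Lemma Rintegral_chasles h a b c : continuous h -> a <= b -> b <= c ->
  \int[mu]_(x in `[a, c]) h x = \int[mu]_(x in `[a, b]) h x + \int[mu]_(x in `[b, c]) h x.
Proof.
move=> hC ab bc.
have hI := continuous_integrable a c hC.
apply/eqP; rewrite -subr_eq addrC.
have -> : \int[mu]_(x in `[b, c]) h x = \int[mu]_(x in `]b, c]) h x.
  rewrite -Rintegral_itv_obnd_cbnd//.
  by apply: integrableS (continuous_integrable b c hC) => //; exact: subset_itv_oc_cc.
by rewrite -(@Rintegral_itvB _ _ (BLeft a) (BRight c) b)//; apply/eqP; ring.
Qed.

(** The second integral extends the primitive to negative t, for which the
    first one is 0. *)
Definition prim h t : R :=
  \int[mu]_(x in `[0, t]) h x - \int[mu]_(x in `[t, 0]) h x.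

Lemma prim0 h : prim h 0 = 0.
Proof. by rewrite /prim subrr. Qed.

Lemma primE h a t : continuous h -> a <= 0 -> a <= t ->
  prim h t = \int[mu]_(x in `[a, t]) h x - \int[mu]_(x in `[a, 0]) h x.
Proof.
move=> hC a0 at_; rewrite /prim.
have [t0|t0] := leP 0 t.
  rewrite (Rintegral_chasles hC a0 t0) [RHS]addrAC subrr add0r.
  have [->|t_0] := eqVneq t 0; first by rewrite set_itv1 Rintegral_set1 subrr.
  rewrite (@set_itv_ge _ _ (BLeft t)) ?Rintegral_set0 ?subr0// bnd_simp -ltNge.
  by rewrite lt_neqAle t0 andbT eq_sym t_0.
rewrite (Rintegral_chasles hC at_ (ltW t0)) opprD addrA subrr.
by rewrite (@set_itv_ge _ _ (BLeft 0)) ?Rintegral_set0// bnd_simp -ltNge.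
Qed.

Lemma is_derive_prim h t : continuous h -> is_derive t (1 : R) (prim h) (h t).
Proof.
move=> hC; pose a := - (`|t| + 1).
have a0 : a <= 0 by rewrite oppr_le0 addr_ge0.
have a_t : a < t.
  by rewrite /a ltrNl (le_lt_trans (ler_norm _))// normrN ltrDl.
pose F (x : R) := \int[mu]_(y in `[a, x]) h y - \int[mu]_(x in `[a, 0]) h x.
have tt1 : t < t + 1 by rewrite ltrDl.
have [dF F'] := continuous_FTC1_closed tt1 (continuous_integrable _ _ hC) a_t (hC t).
apply: (@near_eq_is_derive _ _ _ F); last first.
  rewrite -[h t]subr0; apply: is_deriveB.
  by apply: DeriveDef => //; rewrite -derive1E.
by apply: filterS (lt_nbhsr a_t) => x ax; rewrite /F -primE// ltW.
Qed.

Lemma is_derive_continuous f (f' : R -> R) :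
  (forall t, is_derive t (1 : R) f (f' t)) -> continuous f.
Proof.
move=> fD t; apply/differentiable_continuous/derivable1_diffP.
by have [] := fD t.
Qed.

Lemma is_derive_cst_eq f g h : (forall t, is_derive t (1 : R) f (h t)) ->
  (forall t, is_derive t (1 : R) g (h t)) -> forall s t, f t - f s = g t - g s.
Proof.
move=> fD gD s t.
have : (f - g) t = (f - g) s.
  by apply: is_derive_0_is_cst => x; rewrite -(subrr (h x)); exact: is_deriveB.
rewrite -![(_ - _ : _ -> _) _]/(_ - _) => fg.
by apply/eqP; rewrite subr_eq addrAC -subr_eq opprK addrC; apply/eqP; lra.
Qed.

Lemma prim_diff h s t : continuous h -> s <= t ->
  prim h t - prim h s = \int[mu]_(x in `[s, t]) h x.
Proof.
move=> hC st; pose a := Num.min 0 s.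
have a0 : a <= 0 by rewrite ge_min lexx.
have as_ : a <= s by rewrite ge_min lexx orbT.
rewrite (primE hC a0 as_) (primE hC a0 (le_trans as_ st)).
by rewrite (Rintegral_chasles hC as_ st); ring.
Qed.

Lemma integral_derivative f h s t : continuous h ->
  (forall x, is_derive x (1 : R) f (h x)) -> s <= t ->
  f t - f s = \int[mu]_(x in `[s, t]) h x.
Proof.
move=> hC fD st; rewrite -prim_diff//.
by apply: is_derive_cst_eq fD _ _ _ => x; exact: is_derive_prim.
Qed.

Lemma continuous_integral_eq f h :
  (forall s t, s <= t -> mu.-integrable `[s, t] (fun x => (h x)%:E) /\
    f t - f s = \int[mu]_(x in `[s, t]) h x) ->
  continuous f.
Proof.
move=> fh t.
have tt : t - 1 < t + 1 by lra.
have [hI _] := fh _ _ (ltW tt).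
have /(continuous_within_itvP _ tt)[FC _ _] :=
  parameterized_integral_continuous (ltW tt) hI.
have tin : t \in `]t - 1, t + 1[ by rewrite in_itv /=; apply/andP; split; lra.
pose F (x : R) : R := parameterized_integral mu (t - 1) x h.
have {}FC : {for t, continuous F} := FC t tin.
have fE x : x \in `]t - 1, t + 1[ ->
    f x = F x + f (t - 1).
  rewrite in_itv /= => /andP[tx _]; have [_ fx] := fh _ _ (ltW tx).
  by rewrite /F /parameterized_integral -fx subrK.
have : {for t, continuous (fun x => F x + f (t - 1))}.
  by apply: continuousD; [exact: FC | exact: cst_continuous].
rewrite /prop_for /continuous_at -fE//; apply: cvg_trans; apply: near_eq_cvg.
by apply: filterS (near_in_itvoo tin) => x /fE ->.
Qed.

Lemma is_derive_integral_eq f h : continuous h ->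
  (forall s t, s <= t -> f t - f s = \int[mu]_(x in `[s, t]) h x) ->
  forall t, is_derive t (1 : R) f (h t).
Proof.
move=> hC fh t.
have fE x : f x = prim h x + f 0.
  apply/eqP; rewrite -subr_eq; apply/eqP.
  have [x0|/ltW x0] := leP 0 x; first by rewrite fh// -prim_diff// prim0 subr0.
  by apply: oppr_inj; rewrite opprB fh// -prim_diff// prim0 sub0r.
rewrite (_ : f = (fun x => prim h x + f 0)); last exact/funext.
rewrite -[h t]addr0; apply: is_deriveD; exact: is_derive_prim.
Qed.

End Primitive.

Section ScalarTools.
Variable R : realType.
Implicit Types (f g h u : R -> R).

Lemma derive_add f g (f' g' t : R) : is_derive t (1 : R) f f' ->
  is_derive t (1 : R) g g' -> is_derive t (1 : R) (fun x => f x + g x) (f' + g').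
Proof. by move=> fD gD; exact: is_deriveD. Qed.

Lemma derive_sub f g (f' g' t : R) : is_derive t (1 : R) f f' ->
  is_derive t (1 : R) g g' -> is_derive t (1 : R) (fun x => f x - g x) (f' - g').
Proof. by move=> fD gD; exact: is_deriveB. Qed.

Lemma derive_mul f g (f' g' t : R) : is_derive t (1 : R) f f' ->
  is_derive t (1 : R) g g' ->
  is_derive t (1 : R) (fun x => f x * g x) (f' * g t + f t * g').
Proof.
move=> fD gD; have := is_deriveM fD gD.
by rewrite addrC [g t *: f']mulrC.
Qed.

Lemma derive_const (c t : R) : is_derive t (1 : R) (fun=> c) 0.
Proof. exact: is_derive_cst. Qed.

Lemma derive_scale f (c f' t : R) : is_derive t (1 : R) f f' ->
  is_derive t (1 : R) (fun x => c * f x) (c * f').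
Proof.
by move=> /(derive_mul (derive_const c t)); rewrite mul0r add0r.
Qed.

Lemma derive_id (t : R) : is_derive t (1 : R) (fun x => x) 1.
Proof. exact: is_derive_id. Qed.

Lemma derive_translate (c t : R) : is_derive t (1 : R) (fun x => x + c) 1.
Proof. by have := derive_add (derive_id t) (derive_const c t); rewrite addr0. Qed.

Lemma derive_comp f g (f' g' t : R) : is_derive (g t) (1 : R) f f' ->
  is_derive t (1 : R) g g' -> is_derive t (1 : R) (fun x => f (g x)) (f' * g').
Proof. by move=> fD gD; exact: is_derive1_comp. Qed.

Lemma mean_value f (f' : R -> R) s t : (forall x, is_derive x (1 : R) f (f' x)) ->
  s <= t -> exists2 c, s <= c <= t & f t - f s = f' c * (t - s).
Proof.
move=> fD st; have [|c cst fE] := @MVT_segment R f f' s t st.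
  exact/continuous_subspaceT/(is_derive_continuous fD).
by exists c => //; move: cst; rewrite in_itv.
Qed.

Lemma lipschitz_bound f (f' : R -> R) c s t :
  (forall x, is_derive x (1 : R) f (f' x)) -> (forall x, `|f' x| <= c) ->
  `|f t - f s| <= c * `|t - s|.
Proof.
move=> fD f'c; wlog st : s t / s <= t => [H|].
  by have [/H//|/ltW /H] := leP s t; rewrite distrC [`|s - t|]distrC.
by have [x _ ->] := mean_value fD st; rewrite normrM ler_wpM2r.
Qed.

Lemma prim_dist g h c t : continuous g -> continuous h ->
  (forall x, `|g x - h x| <= c) -> `|prim g t - prim h t| <= c * `|t|.
Proof.
move=> gC hC gh.
have D x : is_derive x (1 : R) (prim g - prim h) (g x - h x).
  by apply: is_deriveB; exact: is_derive_prim.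
have := lipschitz_bound 0 t D gh.
by rewrite -![(_ - _ : _ -> _) _]/(_ - _) !prim0 subrr !subr0.
Qed.

Lemma prim_shift h P t : continuous h -> (forall x, h (x + P) = h x) ->
  prim h (t + P) = prim h t + prim h P.
Proof.
move=> hC hP.
have D x : is_derive x (1 : R) (fun x => prim h (x + P)) (h x).
  rewrite -[h x]mulr1 -hP; apply: derive_comp; last exact: derive_translate.
  exact: is_derive_prim.
have := is_derive_cst_eq D (fun x => is_derive_prim x hC) 0 t.
by rewrite add0r prim0 subr0 => <-; rewrite subrK.
Qed.

(** The derivative of eps * k * D ^ 2 is at least 2 * eps ^ 2 * (`|k| *
    (`|k| - lam)) * D ^ 2. This function is thus monotone, and being periodic
    it is constant. *)
Lemma periodic_rigidity (D e : R -> R) (eps k lam T : R) :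
  eps != 0 -> 0 <= lam -> lam < `|k| -> 0 < T -> (forall t, D (t + T) = D t) ->
  (forall t, is_derive t (1 : R) D (eps * (k * D t + e t))) ->
  (forall t, `|e t| <= lam * `|D t|) -> forall t, D t = 0.
Proof.
move=> eps0 lam0 lamk T0 DT D' eD.
have k0 : k != 0 by rewrite -normr_gt0 (le_lt_trans lam0).
pose E t := eps * k * (D t * D t).
pose E' t := 2 * eps ^+ 2 * (k * D t) * (k * D t + e t).
have ED t : is_derive t (1 : R) E (E' t).
  suff -> : E' t = eps * k * (eps * (k * D t + e t) * D t + D t * (eps * (k * D t + e t))).
    exact: derive_scale (derive_mul (D' t) (D' t)).
  by rewrite /E'; ring.
have E'ge t : 2 * eps ^+ 2 * (`|k| * (`|k| - lam)) * `|D t| ^+ 2 <= E' t.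
  have -> : E' t = 2 * eps ^+ 2 * (k ^+ 2 * D t ^+ 2 + k * D t * e t).
    by rewrite /E'; ring.
  rewrite -[leLHS]mulrA ler_wpM2l ?(mulr_ge0 _ (sqr_ge0 _))//.
  rewrite -[k ^+ 2]real_normK ?num_real// -[D t ^+ 2]real_normK ?num_real//.
  have : - (`|k| * `|D t| * `|e t|) <= k * D t * e t.
    by have := ler_norm (- (k * D t * e t)); rewrite normrN !normrM; lra.
  have : `|k| * `|D t| * `|e t| <= `|k| * `|D t| * (lam * `|D t|).
    by rewrite ler_wpM2l.
  by lra.
have c0 : 0 < 2 * eps ^+ 2 * (`|k| * (`|k| - lam)).
  have e2 : 0 < eps ^+ 2 by rewrite exprn_even_gt0.
  apply: mulr_gt0; first exact: mulr_gt0.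
  by apply: mulr_gt0; rewrite ?normr_gt0 ?subr_gt0.
have E'0 t : 0 <= E' t.
  by apply: le_trans (E'ge t); rewrite mulr_ge0 ?sqr_ge0// ltW.
have E_le s t : s <= t -> E s <= E t.
  move=> st; have [c _ Ec] := mean_value ED st.
  by rewrite -subr_ge0 Ec mulr_ge0// subr_ge0.
have D0 c : E' c = 0 -> D c = 0.
  move=> E'c; apply/eqP; rewrite -normr_eq0 -[_ == 0](@expf_eq0 _ _ 2)//.
  by have := E'ge c; rewrite E'c pmulr_rle0// => D2; rewrite eq_le D2 sqr_ge0.
have ET t : E (t + T) = E t by rewrite /E DT.
move=> t; have tT : t <= t + T by rewrite lerDl ltW.
have [c /andP[tc cT]] := mean_value ED tT.
rewrite ET subrr addrAC subrr add0r => /esym/eqP; rewrite mulf_eq0 (gt_eqF T0) orbF.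
move=> /eqP/D0 Dc.
have Ec : E t = E c.
  by apply/eqP; rewrite eq_le E_le// -[leRHS]ET E_le.
move/eqP: Ec; rewrite /E Dc !mulr0 mulf_eq0 mulf_eq0 (negPf eps0) (negPf k0)/=.
by rewrite mulf_eq0 orbb => /eqP.
Qed.

(** The bounds x n - 2 c / 2 ^ n increase and x n + 2 c / 2 ^ n decrease,
    so the supremum of the former lies between them. *)
Lemma geometric_limit (x : nat -> R) (c : R) :
  (forall n, `|x n.+1 - x n| <= c / 2 ^+ n) ->
  exists l, forall n, `|x n - l| <= 2 * c / 2 ^+ n.
Proof.
move=> xc.
pose lo n := x n - 2 * c / 2 ^+ n; pose hi n := x n + 2 * c / 2 ^+ n.
have step n : c / 2 ^+ n = 2 * c / 2 ^+ n.+1.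
  by rewrite exprS; field; rewrite expf_neq0.
have step2 n : 2 * c / 2 ^+ n = c / 2 ^+ n + c / 2 ^+ n by field.
have loS n : lo n <= lo n.+1.
  have := xc n; rewrite /lo -step step2 ler_norml => /andP[]; lra.
have hiS n : hi n.+1 <= hi n.
  have := xc n; rewrite /hi -step step2 ler_norml => /andP[]; lra.
have c0 n : 0 <= 2 * c / 2 ^+ n.
  by have := le_trans (normr_ge0 _) (xc n); rewrite step2; lra.
have lo_le m n : (m <= n)%N -> lo m <= lo n.
  by move=> mn; have /nondecreasing_seqP := loS; exact.
have hi_le m n : (m <= n)%N -> hi n <= hi m.
  by move=> mn; have /nonincreasing_seqP := hiS; exact.
have lohi m n : lo m <= hi n.
  apply: le_trans (lo_le _ _ (leq_maxl m n)) (le_trans _ (hi_le _ _ (leq_maxr m n))).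
  by have := c0 (maxn m n); rewrite /lo /hi; lra.
exists (sup (range lo)) => n.
have lo_sup : lo n <= sup (range lo).
  apply: sup_upper_bound; last by exists n.
  by split; [exists (lo 0%N), 0%N | exists (hi 0%N) => _ [m _ <-]].
have sup_hi : sup (range lo) <= hi n.
  by apply: sup_le_ub => [|_ [m _ <-]//]; exists (lo 0%N), 0%N.
by move: lo_sup sup_hi; rewrite /lo /hi ler_norml => ? ?; apply/andP; split; lra.
Qed.

Lemma geometric_eq0 (x c : R) : (forall n, `|x| <= c / 2 ^+ n) -> x = 0.
Proof.
move=> xc; apply/eqP; rewrite -normr_eq0 eq_le normr_ge0 andbT.
have c0 : 0 <= c by have := le_trans (normr_ge0 _) (xc 0%N); rewrite divr1.
rewrite leNgt; apply/negP => x0.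
have [n cn] : exists n : nat, c / `|x| < n%:R.
  by exists (Num.truncn (c / `|x|)).+1; rewrite truncnS_gt.
have := xc n; rewrite leNgt => /negP; apply.
rewrite ltr_pdivrMr ?exprn_gt0//; rewrite ltr_pdivrMr// mulrC in cn.
by rewrite (lt_le_trans cn)// ler_pM2l// -natrX ler_nat ltnW// ltn_expl.
Qed.

End ScalarTools.

(** * Periodic solutions by averaging *)

Section Periodic.
Variable R : realType.
Implicit Types (f g h u : R -> R) (P t : R).

Lemma periodic_nat (T : Type) (u : R -> T) P (n : nat) t :
  (forall t, u (t + P) = u t) -> u (t + P *+ n) = u t.
Proof.
move=> uP; elim: n => [|n IH]; first by rewrite mulr0n addr0.
by rewrite mulrSr addrA uP.
Qed.

Lemma periodic_reduce (T : Type) (u : R -> T) P t : 0 < P ->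
  (forall t, u (t + P) = u t) -> exists2 s, 0 <= s <= P & u t = u s.
Proof.
move=> P0 uP; have := floor_itv (t / P) => /andP[].
rewrite intrD ler_pdivlMr// ltr_pdivrMr// mulrDl mul1r => lo hi.
exists (t - (Num.floor (t / P))%:~R * P); first by apply/andP; split; lra.
case: (Num.floor (t / P)) => n.
  rewrite -[in RHS](periodic_nat n _ uP); congr u.
  by rewrite mulrzl -pmulrn subrK.
rewrite -[in LHS](periodic_nat n.+1 _ uP); congr u.
by rewrite mulrzl NegzE mulrNz opprK -pmulrn.
Qed.

Lemma prim_add_scale g h c t : continuous g -> continuous h ->
  prim (fun x => g x + c * h x) t = prim g t + c * prim h t.
Proof.
move=> gC hC.
have ghC : continuous (fun x => g x + c * h x).
  apply: continuous_add => //; apply: continuous_mul => //; exact: cst_continuous.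
have := is_derive_cst_eq (fun x => is_derive_prim x ghC)
  (fun x => derive_add (is_derive_prim x gC) (derive_scale c (is_derive_prim x hC))) 0 t.
by rewrite !prim0 mulr0 addr0 !subr0.
Qed.

End Periodic.

(** The hypotheses under which rho continues to a periodic solution of u' =
    eps * f t u: the mean of f over a period P has a simple zero at rho, where
    h is the derivative of f in its second variable. *)
Record simple_average_zero (R : realType) (f : R -> R -> R) (h : R -> R)
    (P rho H : R) : Prop := SimpleAverageZero {
  saz_period : 0 < P;
  saz_f_periodic : forall t r, f (t + P) r = f t r;
  saz_h_periodic : forall t, h (t + P) = h t;
  saz_h_continuous : continuous h;
  saz_f_continuous : forall u, continuous u -> continuous (fun t => f t (u t));
  saz_h_bound : forall t, `|h t| <= H;
  saz_f_bound : forall t, `|f t rho| <= H;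
  saz_linearization : forall lam, 0 < lam -> exists2 eta, 0 < eta &
    forall t r1 r2, `|r1 - rho| <= eta -> `|r2 - rho| <= eta ->
    `|f t r1 - f t r2 - h t * (r1 - r2)| <= lam * `|r1 - r2|;
  saz_average : prim (fun t => f t rho) P = 0;
  saz_simple : prim h P != 0 }.

Section AveragingExistence.
Variables (R : realType) (f : R -> R -> R) (h : R -> R) (P rho H : R).
Hypothesis hyp : simple_average_zero f h P rho H.

Local Notation kappa := (prim h P).
Let P0 := saz_period hyp.

Let g (u : R -> R) t := f t (u t).

(** With N the integral of f t (u t) over a period, a fixed point u
    satisfies u 0 = u 0 - N / kappa at t = 0, hence N = 0, and then u' = eps *
    f t u. The last term is periodic for every u, so the iteration stays among
    periodic functions. *)
Definition averaging_map (eps : R) (u : R -> R) (t : R) : R :=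
  u 0 - prim (g u) P / kappa + eps * (prim (g u) t - t / P * prim (g u) P).

Lemma averaging_map0 eps u : averaging_map eps u 0 = u 0 - prim (g u) P / kappa.
Proof. by rewrite /averaging_map prim0 !mul0r subrr mulr0 addr0. Qed.

Lemma averaging_map_continuous eps u : continuous u ->
  continuous (averaging_map eps u).
Proof.
move=> uC; have gC : continuous (g u) by exact: (saz_f_continuous hyp).
apply: continuous_add; first exact: cst_continuous.
apply: continuous_mul; first exact: cst_continuous.
apply: continuous_sub; first exact: (is_derive_continuous (fun t => is_derive_prim t gC)).
apply: continuous_mul; last exact: cst_continuous.
by apply: continuous_mul; [move=> ?; exact: cvg_id | exact: cst_continuous].
Qed.

Lemma averaging_map_periodic eps u : continuous u -> (forall t, u (t + P) = u t) ->
  forall t, averaging_map eps u (t + P) = averaging_map eps u t.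
Proof.
move=> uC uP t; have gC : continuous (g u) by exact: (saz_f_continuous hyp).
rewrite /averaging_map prim_shift//; last first.
  by move=> x; rewrite /g (saz_f_periodic hyp) uP.
by congr (_ + _ * _); field; rewrite gt_eqF.
Qed.

(** The value at 0 and the oscillation are measured separately: the map
    contracts the former since kappa != 0, and the latter since eps is small;
    the weight M absorbs the influence of the oscillation on the value at 0. *)
Definition within_dist (M w : R) (u v : R -> R) : Prop :=
  forall t, `|u 0 - v 0| + M * `|(u t - u 0) - (v t - v 0)| <= w.

Lemma within_dist_sup M w u v t : 1 <= M -> within_dist M w u v ->
  `|u t - v t| <= w.
Proof.
move=> M1 /(_ t); apply: le_trans.
rewrite (_ : u t - v t = (u 0 - v 0) + ((u t - u 0) - (v t - v 0))); last by ring.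
rewrite (le_trans (ler_normD _ _))// lerD2l.
by rewrite ler_peMl.
Qed.

Let H0 : 0 <= H := le_trans (normr_ge0 (h 0)) (saz_h_bound hyp 0).
Let K0 : 0 < `|kappa|.
Proof. by rewrite normr_gt0 (saz_simple hyp). Qed.

(** Let a be the distance of the values at 0 and b that of the
    oscillations. Replacing f by its linearization h, the first becomes at most
    a / 4 + (M / 4) * b, which fixes lam and M; the second becomes at most
    `|eps| * 2 P (H + lam) * (a + b), which fixes the size of eps. *)
Lemma averaging_map_contraction (lam eta M eps w : R) (u v : R -> R) :
  lam = `|kappa| / (4 * P) ->
  (forall t r1 r2, `|r1 - rho| <= eta -> `|r2 - rho| <= eta ->
    `|f t r1 - f t r2 - h t * (r1 - r2)| <= lam * `|r1 - r2|) ->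
  M = 4 * (4^-1 + P * H / `|kappa|) ->
  `|eps| * (M * (2 * P * (H + lam))) <= 4^-1 ->
  continuous u -> continuous v ->
  (forall t, u (t + P) = u t) -> (forall t, v (t + P) = v t) ->
  (forall t, `|u t - rho| <= eta) -> (forall t, `|v t - rho| <= eta) ->
  within_dist M w u v ->
  within_dist M (w / 2) (averaging_map eps u) (averaging_map eps v).
Proof.
move=> lamE lin ME epsM uC vC uP vP ur vr uvw.
have lam0 : 0 < lam by rewrite lamE divr_gt0// mulr_gt0.
have M1 : 1 <= M.
  by rewrite ME mulrDr divff// lerDl mulr_ge0// divr_ge0 ?mulr_ge0// ltW.
have M0 : 0 < M by exact: lt_le_trans M1.
have gu : continuous (g u) by exact: (saz_f_continuous hyp).
have gv : continuous (g v) by exact: (saz_f_continuous hyp).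
have hC := saz_h_continuous hyp.
pose del := u 0 - v 0; pose a := `|del|; pose b := (w - a) / M.
have a0 : 0 <= a by exact: normr_ge0.
have wE : w = a + M * b by rewrite /b mulrC divfK ?gt_eqF// addrC subrK.
have bP t : `|(u t - u 0) - (v t - v 0)| <= b.
  by rewrite /b ler_pdivlMr// mulrC lerBrDl; exact: uvw.
have b0 : 0 <= b := le_trans (normr_ge0 _) (bP 0).
have uv t : `|u t - v t| <= a + b.
  rewrite (_ : u t - v t = del + ((u t - u 0) - (v t - v 0))); last by rewrite /del; ring.
  by rewrite (le_trans (ler_normD _ _))// lerD2l.
have gdif t : `|g u t - g v t - h t * del| <= lam * (a + b) + H * b.
  rewrite (_ : _ - _ = (g u t - g v t - h t * (u t - v t)) +
    h t * ((u t - u 0) - (v t - v 0))); last by rewrite /del; ring.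
  rewrite (le_trans (ler_normD _ _))// lerD//.
    by rewrite (le_trans (lin _ _ _ _ _))// ler_wpM2l// ltW.
  by rewrite normrM ler_pM// (saz_h_bound hyp).
have gdif' t : `|g u t - g v t| <= (H + lam) * (a + b).
  rewrite (_ : _ - _ = (g u t - g v t - h t * (u t - v t)) + h t * (u t - v t)); last by ring.
  rewrite (le_trans (ler_normD _ _))// mulrDl addrC lerD//.
    by rewrite normrM ler_pM// (saz_h_bound hyp).
  by rewrite (le_trans (lin _ _ _ _ _))// ler_wpM2l// ltW.
have Ndif : `|prim (g u) P - prim (g v) P - kappa * del| <= (lam * (a + b) + H * b) * P.
  have gvh : continuous (fun t => g v t + del * h t).
    by apply: continuous_add => //; apply: continuous_mul => //; exact: cst_continuous.
  have ghdif t : `|g u t - (g v t + del * h t)| <= lam * (a + b) + H * b.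
    by rewrite opprD addrA [del * h t]mulrC.
  have := prim_dist P gu gvh ghdif.
  by rewrite prim_add_scale// opprD addrA [del * kappa]mulrC (gtr0_norm P0).
have pdif t : `|prim (g u) t - prim (g v) t| <= (H + lam) * (a + b) * `|t|.
  exact: prim_dist.
have a'E : `|averaging_map eps u 0 - averaging_map eps v 0| <= a / 4 + M / 4 * b.
  rewrite !averaging_map0.
  rewrite (_ : _ - _ = - (prim (g u) P - prim (g v) P - kappa * del) / kappa); last first.
    by rewrite /del; field; exact: (saz_simple hyp).
  rewrite normrM normrN normfV ler_pdivrMr//.
  apply: (le_trans Ndif); rewrite ME lamE le_eqVlt; apply/orP; left; apply/eqP.
  by field; rewrite !gt_eqF.
have b'E t : `|(averaging_map eps u t - averaging_map eps u 0) -
    (averaging_map eps v t - averaging_map eps v 0)| <=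
    `|eps| * (2 * P * (H + lam)) * (a + b).
  pose phi t := (averaging_map eps u t - averaging_map eps u 0) -
    (averaging_map eps v t - averaging_map eps v 0).
  have [||s /andP[s0 sP]] := @periodic_reduce _ R phi P t.
  - exact: P0.
  - by move=> x; rewrite /phi !averaging_map_periodic.
  rewrite -/(phi t) => ->; rewrite /phi !averaging_map0 /averaging_map.
  rewrite (_ : _ - _ - _ = eps * ((prim (g u) s - prim (g v) s) -
    s / P * (prim (g u) P - prim (g v) P))); last by ring.
  rewrite normrM -(mulrA `|eps|) ler_wpM2l//.
  rewrite (le_trans (ler_normB _ _))//.
  have sP1 : 0 <= s / P <= 1.
    by rewrite (divr_ge0 s0 (ltW P0)) /= ler_pdivrMr// mul1r.
  have := pdif s; have := pdif P; rewrite (gtr0_norm P0) (ger0_norm s0).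
  have /andP[sP0 sP1'] := sP1; rewrite [`|s / P * _|]normrM (ger0_norm sP0).
  set q := `|prim (g u) P - _|; set q' := `|prim (g u) s - _|; set G := (H + lam) * (a + b).
  move=> qG q'G.
  have G0 : 0 <= G by rewrite mulr_ge0// ?addr_ge0// ltW.
  have : s / P * q <= q by rewrite ler_piMl// normr_ge0.
  have : G * s <= G * P by rewrite ler_wpM2l.
  rewrite (_ : 2 * P * (H + lam) * (a + b) = 2 * (G * P)); last by rewrite /G; ring.
  lra.
move=> t; apply: (@le_trans _ _ (a / 4 + M / 4 * b + M * (`|eps| * (2 * P * (H + lam)) * (a + b)))).
  by rewrite lerD// ler_wpM2l// ltW.
rewrite wE.
have : `|eps| * (M * (2 * P * (H + lam))) * (a + b) <= 4^-1 * (a + b).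
  by rewrite ler_wpM2r// addr_ge0.
have : b <= M * b by rewrite ler_peMl.
lra.
Qed.

Lemma averaging_map_cst eps t : 
  averaging_map eps (fun=> rho) t = rho + eps * prim (g (fun=> rho)) t.
Proof.
by rewrite /averaging_map (saz_average hyp : prim (g _) P = 0) mul0r mulr0 !subr0.
Qed.

Lemma averaging_map_limit eps c (u : R -> R) (un : nat -> R -> R) t :
  continuous u -> (forall n, continuous (un n)) ->
  (forall n, un n.+1 = averaging_map eps (un n)) ->
  (forall n t, `|un n t - u t| <= c / 2 ^+ n) ->
  (forall n t, `|g (un n) t - g u t| <= c / 2 ^+ n) ->
  u t = averaging_map eps u t.
Proof.
move=> uC unC unS unu gunu.
have gu : continuous (g u) by exact: (saz_f_continuous hyp).
have gun n : continuous (g (un n)) by exact: (saz_f_continuous hyp).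
have pd n s : `|prim (g (un n)) s - prim (g u) s| <= c / 2 ^+ n * `|s|.
  exact: prim_dist.
apply/eqP; rewrite -subr_eq0; apply/eqP.
pose Ct := 1 + 1 + P / `|kappa| + `|eps| * (`|t| + `|t / P| * P).
apply: (@geometric_eq0 _ _ (c * Ct)) => n; set d := c / 2 ^+ n.
rewrite (_ : c * Ct / 2 ^+ n = d * Ct); last by rewrite /d; ring.
pose d1 := prim (g (un n)) t - prim (g u) t.
pose d2 := prim (g (un n)) P - prim (g u) P.
rewrite (_ : _ - _ = - (un n.+1 t - u t) + ((un n 0 - u 0) - d2 / kappa +
   eps * (d1 - t / P * d2))); last first.
  by rewrite unS /averaging_map /d1 /d2; ring.
have h1 : `|un n.+1 t - u t| <= d.
  rewrite (le_trans (unu _ _))// /d exprS invfM mulrA -[leRHS]mulr1 -[leRHS]mulrA.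
  rewrite [X in _ <= _ * X]mulr1.
  have c0 : 0 <= c by have := le_trans (normr_ge0 _) (unu 0%N 0); rewrite divr1.
  rewrite ler_wpM2r ?invr_ge0 ?exprn_ge0//.
  by rewrite ler_piMr// invf_le1// ler1n.
have h2 : `|un n 0 - u 0| <= d by exact: unu.
have h3 : `|d1| <= d * `|t| by exact: pd.
have h4 : `|d2| <= d * P by rewrite -[X in _ <= _ * X](gtr0_norm P0); exact: pd.
have h5 : `|d2 / kappa| <= d * (P / `|kappa|).
  by rewrite normrM normfV mulrA ler_pM2r ?invr_gt0.
have h6 : `|eps * (d1 - t / P * d2)| <= d * (`|eps| * (`|t| + `|t / P| * P)).
  rewrite normrM mulrCA ler_wpM2l// (le_trans (ler_normB _ _))// (mulrDr d) lerD//.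
  by rewrite normrM mulrCA ler_wpM2l.
rewrite (_ : d * Ct = d + d + d * (P / `|kappa|) +
  d * (`|eps| * (`|t| + `|t / P| * P))); last by rewrite /Ct; ring.
have := ler_normD (- (un n.+1 t - u t)) (un n 0 - u 0 - d2 / kappa + eps * (d1 - t / P * d2)).
have := ler_normD (un n 0 - u 0 - d2 / kappa) (eps * (d1 - t / P * d2)).
have := ler_normB (un n 0 - u 0) (d2 / kappa).
rewrite normrN; lra.
Qed.

Lemma uniform_geometric_continuous c (u : R -> R) (un : nat -> R -> R) :
  (forall n, continuous (un n)) -> (forall n t, `|un n t - u t| <= c / 2 ^+ n) ->
  continuous u.
Proof.
move=> unC unu t; apply/cvgrPdist_lt => e e0.
have [n cn] : exists n, c / 2 ^+ n < e / 3.
  apply: contrapT => nn; suff /eqP : e / 3 = 0 by rewrite gt_eqF// divr_gt0.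
  apply: (@geometric_eq0 _ _ c) => n; rewrite gtr0_norm ?divr_gt0// leNgt.
  by apply/negP => cn; apply: nn; exists n.
have /cvgrPdist_lt/(_ (e / 3)) := unC n t.
rewrite divr_gt0// => /(_ isT); apply: filterS => s uns.
rewrite (_ : u t - u s = - (un n t - u t) + (un n t - un n s) + (un n s - u s)); last by ring.
have := unu n t; have := unu n s.
have := ler_normD (- (un n t - u t) + (un n t - un n s)) (un n s - u s).
have := ler_normD (- (un n t - u t)) (un n t - un n s); rewrite normrN; lra.
Qed.

End AveragingExistence.

Section AveragingTheorem.
Variables (R : realType) (f : R -> R -> R) (h : R -> R) (P rho H : R).
Hypothesis hyp : simple_average_zero f h P rho H.

Let P0 : 0 < P := saz_period hyp.
Let H0 : 0 <= H := le_trans (normr_ge0 (h 0)) (saz_h_bound hyp 0).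
Let K0 : 0 < `|prim h P|.
Proof. by rewrite normr_gt0 (saz_simple hyp). Qed.

(** The iterates of averaging_map started at the constant rho move by at
    most w / 2 ^ n, where w = O(eps), so they stay near rho and converge
    uniformly to a fixed point. *)
Theorem periodic_solution_exists : exists C e0, [/\ 0 <= C, 0 < e0 &
  forall eps, `|eps| < e0 -> exists u : R -> R,
    [/\ forall t, u (t + P) = u t,
        forall t, is_derive t (1 : R) u (eps * f t (u t)) &
        forall t, `|u t - rho| <= C * `|eps|]].
Proof.
have [lam lamE] : {lam | lam = `|prim h P| / (4 * P)} by eexists.
have lam0 : 0 < lam by rewrite lamE divr_gt0// mulr_gt0.
have [eta eta0 lin] := saz_linearization hyp lam0.
have [M ME] : {M | M = 4 * (4^-1 + P * H / `|prim h P|)} by eexists.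
have M1 : 1 <= M.
  by rewrite ME mulrDr divff// lerDl mulr_ge0// divr_ge0 ?mulr_ge0// ltW.
have M0 : 0 < M by exact: lt_le_trans M1.
(* The product eps * A1 controls the contraction factor, and eps * A2 the
   distance between the first iterate and rho. *)
have [A1 A1E] : {A | A = M * (2 * P * (H + lam))} by eexists.
have [A2 A2E] : {A | A = M * (H * P)} by eexists.
have lamge0 := ltW lam0; have Pge0 := ltW P0; have Mge0 := ltW M0.
have A10 : 0 <= A1.
  by rewrite A1E; apply: mulr_ge0 => //; apply: mulr_ge0; [exact: mulr_ge0 | exact: addr_ge0].
have A20 : 0 <= A2.
  by rewrite A2E; apply: mulr_ge0 => //; exact: mulr_ge0.
exists (2 * A2), (Num.min (4^-1 / (A1 + 1)) (eta / (2 * A2 + 1))); split.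
- by rewrite mulr_ge0.
- by rewrite lt_min !divr_gt0// ?ltr_wpDl// mulr_ge0.
move=> eps; rewrite lt_min => /andP[].
rewrite !ltr_pdivlMr ?ltr_wpDl ?mulr_ge0// => eps1 eps2.
have e0 := normr_ge0 eps.
have {}eps1 : `|eps| * A1 <= 4^-1 by lra.
have {}eps2 : 2 * (A2 * `|eps|) <= eta by lra.
have [w wE] : {w | w = A2 * `|eps|} by eexists.
have w0 : 0 <= w by rewrite wE mulr_ge0.
rewrite -wE in eps2.
pose T := averaging_map f h P eps.
pose un n := iter n T (fun=> rho).
have half n : w / 2 ^+ n / 2 = w / 2 ^+ n.+1.
  by rewrite exprS invfM mulrA mulrAC.
have pow n : 0 <= w / 2 ^+ n by rewrite divr_ge0// exprn_ge0.
have inv n : [/\ continuous (un n), forall t, un n (t + P) = un n t,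
    forall t, `|un n t - rho| <= 2 * w - 2 * (w / 2 ^+ n) &
    within_dist M (w / 2 ^+ n) (un n.+1) (un n)].
  elim: n => [|n [uC uP ur ud]].
    split=> [||t|t]; first exact: cst_continuous.
    - by [].
    - by rewrite /un /= subrr normr0 divr1 subrr.
    - rewrite /un /= /T !(averaging_map_cst hyp) prim0 mulr0 addr0 !subrr normr0 add0r.
      rewrite subr0 addrAC subrr add0r divr1 wE A2E -mulrA ler_wpM2l//.
      rewrite normrM [leLHS]mulrC ler_wpM2r//.
      have gC : continuous (fun s => f s rho).
        by apply: (saz_f_continuous hyp (u := fun=> rho)); exact: cst_continuous.
      have [||s /andP[s0 sP] ->] := @periodic_reduce _ R (prim (fun s => f s rho)) P t.
      + by [].
      + move=> x; rewrite prim_shift//; last by move=> y; rewrite (saz_f_periodic hyp).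
        by rewrite (saz_average hyp) addr0.
      + have := lipschitz_bound 0 s (fun x => is_derive_prim x gC) (saz_f_bound hyp).
        rewrite prim0 !subr0 (ger0_norm s0) => /le_trans; apply.
        by rewrite ler_wpM2l.
  have TC : continuous (un n.+1) by exact: (averaging_map_continuous hyp).
  have TP : forall t, un n.+1 (t + P) = un n.+1 t by exact: (averaging_map_periodic hyp).
  have Tr t : `|un n.+1 t - rho| <= 2 * w - 2 * (w / 2 ^+ n.+1).
    have := within_dist_sup t M1 ud; have := ur t; rewrite -half.
    have := ler_normD (un n.+1 t - un n t) (un n t - rho); rewrite addrA subrK.
    have := pow n; lra.
  split=> //; rewrite -half; apply: (averaging_map_contraction hyp (lam := lam) (eta := eta)) => //.
  - by rewrite -A1E.
  - by move=> t; have := Tr t; have := pow n.+1; lra.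
  - by move=> t; have := ur t; have := pow n; lra.
have /choice[u uP] : forall t, exists l, forall n, `|un n t - l| <= 2 * w / 2 ^+ n.
  move=> t; apply: geometric_limit => n; have [_ _ _ ud] := inv n.
  exact: within_dist_sup ud.
have unu n t : `|un n t - u t| <= 2 * w / 2 ^+ n by exact: uP.
have unC n : continuous (un n) by have [] := inv n.
have uC : continuous u by exact: uniform_geometric_continuous unu.
have ur t : `|u t - rho| <= 2 * w.
  by have := unu 0%N t; rewrite divr1 distrC.
have unr n t : `|un n t - rho| <= eta.
  by have [_ _ /(_ t) + _] := inv n; have := pow n; lra.
have uPer t : u (t + P) = u t.
  apply/eqP; rewrite -subr_eq0; apply/eqP; apply: (@geometric_eq0 _ _ (4 * w)) => n.
  have := unu n t; have := unu n (t + P); have [_ -> _ _] := inv n.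
  have := ler_normD (- (un n t - u (t + P))) (un n t - u t); rewrite normrN.
  rewrite (_ : - (un n t - u (t + P)) + (un n t - u t) = u (t + P) - u t); last by ring.
  rewrite (_ : 4 * w / 2 ^+ n = 2 * w / 2 ^+ n + 2 * w / 2 ^+ n); last by ring.
  lra.
have uT t : u t = T u t.
  apply: (averaging_map_limit hyp (c := 2 * w * (1 + H + lam)) (un := un)) => //.
  - move=> n s; rewrite (le_trans (unu n s))//.
    rewrite (_ : 2 * w * (1 + H + lam) / 2 ^+ n = 2 * w / 2 ^+ n * (1 + H + lam)); last by ring.
    rewrite ler_peMr ?(le_trans (normr_ge0 _) (unu n s))//.
    by rewrite -addrA lerDl addr_ge0.
  - move=> n s; have us : `|u s - rho| <= eta by rewrite (le_trans (ur s)).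
    have := lin s _ _ (unr n s) us.
    have := saz_h_bound hyp s; have := unu n s.
    rewrite (_ : 2 * w * (1 + H + lam) / 2 ^+ n = 2 * w / 2 ^+ n * (1 + H + lam)); last by ring.
    have : `|h s * (un n s - u s)| <= H * `|un n s - u s|.
      by rewrite normrM ler_wpM2r// (saz_h_bound hyp).
    have := ler_normD (f s (un n s) - f s (u s) - h s * (un n s - u s)) (h s * (un n s - u s)).
    rewrite subrK.
    set q := 2 * w / 2 ^+ n; move=> h1 h2 h3 _ h4.
    have q0 : 0 <= q := le_trans (normr_ge0 _) h3.
    have : (H + lam) * `|un n s - u s| <= (H + lam) * q.
      by rewrite ler_wpM2l// addr_ge0// ltW.
    lra.
have N0 : prim (fun t => f t (u t)) P = 0.
  have := uT 0; rewrite /T averaging_map0 => /eqP.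
  rewrite -subr_eq0 opprB addrCA subrr addr0 mulf_eq0 invr_eq0.
  by rewrite (negPf (saz_simple hyp)) orbF => /eqP.
exists u; split=> // t; last by rewrite (le_trans (ur t))// wE mulrA.
have gC : continuous (fun t => f t (u t)) by exact: (saz_f_continuous hyp).
suff {1}-> : u = (fun t => u 0 + eps * prim (fun t => f t (u t)) t).
  rewrite -[eps * f t _]add0r; apply: derive_add.
  by apply: derive_scale; exact: is_derive_prim.
by apply/funext => s; rewrite {1}uT /T /averaging_map N0 mul0r mulr0 !subr0.
Qed.

(** The difference of two solutions satisfies a linear equation with
    coefficient eps * h up to a small error. Multiplying it by exp (- eps * S),
    where S is the periodic part of the primitive of h, replaces h by its
    nonzero mean, and periodic_rigidity applies. *)
Theorem periodic_solution_unique : exists2 eta, 0 < eta &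
  forall eps (u v : R -> R) (m : nat), eps != 0 -> (0 < m)%N ->
    (forall t, is_derive t (1 : R) u (eps * f t (u t))) ->
    (forall t, is_derive t (1 : R) v (eps * f t (v t))) ->
    (forall t, u (t + P *+ m) = u t) -> (forall t, v (t + P *+ m) = v t) ->
    (forall t, `|u t - rho| <= eta) -> (forall t, `|v t - rho| <= eta) ->
    forall t, u t = v t.
Proof.
have [k kE] : {k | k = prim h P / P} by eexists.
have k0 : 0 < `|k| by rewrite kE normrM mulr_gt0// normr_gt0 invr_neq0// gt_eqF.
have k2 : 0 < `|k| / 2 by rewrite divr_gt0.
have [eta eta0 lin] := saz_linearization hyp k2.
exists eta => // eps u v m eps0 m0 uD vD uP vP ur vr t.
have hC := saz_h_continuous hyp.
pose S x := prim h x - k * x.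
have SD x : is_derive x (1 : R) S (h x - k).
  rewrite -[X in _ - X]mulr1.
  exact: (derive_sub (is_derive_prim x hC) (derive_scale k (derive_id x))).
have SP x : S (x + P *+ m) = S x.
  apply: periodic_nat => y; rewrite /S prim_shift//; last exact: (saz_h_periodic hyp).
  by rewrite kE; field; rewrite gt_eqF.
pose X x := expR (- eps * S x).
have XD x : is_derive x (1 : R) X (- (eps * (h x - k)) * X x).
  rewrite mulrC -mulNr.
  exact: (derive_comp (is_derive_expR _) (derive_scale (- eps) (SD x))).
pose D x := (u x - v x) * X x.
pose e x := (f x (u x) - f x (v x) - h x * (u x - v x)) * X x.
have DD x : is_derive x (1 : R) D (eps * (k * D x + e x)).
  suff -> : eps * (k * D x + e x) = (eps * f x (u x) - eps * f x (v x)) * X x +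
      (u x - v x) * (- (eps * (h x - k)) * X x).
    by apply: derive_mul => //; exact: derive_sub.
  by rewrite /D /e; ring.
have eD x : `|e x| <= `|k| / 2 * `|D x|.
  by rewrite /e /D !normrM mulrA ler_wpM2r// lin.
have DP x : D (x + P *+ m) = D x by rewrite /D /X uP vP SP.
have Pm : 0 < P *+ m by rewrite pmulrn_lgt0.
have kk : `|k| / 2 < `|k| by rewrite ltr_pdivrMr// ltr_pMr// ltr1n.
have := periodic_rigidity eps0 (ltW k2) kk Pm DP DD eD t.
move=> /eqP; rewrite /D mulf_eq0 subr_eq0 => /orP[/eqP//|].
by rewrite gt_eqF// expR_gt0.
Qed.

End AveragingTheorem.

(** * The radial equation of the example *)

Section RadialEquation.
Variable R : realType.
Implicit Types (g : {poly R}) (rho r s t : R).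

Lemma continuous_abs_sin : continuous (fun t : R => `|sin t|).
Proof.
move=> t; apply: (@continuous_comp _ _ _ sin (fun x => `|x|)).
  exact: continuous_sin.
exact: norm_continuous.
Qed.

Lemma abs_sin_periodic t : `|sin (t + pi)| = `|sin t|.
Proof. by rewrite sinDpi normrN. Qed.

Lemma abs_sin_le1 t : `|sin t| <= 1.
Proof. by rewrite ler_norml sin_geN1 sin_le1. Qed.

Definition sin_moment (j : nat) : R := prim (fun t => `|sin t| ^+ j) pi.

Lemma sin_moment_neq0 j : sin_moment j != 0.
Proof.
have jC : continuous (fun t : R => `|sin t| ^+ j).
  exact: continuous_expr continuous_abs_sin.
have D t := is_derive_prim t jC.
have [|c] := MVT (pi_gt0 R) (fun x _ => D x).
  exact/continuous_subspaceT/(is_derive_continuous D).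
rewrite in_itv /= prim0 !subr0 /sin_moment => /sin_gt0_pi sc ->.
apply: mulf_neq0; last by rewrite gt_eqF// pi_gt0.
by rewrite expf_neq0// normr_eq0 gt_eqF.
Qed.

(** Dividing by the moments of `|sin| makes the mean of radial_rhs
    proportional to r * g(r), with a prescribed g. *)
Definition radial_coef g (j : nat) : R := g`_j / sin_moment j.

Definition radial_rhs g t r : R :=
  r * \sum_(j < size g) radial_coef g j * (`|sin t| * r) ^+ j.

(** The derivative of radial_rhs with respect to r at rho. *)
Definition radial_slope g rho t : R :=
  \sum_(j < size g) radial_coef g j * `|sin t| ^+ j * (j.+1%:R * rho ^+ j).

Lemma radial_rhsE g t r :
  radial_rhs g t r = \sum_(j < size g) radial_coef g j * r ^+ j.+1 * `|sin t| ^+ j.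
Proof.
rewrite /radial_rhs mulr_sumr; apply: eq_bigr => j _.
by rewrite exprMn exprS; ring.
Qed.

Lemma prim_sum (I : Type) (s : seq I) (c : I -> R) (F : I -> R -> R) t :
  (forall i, continuous (F i)) ->
  prim (fun x => \sum_(i <- s) c i * F i x) t = \sum_(i <- s) c i * prim (F i) t.
Proof.
move=> FC.
have sC (s' : seq I) : continuous (fun x => \sum_(i <- s') c i * F i x).
  apply: continuous_big => [|i _]; first exact: add_continuous.
  by apply: continuous_mul; [exact: cst_continuous | exact: FC].
elim: s => [|i s IH].
  rewrite big_nil; have zC : continuous (fun _ : R => 0 : R) by exact: cst_continuous.
  transitivity (prim (fun _ : R => 0 + - 1 * 0 : R) t).
    by congr (prim _ t); apply/funext => x; rewrite big_nil mulr0 addr0.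
  by rewrite (prim_add_scale (- 1) t zC zC) [in LHS]mulN1r subrr.
rewrite big_cons -IH addrC -prim_add_scale//.
by congr (prim _ t); apply/funext => x; rewrite big_cons addrC.
Qed.

(** Induction on j through r1 ^ (j + 2) - r2 ^ (j + 2) = r1 * (r1 ^ (j + 1)
    - r2 ^ (j + 1)) + r2 ^ (j + 1) * (r1 - r2). *)
Lemma power_linearization rho (j : nat) : exists2 B, 0 <= B &
  forall eta r1 r2, eta <= 1 -> `|r1 - rho| <= eta -> `|r2 - rho| <= eta ->
  `|r1 ^+ j.+1 - r2 ^+ j.+1 - j.+1%:R * rho ^+ j * (r1 - r2)| <=
    B * eta * `|r1 - r2|.
Proof.
elim: j => [|j [B B0 IH]].
  exists 0 => // eta r1 r2 _ _ _; rewrite !expr1 expr0 !mul1r subrr normr0.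
  by rewrite mul0r mul0r.
pose A := j.+1%:R * `|rho| ^+ j.
have A0 : 0 <= A by rewrite mulr_ge0// exprn_ge0.
exists ((`|rho| + 1) * B + A + (A + B)).
  by rewrite !addr_ge0// mulr_ge0// addr_ge0.
move=> eta r1 r2 eta1 h1 h2.
have eta0 : 0 <= eta := le_trans (normr_ge0 _) h1.
pose X := r1 ^+ j.+1 - r2 ^+ j.+1 - j.+1%:R * rho ^+ j * (r1 - r2).
pose Y := r2 ^+ j.+1 - rho ^+ j.+1.
rewrite (_ : _ - _ - _ = r1 * X + (r1 - rho) * (j.+1%:R * rho ^+ j) * (r1 - r2) +
  Y * (r1 - r2)); last first.
  rewrite /X /Y [r1 ^+ j.+2]exprS [r2 ^+ j.+2]exprS ![rho ^+ j.+1]exprS.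
  rewrite -[j.+2%:R]natr1; ring.
have XB : `|X| <= B * eta * `|r1 - r2| by exact: IH.
have r1B : `|r1| <= `|rho| + 1.
  by have := ler_normD (r1 - rho) rho; rewrite subrK; lra.
have YB : `|Y| <= (A + B) * eta.
  have rr : `|rho - rho| <= eta by rewrite subrr normr0.
  have := IH eta r2 rho eta1 h2 rr.
  rewrite (_ : Y = (r2 ^+ j.+1 - rho ^+ j.+1 - j.+1%:R * rho ^+ j * (r2 - rho)) +
     j.+1%:R * rho ^+ j * (r2 - rho)); last by rewrite /Y; ring.
  move=> h; apply: (le_trans (ler_normD _ _)); rewrite mulrDl addrC lerD//.
    by rewrite normrM normrM normr_nat normrX -/A ler_wpM2l.
  by rewrite (le_trans h)// ler_piMr// ?mulr_ge0//; exact: le_trans h2 eta1.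
rewrite (_ : _ * eta * _ = (`|rho| + 1) * (B * eta * `|r1 - r2|) +
  eta * A * `|r1 - r2| + (A + B) * eta * `|r1 - r2|); last by ring.
rewrite (le_trans (ler_normD _ _))// lerD//; last by rewrite normrM ler_wpM2r.
rewrite (le_trans (ler_normD _ _))// lerD//; first by rewrite normrM ler_pM.
by rewrite !normrM normr_nat normrX -/A ler_wpM2r// ler_wpM2r.
Qed.

Lemma radial_average g r : prim (fun t => radial_rhs g t r) pi = r * g.[r].
Proof.
rewrite (_ : (fun t => _) = fun t =>
  \sum_(j < size g) (radial_coef g j * r ^+ j.+1) * `|sin t| ^+ j); last first.
  by apply/funext => t; rewrite radial_rhsE.
rewrite prim_sum => [|j]; last exact: continuous_expr continuous_abs_sin.
rewrite horner_coef mulr_sumr; apply: eq_bigr => j _.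
by rewrite /radial_coef exprS -/(sin_moment j); field; exact: sin_moment_neq0.
Qed.

Lemma radial_slope_average g rho :
  prim (radial_slope g rho) pi = (g * 'X)^`().[rho].
Proof.
rewrite (_ : radial_slope g rho = fun t => \sum_(j < size g)
  (radial_coef g j * (j.+1%:R * rho ^+ j)) * `|sin t| ^+ j); last first.
  by apply/funext => t; apply: eq_bigr => j _; ring.
rewrite prim_sum => [|j]; last exact: continuous_expr continuous_abs_sin.
rewrite -[in RHS](coefK g) poly_def mulr_suml raddf_sum horner_sum /=.
apply: eq_bigr => j _.
rewrite (_ : _ * 'X = g`_j *: ('X : {poly R}) ^+ j.+1); last by rewrite -scalerAl exprSr.
rewrite derivZ derivXn hornerZ.
rewrite hornerMn hornerXn -mulr_natl /radial_coef -/(sin_moment j).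
by field; exact: sin_moment_neq0.
Qed.

(** The mean of radial_rhs is r * g(r), whose derivative at a zero rho of g
    is rho * g'(rho). *)
Lemma radial_simple_average_zero g rho : rho != 0 -> g.[rho] = 0 ->
  g^`().[rho] != 0 ->
  exists H, simple_average_zero (radial_rhs g) (radial_slope g rho) pi rho H.
Proof.
move=> rho0 grho g'rho.
have sinj1 t j : `|sin t| ^+ j <= 1 by rewrite exprn_ile1// abs_sin_le1.
have sinC := @continuous_abs_sin.
pose H1 := \sum_(j < size g) `|radial_coef g j * (j.+1%:R * rho ^+ j)|.
pose H2 := \sum_(j < size g) `|radial_coef g j * rho ^+ j.+1|.
have H10 : 0 <= H1 by apply: sumr_ge0.
have H20 : 0 <= H2 by apply: sumr_ge0.
exists (H1 + H2); split.
- exact: pi_gt0.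
- by move=> t r; rewrite /radial_rhs abs_sin_periodic.
- by move=> t; rewrite /radial_slope abs_sin_periodic.
- apply: continuous_big => [|j _]; first exact: add_continuous.
  apply: continuous_mul; last exact: cst_continuous.
  by apply: continuous_mul; [exact: cst_continuous | exact: continuous_expr].
- move=> u uC; apply: continuous_mul => //.
  apply: continuous_big => [|j _]; first exact: add_continuous.
  apply: continuous_mul; first exact: cst_continuous.
  by apply: continuous_expr; exact: continuous_mul.
- move=> t; rewrite (@le_trans _ _ H1) ?lerDl// (le_trans (ler_norm_sum _ _ _))//.
  apply: ler_sum => j _; rewrite mulrAC [leLHS]normrM ler_piMr//.
  by rewrite normrX normr_id.
- move=> t; rewrite (@le_trans _ _ H2) ?lerDr// radial_rhsE.
  rewrite (le_trans (ler_norm_sum _ _ _))//.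
  apply: ler_sum => j _; rewrite [leLHS]normrM ler_piMr//.
  by rewrite normrX normr_id.
- move=> lam lam0.
  have /choice[B BP] : forall j : nat, exists B, 0 <= B /\
    forall eta r1 r2, eta <= 1 -> `|r1 - rho| <= eta -> `|r2 - rho| <= eta ->
    `|r1 ^+ j.+1 - r2 ^+ j.+1 - j.+1%:R * rho ^+ j * (r1 - r2)| <=
      B * eta * `|r1 - r2|.
    by move=> j; have [B B0 BE] := power_linearization rho j; exists B.
  pose K := \sum_(j < size g) `|radial_coef g j| * B j.
  have K0 : 0 <= K.
    by apply: sumr_ge0 => j _; rewrite mulr_ge0//; have [] := BP j.
  pose eta := Num.min 1 (lam / (K + 1)).
  have eta0 : 0 < eta by rewrite lt_min ltr01 divr_gt0// ltr_wpDl.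
  exists eta => // t r1 r2 h1 h2.
  rewrite !radial_rhsE /radial_slope mulr_suml -!sumrB.
  apply: (@le_trans _ _ (K * eta * `|r1 - r2|)).
    rewrite (le_trans (ler_norm_sum _ _ _))// !mulr_suml; apply: ler_sum => j _.
    rewrite (_ : _ - _ - _ = radial_coef g j * (`|sin t| ^+ j *
      (r1 ^+ j.+1 - r2 ^+ j.+1 - j.+1%:R * rho ^+ j * (r1 - r2)))); last by ring.
    rewrite normrM -2!(mulrA `|radial_coef g j|) ler_wpM2l// normrM.
    have [_ BE] := BP j.
    rewrite (le_trans _ (BE _ _ _ _ h1 h2)) ?ge_min ?lexx//.
    by rewrite ler_piMl// normrX normr_id.
  rewrite ler_wpM2r//.
  apply: (@le_trans _ _ ((K + 1) * eta)).
    by rewrite ler_wpM2r ?(ltW eta0)// lerDl.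
  by rewrite mulrC -ler_pdivlMr ?ltr_wpDl// ge_min lexx orbT.
- by rewrite radial_average grho mulr0.
- by rewrite radial_slope_average derivM derivX mulr1 hornerD grho addr0
    hornerM hornerX mulf_neq0.
Qed.

End RadialEquation.

(** * A polynomial field depending on the absolute value of y *)

Section PolynomialField.
Variables (R : realType) (d : nat).
Implicit Types (g q : {poly R}) (u : 'rV[R]_d.+2) (p : 'rV[R]_d.+1).
Local Notation mu := (@lebesgue_measure R).

(** Taking for sgn the sign of y turns sgn * y into its absolute value, so
    the two half-systems together form one continuous system. *)
Definition even_radial_field (sgn : R) g q (i : 'I_d.+2) : mpoly d.+2 R :=
  if (i == ix) || (i == iy) then
    mpolyX R (mnm1 i) * \sum_(j < size g)
      (radial_coef g j * sgn ^+ j) *: mpolyX R (mnm1 iy) ^+ j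
  else \sum_(k < size q) q`_k *: mpolyX R (mnm1 i) ^+ k.

Lemma iy_neq_ix : (iy == ix :> 'I_d.+2) = false.
Proof. by []. Qed.

Lemma iz_neq_ix (l : 'I_d) : (iz l == ix) = false.
Proof. by []. Qed.

Lemma iz_neq_iy (l : 'I_d) : (iz l == iy) = false.
Proof. by rewrite /iz /iy (inj_eq lift_inj). Qed.

Lemma coordP (i : 'I_d.+2) : [\/ i = ix, i = iy | exists l, i = iz l].
Proof.
case: (unliftP ord0 i) => [j ->|->]; last by constructor 1.
by case: (unliftP ord0 j) => [l ->|->]; [constructor 3; exists l | constructor 2].
Qed.

Lemma peval_radial sgn g q u (i : 'I_d.+2) : (i == ix) || (i == iy) ->
  peval (even_radial_field sgn g q i) u =
  u ord0 i * \sum_(j < size g) radial_coef g j * (sgn * u ord0 iy) ^+ j.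
Proof.
move=> ixy; rewrite /even_radial_field ixy /peval mevalM mevalXU raddf_sum /=.
congr (_ * _); apply: eq_bigr => j _.
by rewrite mevalZ rmorphXn /= mevalXU exprMn mulrA.
Qed.

Lemma peval_vertical sgn g q u (l : 'I_d) :
  peval (even_radial_field sgn g q (iz l)) u = q.[u ord0 (iz l)].
Proof.
rewrite /even_radial_field iz_neq_ix iz_neq_iy /= /peval raddf_sum horner_coef /=.
by apply: eq_bigr => k _; rewrite mevalZ rmorphXn /= mevalXU.
Qed.

Lemma even_radial_field_perturbation sgn g q (n : nat) : (size g <= n)%N ->
  (size q <= n.+1)%N -> perturbation n (even_radial_field sgn g q).
Proof.
move=> sg sq.
have X1 (i : 'I_d.+2) : (mmeasure mdeg (mpolyX R (mnm1 i)) <= 2)%N by rewrite msizeX mdeg1.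
have nz (i : 'I_d.+2) (m : multinom d.+2) : (i == ix) || (i == iy) -> m i = 0%N ->
    mcoeff m (even_radial_field sgn g q i) = 0.
  move=> ixy mi; rewrite /even_radial_field ixy mulr_sumr raddf_sum big1 //= => j _.
  rewrite -scalerAr mcoeffZ mpolyXn -mpolyXD mcoeffX.
  case: eqP => [mE|_]; last by rewrite mulr0.
  by move: mi; rewrite -mE mnmDE mnm1E eqxx.
split=> [i|m mx my|m mx my]; [|by rewrite nz|by rewrite nz].
rewrite /even_radial_field; case: ifP => _.
    case: (posnP (size g)) => [->|g0]; first by rewrite big_ord0 mulr0 msize0.
    rewrite -(prednK (leq_trans g0 sg)) -[n.-1.+1]add1n.
    apply: msizeM_bound; first exact: X1.
    rewrite (leq_trans (msize_sum _ _ _))//; apply/bigmax_leqP => j _.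
    rewrite (leq_trans (msizeZ_le _ _))// (leq_trans (msizeX_bound _ (X1 iy)))//.
    by have := ltn_ord j; lia.
  rewrite (leq_trans (msize_sum _ _ _))//; apply/bigmax_leqP => j _.
  rewrite (leq_trans (msizeZ_le _ _))// (leq_trans (msizeX_bound _ (X1 i)))//.
  by have := ltn_ord j; lia.
Qed.

(** The restriction of this field to each half-space is polynomial, and on
    y = 0 both polynomial fields agree with it. *)
Definition even_vfield (eps : R) g q u : 'rV[R]_d.+2 :=
  let s := \sum_(j < size g) radial_coef g j * `|u ord0 iy| ^+ j in
  \row_i (if i == ix then - u ord0 iy + eps * (u ord0 ix * s)
          else if i == iy then u ord0 ix + eps * (u ord0 iy * s)
          else eps * q.[u ord0 i]).

Lemma even_vfield_x eps g q u : even_vfield eps g q u ord0 ix =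
  - u ord0 iy + eps * (u ord0 ix *
      \sum_(j < size g) radial_coef g j * `|u ord0 iy| ^+ j).
Proof. by rewrite mxE. Qed.

Lemma even_vfield_y eps g q u : even_vfield eps g q u ord0 iy =
  u ord0 ix + eps * (u ord0 iy *
      \sum_(j < size g) radial_coef g j * `|u ord0 iy| ^+ j).
Proof. by rewrite mxE. Qed.

Lemma even_vfield_z eps g q u (l : 'I_d) :
  even_vfield eps g q u ord0 (iz l) = eps * q.[u ord0 (iz l)].
Proof. by rewrite mxE iz_neq_ix iz_neq_iy. Qed.

Lemma vfield_even (eps sgn : R) g q u : sgn * u ord0 iy = `|u ord0 iy| ->
  vfield eps (even_radial_field sgn g q) u = even_vfield eps g q u.
Proof.
move=> sgnE; apply/rowP => i; rewrite !mxE.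
have [->|->|[l ->]] := coordP i.
- by rewrite eqxx peval_radial ?eqxx// sgnE.
- by rewrite iy_neq_ix eqxx peval_radial ?eqxx ?orbT// sgnE.
- by rewrite iz_neq_ix iz_neq_iy peval_vertical add0r.
Qed.

(** On y = 0 a convex combination of two equal vectors is the same vector,
    so the inclusion is an ordinary equation. *)
Lemma filippov_even (eps : R) g q u v :
  filippov (vfield eps (even_radial_field 1 g q))
    (vfield eps (even_radial_field (-1) g q)) u v <-> v = even_vfield eps g q u.
Proof.
have up : 0 <= u ord0 iy ->
    vfield eps (even_radial_field 1 g q) u = even_vfield eps g q u.
  by move=> y0; apply: vfield_even; rewrite mul1r ger0_norm.
have down : u ord0 iy <= 0 ->
    vfield eps (even_radial_field (-1) g q) u = even_vfield eps g q u.
  by move=> y0; apply: vfield_even; rewrite mulN1r ler0_norm.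
split=> [[vX vY vXY]|->].
  have [y0|y0|y0] := ltgtP 0 (u ord0 iy).
  - by rewrite vX// up// ltW.
  - by rewrite vY// down// ltW.
  - have [c _ ->] := vXY (esym y0).
    by rewrite up -?y0// down -?y0// scalerBl scale1r addrC subrK.
split=> [y0|y0|y0]; first by rewrite up// ltW.
  by rewrite down// ltW.
by exists 1; rewrite ?ler01 ?lexx// up ?y0// subrr scale1r scale0r addr0.
Qed.

Lemma polar_rhs_radial sgn g q t p :
  sgn * sin t = `|sin t| ->
  polar_rhs (even_radial_field sgn g q) t p ord0 ord0 = radial_rhs g t (p ord0 ord0).
Proof.
move=> sgnE; rewrite mxE eqxx !peval_radial ?eqxx ?orbT//.
have -> : polar t p ord0 ix = p ord0 ord0 * cos t by rewrite mxE.
have -> : polar t p ord0 iy = p ord0 ord0 * sin t by rewrite mxE /= liftK.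
rewrite (mulrCA sgn) sgnE [p ord0 ord0 * `|sin t|]mulrC /radial_rhs.
set s := \sum_(j < _) _.
transitivity ((cos t ^+ 2 + sin t ^+ 2) * (p ord0 ord0 * s)); first by ring.
by rewrite cos2Dsin2 mul1r.
Qed.

Lemma averaged_even_radial_field g q :
  averaged (even_radial_field 1 g q) (even_radial_field (-1) g q) =
  fun p => \row_i (if i == ord0 then 2 *: (g * 'X) else (2 * pi) *: q).[p ord0 i].
Proof.
apply/funext => p; apply/rowP => i; rewrite !mxE.
have pi0 := pi_ge0 R.
case: (unliftP ord0 i) => [l ->|->]; last first.
  rewrite eqxx hornerZ hornerM hornerX [g.[_] * _]mulrC.
  have rC : continuous (fun t => radial_rhs g t (p ord0 ord0)).
    apply: continuous_mul; first exact: cst_continuous.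
    apply: continuous_big => [|j _]; first exact: add_continuous.
    apply: continuous_mul; first exact: cst_continuous.
    apply: continuous_expr; apply: continuous_mul; last exact: cst_continuous.
    exact: continuous_abs_sin.
  have -> : \int[mu]_(t in `[0, pi])
      polar_rhs (even_radial_field 1 g q) t p ord0 ord0 = p ord0 ord0 * g.[p ord0 ord0].
    rewrite -radial_average.
    have <- : prim (fun t => radial_rhs g t (p ord0 ord0)) pi -
        prim (fun t => radial_rhs g t (p ord0 ord0)) 0 =
        prim (fun t => radial_rhs g t (p ord0 ord0)) pi by rewrite prim0 subr0.
    rewrite prim_diff//; apply: eq_Rintegral => t; rewrite inE /= in_itv /= => tpi.
    by rewrite polar_rhs_radial// mul1r ger0_norm// sin_ge0_pi.
  have -> : \int[mu]_(t in `[pi, 2 * pi])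
      polar_rhs (even_radial_field (-1) g q) t p ord0 ord0 = p ord0 ord0 * g.[p ord0 ord0].
    rewrite -radial_average.
    have <- : prim (fun t => radial_rhs g t (p ord0 ord0)) (2 * pi) -
        prim (fun t => radial_rhs g t (p ord0 ord0)) pi =
        prim (fun t => radial_rhs g t (p ord0 ord0)) pi.
      rewrite (_ : 2 * pi = pi + pi); last by rewrite mulr_natl.
      rewrite prim_shift ?addrK// => x.
      by rewrite /radial_rhs abs_sin_periodic.
    rewrite prim_diff//; last by rewrite ler_peMl// ler1n.
    apply: eq_Rintegral => t; rewrite inE /= in_itv /= => /andP[t1 t2].
    rewrite polar_rhs_radial// mulN1r -[t](subrK pi) sinDpi opprK normrN ger0_norm//.
    by apply: sin_ge0_pi; apply/andP; split; lra.
  by rewrite mulrDl mul1r.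
have zE sgn t : polar_rhs (even_radial_field sgn g q) t p ord0 (lift ord0 l) =
    q.[p ord0 (lift ord0 l)].
  by rewrite mxE /= peval_vertical mxE /= liftK.
under eq_Rintegral do rewrite zE.
under [X in _ + X]eq_Rintegral do rewrite zE.
rewrite !Rintegral_cst//= !lebesgue_measure_itv/= !lte_fin.
have pi0' := pi_gt0 R; have pi2 : pi < 2 * pi :> R by rewrite ltr_pMl// ltr1n.
by rewrite pi0' pi2 /= hornerZ oppr0 addr0; ring.
Qed.

End PolynomialField.

(** * Simple zeros are admissible *)

Section DecoupledMap.
Variables (R : realType) (d : nat) (q : 'I_d.+1 -> {poly R}).
Implicit Types (x p v : 'rV[R]_d.+1).

Definition decoupled_map x : 'rV[R]_d.+1 := \row_i (q i).[x ord0 i].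

Lemma is_diff_coord (i : 'I_d.+1) x :
  is_diff x (fun y : 'rV[R]_d.+1 => y ord0 i : R) (fun v => v ord0 i).
Proof.
have @f : {linear 'rV[R]_d.+1 -> R}.
  by exists (fun N : 'rV[R]_d.+1 => N ord0 i); do 2![eexists]; do ?[constructor];
     rewrite ?mxE// => ? *; rewrite ?mxE//; move=> ?; rewrite !mxE.
have fC : continuous f by exact: coord_continuous.
apply: (@DiffDef _ _ _ _ _ f); first exact: linear_differentiable.
exact: (diff_lin x fC).
Qed.

Lemma is_diff_poly_coord (i : 'I_d.+1) x :
  is_diff x (fun y : 'rV[R]_d.+1 => (q i).[y ord0 i])
    (fun v => v ord0 i * (q i)^`().[x ord0 i]).
Proof.
have [qd qE] := is_derive_poly (q i) (x ord0 i).
have qd' : differentiable (horner (q i)) (x ord0 i) by exact/derivable1_diffP.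
have [cd cE] := is_diff_coord i x.
apply: DiffDef; first exact: (differentiable_comp cd qd').
rewrite -[LHS]/('d (horner (q i) \o (fun y : 'rV[R]_d.+1 => y ord0 i)) x : _ -> _).
rewrite diff_comp// cE; apply/funext => v /=.
by rewrite diff1E// derive1E qE.
Qed.

Lemma is_diff_decoupled x : is_diff x decoupled_map
  (fun v => \row_i (v ord0 i * (q i)^`().[x ord0 i])).
Proof.
have -> : decoupled_map = \sum_i (fun y => (q i).[y ord0 i] *: delta_mx 0 i).
  apply/funext => y; rewrite fct_sumE; apply/rowP => j; rewrite mxE summxE.
  rewrite (bigD1 j)//= !mxE !eqxx mulr1 big1 ?addr0// => i ij.
  by rewrite !mxE eqxx eq_sym (negPf ij) mulr0.
have -> : (fun v => \row_i (v ord0 i * (q i)^`().[x ord0 i])) =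
    \sum_i (fun v : 'rV[R]_d.+1 => (v ord0 i * (q i)^`().[x ord0 i]) *: delta_mx 0 i).
  apply/funext => y; rewrite fct_sumE; apply/rowP => j; rewrite mxE summxE.
  rewrite (bigD1 j)//= !mxE !eqxx mulr1 big1 ?addr0// => i ij.
  by rewrite !mxE eqxx eq_sym (negPf ij) mulr0.
elim/big_ind2: _ => [|f df g dg fD gD|i _]; first exact: is_diff_cst.
  exact: is_diffD.
have [kd kE] := is_diff_poly_coord i x.
by apply: DiffDef; [exact: differentiableZl | rewrite diffZl// kE].
Qed.

Lemma jacobian_decoupled x :
  jacobian decoupled_map x = diag_mx (\row_i (q i)^`().[x ord0 i]).
Proof.
have [fd fE] := is_diff_decoupled x.
apply/row_matrixP => i; rewrite [LHS]rowE /jacobian mul_rV_lin1 fE.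
apply/rowP => j; rewrite !mxE eqxx eq_sym.
by case: eqVneq => [->|_]; rewrite ?mul1r ?mulr1n// mul0r mulr0n.
Qed.

Lemma jac_det_decoupled x :
  jac_det decoupled_map x = \prod_i (q i)^`().[x ord0 i].
Proof.
rewrite /jac_det jacobian_decoupled det_diag.
by apply: eq_bigr => i _; rewrite mxE.
Qed.

Lemma decoupled_C1 (U : set 'rV[R]_d.+1) : C1_on U decoupled_map.
Proof.
split=> x _; first by have [] := is_diff_decoupled x.
have -> : (fun w => jacobian decoupled_map w) =
    (fun w => \matrix_(i, j) (if i == j then (q i)^`().[w ord0 i] else 0)).
  apply/funext => w; rewrite jacobian_decoupled; apply/matrixP => i j.
  by rewrite !mxE; case: eqVneq => [->|_]; rewrite ?mulr1n ?mulr0n.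
suff C : continuous (fun w : 'rV[R]_d.+1 =>
    \matrix_(i < d.+1, j < d.+1) (if i == j then (q i)^`().[w ord0 i] else 0)).
  exact: C.
apply: continuous_matrix => i j; case: (i == j); last exact: cst_continuous.
move=> w; apply: (@continuous_comp _ _ _ (fun y : 'rV[R]_d.+1 => y ord0 i) (horner (q i)^`())).
  exact: coord_continuous.
exact: continuous_horner.
Qed.

Lemma continuous_decoupled : continuous decoupled_map.
Proof.
by move=> x; apply: differentiable_continuous; have [] := is_diff_decoupled x.
Qed.

Lemma poly_locally_constant_sign (P : {poly R}) (a : R) : P.[a] != 0 ->
  exists2 h, 0 < h & forall t, `|a - t| < h -> sgz P.[t] = sgz P.[a].
Proof.
move=> Pa0.
have PC : continuous (fun t => P.[t] * P.[a]).
  by apply: continuous_mul; [exact: continuous_horner | exact: cst_continuous].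
have PP : 0 < P.[a] * P.[a] by rewrite -expr2 exprn_even_gt0.
have /nbhs_ballP[h /= h0 hP] := PC a [set y | 0 < y] (lt_nbhsr PP).
exists h => // t /hP /=.
case: (ltrgt0P P.[a]) Pa0 => // [Pa|Pa] _.
  by rewrite pmulr_lgt0// => Pt; rewrite !gtr0_sgz.
by rewrite nmulr_lgt0// => Pt; rewrite !ltr0_sgz.
Qed.

Lemma coord_le_norm v (i : 'I_d.+1) : `|v ord0 i| <= `|v|.
Proof.
rewrite -[leRHS]/(mx_norm v) mx_normrE.
exact: (le_bigmax _ (fun ij : 'I_1 * 'I_d.+1 => `|v ij.1 ij.2|) (ord0, i)).
Qed.

Lemma norm_le_coord v (c : R) : 0 <= c -> (forall i, `|v ord0 i| <= c) -> `|v| <= c.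
Proof.
move=> c0 vc; rewrite -[leLHS]/(mx_norm v) mx_normrE; apply: bigmax_le => // -[i j] _ /=.
by rewrite ord1.
Qed.

Lemma poly_mean_value (P : {poly R}) (a b : R) : a <= b ->
  exists2 c, a <= c <= b & P.[b] - P.[a] = P^`().[c] * (b - a).
Proof. by move=> ab; apply: (mean_value (is_derive_poly P)). Qed.

(** On a small cube around p each component is strictly monotone in its own
    variable. The map is then injective with a Jacobian of constant sign, and
    by the intermediate value theorem it takes once every value that is smaller
    than all its values on the boundary of the cube. So the degree is 1 or -1. *)
Lemma decoupled_admissible p : half_space p ->
  (forall i, (q i).[p ord0 i] = 0) -> (forall i, (q i)^`().[p ord0 i] != 0) ->
  admissible_zero decoupled_map p.
Proof.
move=> pH qp q'p; have p0 : 0 < p ord0 ord0 by exact: pH.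
have [h [h0 hp hsg]] : exists h : R, [/\ 0 < h, h < p ord0 ord0 &
    forall i t, `|p ord0 i - t| <= h ->
      sgz (q i)^`().[t] = sgz (q i)^`().[p ord0 i]].
  near (0 : R)^'+ => h; exists h; split=> //.
  near: h; apply: filter_forall => i.
  have [e e0 He] := poly_locally_constant_sign (q'p i).
  apply: filterS (nbhs_right_lt e0) => h he t th.
  by apply: He; exact: le_lt_trans he.
have sg0 i t : `|p ord0 i - t| <= h -> (q i)^`().[t] != 0.
  by move=> /hsg sgE; rewrite -sgz_eq0 sgE sgz_eq0.
pose U := ball p h.
have closureU : closure U = [set y | `|p - y| <= h].
  by rewrite -[closure U]/(closed_ball p h) closed_ballE.
have UE y : U y <-> `|p - y| < h by rewrite /U -ball_normE.
have coordU y i : closure U y -> `|p ord0 i - y ord0 i| <= h.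
  rewrite closureU /= => /(le_trans _); apply.
  by rewrite (_ : _ - _ = (p - y) ord0 i) ?coord_le_norm// !mxE.
have inj y z : closure U y -> closure U z -> decoupled_map y = decoupled_map z -> y = z.
  move=> Uy Uz yz; apply/rowP => i; apply/eqP.
  have := congr1 (fun v : 'rV__ => v ord0 i) yz; rewrite !mxE => qyz.
  have := coordU _ i Uy; have := coordU _ i Uz; move: qyz.
  wlog yzi : y z {Uy Uz yz} / y ord0 i <= z ord0 i => [H qyz zi yi|qyz zi yi].
    have [yz'|/ltW zy] := leP (y ord0 i) (z ord0 i); first exact: H.
    by rewrite eq_sym; apply: H.
  have [c /andP[yc cz] /eqP] := poly_mean_value (q i) yzi.
  rewrite qyz subrr eq_sym mulf_eq0 (negPf (sg0 i c _)) /=; last first.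
    by move: zi yi; rewrite !ler_norml => /andP[? ?] /andP[? ?]; apply/andP; split; lra.
  by rewrite subr_eq0 eq_sym.
have pU : U p by apply/UE; rewrite subrr normr0.
have pcU : closure U p := subset_closure pU.
have fp0 : decoupled_map p = 0 by apply/rowP => i; rewrite !mxE qp.
have detU y : closure U y -> sgz (jac_det decoupled_map y) = sgz (jac_det decoupled_map p).
  move=> Uy; rewrite !jac_det_decoupled.
  rewrite !(big_morph (@sgz R) (@sgzM R) (@sgz1 R)); apply: eq_bigr => i _.
  by rewrite hsg// coordU.
have detp : sgz (jac_det decoupled_map p) != 0.
  rewrite sgz_eq0 jac_det_decoupled; apply/prodf_neq0 => i _; exact: q'p.
have onto v : (forall x, (closure U `\` U) x -> `|v - 0| < `|decoupled_map x - 0|) ->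
    exists2 x, U x & decoupled_map x = v.
  move=> vb.
  (* At the centers of the faces of the cube only one component is nonzero. *)
  have side i (s : R) : `|s| = h -> `|v ord0 i| < `|(q i).[p ord0 i + s]|.
    move=> sh; pose y : 'rV[R]_d.+1 := p + s *: delta_mx 0 i.
    have yE : p - y = - s *: delta_mx 0 i by rewrite /y opprD addNKr scaleNr.
    have ny : `|p - y| = h.
      apply/eqP; rewrite eq_le; apply/andP; split.
        rewrite yE; apply: norm_le_coord => [|j]; first exact: ltW.
        rewrite !mxE eqxx /=; case: eqVneq => _; first by rewrite mulr1 normrN sh.
        by rewrite mulr0 normr0 ltW.
      apply: le_trans (coord_le_norm _ i).
      by rewrite yE !mxE !eqxx mulr1 normrN sh.
    have /vb : (closure U `\` U) y.
      by split; rewrite ?closureU /= ?UE ny ?ltxx.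
    rewrite !subr0 => /(le_lt_trans (coord_le_norm _ i)) /lt_le_trans; apply.
    apply: norm_le_coord => // j; rewrite /y !mxE eqxx /=.
    case: eqVneq => [->|ji]; first by rewrite mulr1.
    by rewrite mulr0 addr0 qp normr0.
  have /choice[x xP] : forall i, exists t, `|p ord0 i - t| < h /\ (q i).[t] = v ord0 i.
    move=> i.
    have hn : `|h| = h by rewrite gtr0_norm.
    have vh := side i h hn.
    have vh' : `|v ord0 i| < `|(q i).[p ord0 i - h]| by apply: side; rewrite normrN.
    pose a := p ord0 i - h; pose b := p ord0 i + h; pose P := q i - (v ord0 i)%:P.
    have ab : a <= b by rewrite /a /b; lra.
    suff [t tab Pt] : exists2 t, a <= t <= b & root P t.
      have Pt0 : P.[t] = 0 by exact/rootP.
      exists t; split; last by move: Pt0; rewrite hornerD hornerN hornerC => /subr0_eq.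
      have ta : t != a.
        apply: contraTneq vh' => ta; move: Pt0.
        by rewrite hornerD hornerN hornerC ta => /subr0_eq ->; rewrite ltxx.
      have tb : t != b.
        apply: contraTneq vh => tb; move: Pt0.
        by rewrite hornerD hornerN hornerC tb => /subr0_eq ->; rewrite ltxx.
      have /andP[at_ tb'] := tab.
      have : a < t by rewrite lt_neqAle eq_sym ta.
      have : t < b by rewrite lt_neqAle tb.
      by rewrite ltr_norml /a /b => ? ?; apply/andP; split; lra.
    have ap : a <= p ord0 i by rewrite /a; lra.
    have pb : p ord0 i <= b by rewrite /b; lra.
    have [c /andP[ac cp]] := poly_mean_value (q i) ap.
    have [c' /andP[pc' c'b]] := poly_mean_value (q i) pb.
    rewrite qp subr0 sub0r => qb qa.
    have sc : sgz (q i)^`().[c] = sgz (q i)^`().[p ord0 i].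
      by apply: hsg; rewrite ler_norml; apply/andP; move: ac; rewrite /a; split; lra.
    have sc' : sgz (q i)^`().[c'] = sgz (q i)^`().[p ord0 i].
      by apply: hsg; rewrite ler_norml; apply/andP; move: c'b; rewrite /b; split; lra.
    have hb : b - p ord0 i = h by rewrite /b; ring.
    have ha : p ord0 i - a = h by rewrite /a; ring.
    rewrite hb in qb; rewrite ha in qa.
    have [q'0|q'0|q'0] := ltrgt0P (q i)^`().[p ord0 i]; last by have := q'p i; rewrite q'0 eqxx.
    - rewrite (gtr0_sgz q'0) in sc sc'.
      have c0 : 0 < (q i)^`().[c] by rewrite -sgz_gt0 sc.
      have c'0 : 0 < (q i)^`().[c'] by rewrite -sgz_gt0 sc'.
      have qb0 : 0 < (q i).[b] by rewrite qb mulr_gt0.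
      have qa0 : (q i).[a] < 0 by rewrite -oppr_gt0 qa mulr_gt0.
      apply: poly_ivt => //; rewrite !hornerD !hornerN !hornerC.
      move: vh vh'; rewrite -/a -/b (gtr0_norm qb0) (ltr0_norm qa0) !ltr_norml.
      by move=> /andP[? ?] /andP[? ?]; apply/andP; split; lra.
    - rewrite (ltr0_sgz q'0) in sc sc'.
      have c0 : (q i)^`().[c] < 0 by rewrite -sgz_lt0 sc.
      have c'0 : (q i)^`().[c'] < 0 by rewrite -sgz_lt0 sc'.
      have qb0 : (q i).[b] < 0 by rewrite qb nmulr_rlt0.
      have qa0 : 0 < (q i).[a] by rewrite -oppr_lt0 qa nmulr_rlt0.
      have [|t tab] := @poly_ivt R (- P) a b ab; last by rewrite rootN; exists t.
      rewrite !hornerN !hornerD !hornerN !hornerC.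
      move: vh vh'; rewrite -/a -/b (ltr0_norm qb0) (gtr0_norm qa0) !ltr_norml.
      by move=> /andP[? ?] /andP[? ?]; apply/andP; split; lra.
  exists (\row_i x i); last by apply/rowP => i; rewrite !mxE; have [] := xP i.
  by split=> // j i; rewrite mxE ord1; have [] := xP i.
have bU : bounded_set U.
  exists (`|p| + h); split; first by rewrite num_real.
  move=> M hM y /UE Uy /=; rewrite (le_trans _ (ltW hM))//.
  rewrite (_ : y = p - (p - y)); last by rewrite opprB addrC subrK.
  by rewrite (le_trans (ler_normB _ _))// lerD2l ltW.
have bdry y : (closure U `\` U) y -> decoupled_map y <> 0.
  by move=> [Uy Uy'] fy; apply: Uy'; rewrite (inj y p) ?fy.
have fibre v y : U y -> decoupled_map y = v ->
    U `&` decoupled_map @^-1` [set v] = [set y].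
  move=> Uy yv; apply/seteqP; split=> [z [Uz /= zv]|_ ->//].
  by apply: inj; rewrite ?zv//; exact: subset_closure.
split=> //; exists U; split.
- by split=> //; exact: ball_open.
- by [].
- move=> y Uy; have := coordU _ ord0 Uy; rewrite /half_space /= ler_norml => /andP[_].
  by move: hp; lra.
- by move=> y Uy yp fy0; apply: yp; apply: inj => //; rewrite fy0.
have degU k : is_brouwer_degree decoupled_map U 0 k -> k = sgz (jac_det decoupled_map p).
  move=> [_ _ _ /(_ 0)] <-; first by rewrite (fibre _ p)// fsbig_set1.
    move=> y Uy fy; rewrite (inj y p) ?fy//; last exact: subset_closure.
    by move: detp; rewrite sgz_eq0.
  by move=> y /bdry/eqP fy; rewrite !subr0 normr0 normr_gt0.
rewrite /brouwer_degree; case: xgetP => [k _ /= /degU ->//|none].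
case: (none (sgz (jac_det decoupled_map p))); split.
- by split=> //; exact: ball_open.
- by split; [exact: decoupled_C1 | exact/continuous_subspaceT/continuous_decoupled].
- exact: bdry.
- move=> v _ /onto[y Uy yv]; rewrite (fibre v y Uy yv) fsbig_set1.
  exact: detU (subset_closure Uy).
Unshelve. all: by end_near. Qed.

End DecoupledMap.

(** * Periodic orbits of the example *)

Section Angle.
Variable R : realType.

Lemma unit_vector_angle (a b : R) : a ^+ 2 + b ^+ 2 = 1 ->
  exists phi, a = cos phi /\ b = sin phi.
Proof.
move=> ab1.
have a1 : -1 <= a <= 1.
  rewrite -ler_norml -(@ler_pXn2r _ 2)// ?nnegrE// real_normK ?num_real// expr1n.
  by rewrite -ab1 lerDl sqr_ge0.
have ca : cos (acos a) = a by rewrite acosK// in_itv.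
have sa : sin (acos a) = `|b|.
  by rewrite sin_acos// -sqrtr_sqr; congr (Num.sqrt _); rewrite -ab1; ring.
have [b0|b0] := leP 0 b.
  by exists (acos a); rewrite ca sa ger0_norm.
by exists (- acos a); rewrite cosN sinN ca sa ltr0_norm// opprK.
Qed.

Lemma cos_eq1_multiple (T : R) : 0 < T -> cos T = 1 ->
  exists2 m : nat, (0 < m)%N & T = pi *+ m.
Proof.
move=> T0 cT; have pi0 := pi_gt0 R.
pose P : R := pi *+ 2.
have P0 : 0 < P by rewrite pmulrn_lgt0.
have /truncn_itv : 0 <= T / P by rewrite divr_ge0// ltW.
set n := Num.truncn _; rewrite ler_pdivlMr// ltr_pdivrMr// => /andP[nT Tn].
pose s := T - P *+ n.
have cs : cos s = 1.
  by rewrite -cT -[in RHS](subrK (P *+ n) T) (periodicn (@cosD2pi R)).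
have s0 : 0 <= s by rewrite subr_ge0 -mulr_natl.
have sP : s < P by move: Tn; rewrite -natr1 mulrDl mul1r mulr_natl /s; lra.
have s00 : s = 0.
  have [spi|spi] := leP s pi.
    by apply: cos_inj; rewrite ?in_itv/= ?lexx ?s0 ?spi ?(ltW pi0)// cs cos0.
  have c2 : cos (P - s) = 1 by rewrite -cs -cosN opprB -(cosD2pi (s - P)) subrK.
  have : P - s = 0.
    apply: cos_inj; rewrite ?in_itv/= ?lexx ?(ltW pi0)// ?c2 ?cos0//.
    by move: spi sP; rewrite /P; lra.
  by move: sP; lra.
exists (2 * n)%N; last by rewrite mulrnA -/P; move: s00; rewrite /s; lra.
rewrite muln_gt0 /= lt0n; apply/eqP => n0.
by move: s00; rewrite /s n0 mulr0n subr0 => TT; rewrite TT ltxx in T0.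
Qed.

End Angle.

Section Dynamics.
Variables (R : realType) (d : nat) (g q : {poly R}).
Implicit Types (eps : R) (p : 'rV[R]_d.+1) (gam : R -> 'rV[R]_d.+2) (u : R -> R).

Local Notation upper eps := (vfield eps (@even_radial_field R d 1 g q)).
Local Notation lower eps := (vfield eps (@even_radial_field R d (-1) g q)).

Lemma continuous_even_vfield eps gam :
  (forall i, continuous (fun t => gam t ord0 i)) ->
  forall i, continuous (fun t => even_vfield eps g q (gam t) ord0 i).
Proof.
move=> gamC i.
have sC : continuous (fun t => \sum_(j < size g) radial_coef g j * `|gam t ord0 iy| ^+ j).
  apply: continuous_big => [|j _]; first exact: add_continuous.
  apply: continuous_mul; first exact: cst_continuous.
  apply: continuous_expr => t.
  apply: (@continuous_comp _ _ _ (fun t => gam t ord0 iy) (fun x => `|x|)).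
    exact: gamC.
  exact: norm_continuous.
have [->|->|[l ->]] := coordP i; under eq_fun do rewrite mxE /=.
- apply: continuous_add.
    by move=> t; apply: continuousN; exact: gamC.
  by apply: continuous_mul; [exact: cst_continuous | exact: continuous_mul].
- apply: continuous_add => //.
  by apply: continuous_mul; [exact: cst_continuous | exact: continuous_mul].
- rewrite ?iz_neq_iy; apply: continuous_mul; first exact: cst_continuous.
  move=> t; apply: (@continuous_comp _ _ _ (fun t => gam t ord0 (iz l)) (horner q)).
    exact: gamC.
  exact: continuous_horner.
Qed.

(** The field is continuous along a solution, so the velocity is continuous
    and the integral equation can be differentiated. *)
Lemma is_solution_even eps gam : is_solution (upper eps) (lower eps) gam <->
  forall i t, is_derive t (1 : R) (fun t => gam t ord0 i)
    (even_vfield eps g q (gam t) ord0 i).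
Proof.
split=> [[v [vF vI]]|gamD].
  have vE t : v t = even_vfield eps g q (gam t) by apply/filippov_even.
  have gamC i : continuous (fun t => gam t ord0 i).
    by apply: (continuous_integral_eq (h := fun t => v t ord0 i)) => s t; exact: vI.
  move=> i; apply: is_derive_integral_eq; first exact: continuous_even_vfield.
  move=> s t st; have [_ ->] := vI i s t st.
  by apply: eq_Rintegral => x _; rewrite vE.
have gamC i : continuous (fun t => gam t ord0 i) by exact: is_derive_continuous (gamD i).
have FC := @continuous_even_vfield eps _ gamC.
exists (fun t => even_vfield eps g q (gam t)); split.
  by move=> t; exact/filippov_even.
move=> i s t st; split; first exact: (continuous_integrable _ _ (FC i)).
exact: (integral_derivative (FC i) (gamD i)).
Qed.

Definition orbit_point p (r t : R) : 'rV[R]_d.+2 :=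
  \row_i (if i == ix then r * cos t else if i == iy then r * sin t
          else if unlift ord0 i is Some j then p ord0 j else 0).

Lemma orbit_point_x p r t : orbit_point p r t ord0 ix = r * cos t.
Proof. by rewrite mxE. Qed.

Lemma orbit_point_y p r t : orbit_point p r t ord0 iy = r * sin t.
Proof. by rewrite mxE. Qed.

Lemma orbit_point_z p r t (l : 'I_d) :
  orbit_point p r t ord0 (iz l) = p ord0 (lift ord0 l).
Proof. by rewrite mxE iz_neq_ix iz_neq_iy /iz liftK. Qed.

Lemma orbit_point_periodic p r t : orbit_point p r (t + pi *+ 2) = orbit_point p r t.
Proof.
apply/rowP => i; have [->|->|[l ->]] := coordP i.
- by rewrite !orbit_point_x cosD2pi.
- by rewrite !orbit_point_y mulr2n addrA !sinDpi opprK.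
- by rewrite !orbit_point_z.
Qed.

Lemma orbit_solution eps p u : (forall t, 0 < u t) ->
  (forall t, is_derive t (1 : R) u (eps * radial_rhs g t (u t))) ->
  (forall l : 'I_d, q.[p ord0 (lift ord0 l)] = 0) ->
  is_solution (upper eps) (lower eps) (fun t => orbit_point p (u t) t).
Proof.
move=> u0 uD qp; apply/is_solution_even => i t.
have sE : \sum_(j < size g) radial_coef g j * `|orbit_point p (u t) t ord0 iy| ^+ j =
    \sum_(j < size g) radial_coef g j * (`|sin t| * u t) ^+ j.
  by rewrite orbit_point_y normrM (gtr0_norm (u0 t)) mulrC.
have [->|->|[l ->]] := coordP i.
- rewrite (_ : (fun t => _) = fun t => u t * cos t); last first.
    by apply/funext => s; rewrite orbit_point_x.
  have := derive_mul (uD t) (is_derive_cos t).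
  congr (is_derive _ _ _ _).
  by rewrite [RHS]mxE /= sE orbit_point_x orbit_point_y /radial_rhs; ring.
- rewrite (_ : (fun t => _) = fun t => u t * sin t); last first.
    by apply/funext => s; rewrite orbit_point_y.
  have := derive_mul (uD t) (is_derive_sin t).
  congr (is_derive _ _ _ _).
  by rewrite [RHS]mxE /= sE orbit_point_x orbit_point_y /radial_rhs; ring.
- rewrite (_ : (fun t => _) = fun=> p ord0 (lift ord0 l)); last first.
    by apply/funext => s; rewrite orbit_point_z.
  rewrite mxE iz_neq_ix iz_neq_iy orbit_point_z qp mulr0; exact: derive_const.
Qed.

Lemma orbit_periodic eps p u : (forall t, 0 < u t) ->
  (forall t, is_derive t (1 : R) u (eps * radial_rhs g t (u t))) ->
  (forall t, u (t + pi) = u t) ->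
  (forall l : 'I_d, q.[p ord0 (lift ord0 l)] = 0) ->
  periodic_orbit (upper eps) (lower eps) (range (fun t => orbit_point p (u t) t)).
Proof.
move=> u0 uD uP qp; exists (fun t => orbit_point p (u t) t), (pi *+ 2); split.
- exact: orbit_solution.
- by rewrite pmulrn_lgt0// pi_gt0.
- by move=> t; rewrite (periodic_nat 2 t uP) orbit_point_periodic.
- exists pi => /(congr1 (fun v : 'rV__ => v ord0 ix)).
  rewrite !orbit_point_x cospi cos0 => h.
  by have := u0 pi; have := u0 0; lra.
- by [].
Qed.

End Dynamics.

(** * Isolation of the periodic orbits *)

Section Isolation.
Variables (R : realType) (d : nat).
Implicit Types (g q : {poly R}) (eps : R) (p : 'rV[R]_d.+1).

Lemma poly_linearization (P : {poly R}) (a lam : R) : 0 < lam ->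
  exists2 eta, 0 < eta & forall x, `|x - a| <= eta ->
    `|P.[x] - P.[a] - P^`().[a] * (x - a)| <= lam * `|x - a|.
Proof.
move=> lam0.
have /cvgrPdist_le/(_ lam lam0)/nbhs_ballP[e /= e0 eP] := @continuous_horner R P^`() a.
exists (e / 2); first by rewrite divr_gt0.
move=> x xa; have ee : e / 2 < e by rewrite ltr_pdivrMr// ltr_pMr// ltr1n.
suff [c ca ->] : exists2 c, `|a - c| < e & P.[x] - P.[a] = P^`().[c] * (x - a).
  by rewrite -mulrBl normrM ler_wpM2r// distrC; exact: eP.
have [ax|/ltW xa'] := leP a x.
  have [c /andP[ac cx] ->] := poly_mean_value P ax; exists c => //.
  by move: xa; rewrite ler_norml ltr_norml => /andP[? ?]; apply/andP; split; lra.
have [c /andP[xc ca] E] := poly_mean_value P xa'; exists c => //.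
  by move: xa; rewrite ler_norml ltr_norml => /andP[? ?]; apply/andP; split; lra.
by rewrite -[LHS]opprB E -mulrN opprB.
Qed.

(** The deviation from a simple equilibrium satisfies a linear equation up
    to a small error, to which periodic_rigidity applies. *)
Lemma simple_equilibrium_isolated q (zeta : R) : q.[zeta] = 0 ->
  q^`().[zeta] != 0 -> exists2 eta, 0 < eta &
  forall eps T (z : R -> R), eps != 0 -> 0 < T -> (forall t, z (t + T) = z t) ->
    (forall t, is_derive t (1 : R) z (eps * q.[z t])) ->
    (forall t, `|z t - zeta| <= eta) -> forall t, z t = zeta.
Proof.
move=> qz q'z; pose k := q^`().[zeta].
have k0 : 0 < `|k| by rewrite normr_gt0.
have k2 : 0 < `|k| / 2 by rewrite divr_gt0.
have kk : `|k| / 2 < `|k| by rewrite ltr_pdivrMr// ltr_pMr// ltr1n.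
have [eta eta0 lin] := poly_linearization q zeta k2.
exists eta => // eps T z eps0 T0 zT zD zeta_z t.
apply/eqP; rewrite -subr_eq0; apply/eqP.
apply: (@periodic_rigidity _ (fun t => z t - zeta)
  (fun t => q.[z t] - k * (z t - zeta)) eps k (`|k| / 2) T) => //.
- by move=> x; rewrite zT.
- move=> x; have := derive_sub (zD x) (derive_const zeta x).
  by congr (is_derive _ _ _ _); ring.
- by move=> x; have := lin _ (zeta_z x); rewrite qz subr0.
Qed.

(** In the frame rotating with unit speed the point moves along a fixed
    ray, since its two coordinates A and B satisfy the same linear equation as
    the radius. *)
Lemma polar_decomposition eps (x y s : R -> R) :
  (forall t, is_derive t (1 : R) x (- y t + eps * (x t * s t))) ->
  (forall t, is_derive t (1 : R) y (x t + eps * (y t * s t))) ->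
  (forall t, 0 < x t ^+ 2 + y t ^+ 2) ->
  exists phi (r : R -> R), [/\ forall t, 0 < r t,
    forall t, is_derive t (1 : R) r (eps * (r t * s t)),
    forall t, x t = r t * cos (t + phi) & forall t, y t = r t * sin (t + phi)].
Proof.
move=> xD yD N0.
pose N (t : R) : R := x t * x t + y t * y t.
have NE t : N t = x t ^+ 2 + y t ^+ 2 by rewrite /N; ring.
have Npos t : 0 < N t by rewrite NE.
pose r (t : R) : R := Num.sqrt (N t).
have r0 t : 0 < r t by rewrite sqrtr_gt0.
have rN t : r t ^+ 2 = N t by rewrite sqr_sqrtr// ltW.
have rneq t : r t != 0 by rewrite gt_eqF.
have rD t : is_derive t (1 : R) r (eps * (r t * s t)).
  have ND := derive_add (derive_mul (xD t) (xD t)) (derive_mul (yD t) (yD t)).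
  have := derive_comp (is_derive1_sqrt (Npos t)) ND.
  congr (is_derive _ _ _ _).
  rewrite -/(r t) invfM.
  transitivity (2^-1 * (r t)^-1 * (2 * eps * s t * N t)); first by rewrite /N; ring.
  by rewrite -rN; field.
have VD t : is_derive t (1 : R) (fun t => (r t)^-1) (- (eps * s t) * (r t)^-1).
  have := is_deriveV (rneq t) (rD t).
  congr (is_derive _ _ _ _).
  by rewrite /GRing.scale /=; field.
have const (a : R -> R) : (forall t, is_derive t (1 : R) a (eps * s t * a t)) ->
    forall t, a t = a 0 / r 0 * r t.
  move=> aD t; rewrite -[LHS](mulfVK (rneq t)); congr (_ * _).
  apply: (@is_derive_0_is_cst _ (fun t => a t / r t)) => z.
  have := derive_mul (aD z) (VD z).
  by congr (is_derive _ _ _ _); ring.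
pose A t := x t * cos t + y t * sin t.
pose B t := y t * cos t - x t * sin t.
have AD t : is_derive t (1 : R) A (eps * s t * A t).
  have := derive_add (derive_mul (xD t) (is_derive_cos t)) (derive_mul (yD t) (is_derive_sin t)).
  by congr (is_derive _ _ _ _); rewrite /A; ring.
have BD t : is_derive t (1 : R) B (eps * s t * B t).
  have := derive_sub (derive_mul (yD t) (is_derive_cos t)) (derive_mul (xD t) (is_derive_sin t)).
  by congr (is_derive _ _ _ _); rewrite /B; ring.
have xE t : x t = A t * cos t - B t * sin t.
  rewrite /A /B; transitivity (x t * (cos t ^+ 2 + sin t ^+ 2)); last by ring.
  by rewrite cos2Dsin2 mulr1.
have yE t : y t = A t * sin t + B t * cos t.
  rewrite /A /B; transitivity (y t * (cos t ^+ 2 + sin t ^+ 2)); last by ring.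
  by rewrite cos2Dsin2 mulr1.
have [phi [cE sE]] : exists phi, A 0 / r 0 = cos phi /\ B 0 / r 0 = sin phi.
  apply: unit_vector_angle.
  rewrite /A /B cos0 sin0 !mulr0 !mulr1 addr0 subr0 !exprMn exprVn rN -mulrDl -NE.
  by rewrite mulfV// gt_eqF.
exists phi, r; split=> // t.
  by rewrite xE (const _ AD) (const _ BD) cE sE cosD; ring.
by rewrite yE (const _ AD) (const _ BD) cE sE sinD; ring.
Qed.

End Isolation.

Section LimitCycles.
Variables (R : realType) (d : nat) (g q : {poly R}).
Implicit Types (eps : R) (p : 'rV[R]_d.+1) (u : R -> R).

Local Notation upper eps := (vfield eps (@even_radial_field R d 1 g q)).
Local Notation lower eps := (vfield eps (@even_radial_field R d (-1) g q)).

Definition simple_node p : Prop :=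
  [/\ 0 < p ord0 ord0, g.[p ord0 ord0] = 0, g^`().[p ord0 ord0] != 0,
      forall l : 'I_d, q.[p ord0 (lift ord0 l)] = 0 &
      forall l : 'I_d, q^`().[p ord0 (lift ord0 l)] != 0].

(** The bounds on x ^ 2 + y ^ 2 say that the distance to the z-space
    differs from the radius of p by less than eta, provided that eta is smaller
    than this radius. *)
Definition tube p (eta : R) : set 'rV[R]_d.+2 :=
  [set w | ((p ord0 ord0 - eta) ^+ 2 < w ord0 ix ^+ 2 + w ord0 iy ^+ 2) /\
           (w ord0 ix ^+ 2 + w ord0 iy ^+ 2 < (p ord0 ord0 + eta) ^+ 2) /\
           forall l, `|w ord0 (iz l) - p ord0 (lift ord0 l)| < eta].

Lemma open_tube p eta : open (tube p eta).
Proof.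
have cC (i : 'I_d.+2) : continuous (fun w : 'rV[R]_d.+2 => w ord0 i).
  exact: coord_continuous.
have NC : continuous (fun w : 'rV[R]_d.+2 => w ord0 ix ^+ 2 + w ord0 iy ^+ 2).
  by apply: continuous_add; apply: continuous_expr; exact: cC.
rewrite openE => w [w1 [w2 w3]].
have Fw : Filter (nbhs w) := @nbhs_filter _ w.
apply: filterI; first exact: (NC w [set x | _ < x] (lt_nbhsr w1)).
apply: filterI; first exact: (NC w [set x | x < _] (lt_nbhsl w2)).
apply: (@filter_forall _ _ (fun l (y : 'rV[R]_d.+2) =>
  `|y ord0 (iz l) - p ord0 (lift ord0 l)| < eta) (nbhs w) Fw) => l.
have lC : continuous (fun y : 'rV[R]_d.+2 => `|y ord0 (iz l) - p ord0 (lift ord0 l)|).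
  move=> y; apply: (@continuous_comp _ _ _
    (fun y : 'rV[R]_d.+2 => y ord0 (iz l) - p ord0 (lift ord0 l)) (fun x => `|x|)).
    by apply: continuous_sub y; [exact: cC | exact: cst_continuous].
  exact: norm_continuous.
exact: (lC w [set x | x < eta] (lt_nbhsl (w3 l))).
Qed.

Lemma tube_radius p eta (r t : R) : 0 < r -> 0 < eta -> eta < p ord0 ord0 ->
  (p ord0 ord0 - eta) ^+ 2 < (r * cos t) ^+ 2 + (r * sin t) ^+ 2 ->
  (r * cos t) ^+ 2 + (r * sin t) ^+ 2 < (p ord0 ord0 + eta) ^+ 2 ->
  `|r - p ord0 ord0| < eta.
Proof.
move=> r0 eta0 etap; rewrite !exprMn -mulrDr cos2Dsin2 mulr1 => h1 h2.
have {}h1 : p ord0 ord0 - eta < r.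
  by move: h1; rewrite ltr_pXn2r ?nnegrE//; lra.
have {}h2 : r < p ord0 ord0 + eta.
  by move: h2; rewrite ltr_pXn2r ?nnegrE//; lra.
by rewrite ltr_norml; apply/andP; split; lra.
Qed.

Lemma orbit_in_tube p eta (r t : R) : 0 < eta -> eta < p ord0 ord0 ->
  `|r - p ord0 ord0| < eta -> tube p eta (orbit_point p r t).
Proof.
move=> eta0 etap; rewrite ltr_norml => /andP[h1 h2].
rewrite /tube /= orbit_point_x orbit_point_y !exprMn -mulrDr cos2Dsin2 mulr1.
split; first by rewrite ltr_pXn2r ?nnegrE//; lra.
split; first by rewrite ltr_pXn2r ?nnegrE//; lra.
by move=> l; rewrite orbit_point_z subrr normr0.
Qed.

Lemma orbit_shift p (u : R -> R) (phi : R) :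
  range (fun t => orbit_point p (u (t + phi)) (t + phi)) =
  range (fun t => orbit_point p (u t) t).
Proof.
apply/seteqP; split=> _ [t _ <-]; first by exists (t + phi).
by exists (t - phi); rewrite ?subrK.
Qed.

(** On a periodic orbit inside a thin tube z is constant by
    simple_equilibrium_isolated. The orbit is then planar and, up to a shift of
    time, its radius solves the radial equation; its period is a multiple of
    pi, so this radius is u by periodic_solution_unique. *)
Lemma orbit_limit_cycle p : simple_node p -> exists2 eta, 0 < eta &
  forall eps u, eps != 0 ->
    (forall t, is_derive t (1 : R) u (eps * radial_rhs g t (u t))) ->
    (forall t, u (t + pi) = u t) ->
    (forall t, `|u t - p ord0 ord0| < eta) ->
    limit_cycle (upper eps) (lower eps) (range (fun t => orbit_point p (u t) t)).
Proof.
move=> [p0 gp g'p qp q'p].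
have [H saz] := radial_simple_average_zero (lt0r_neq0 p0) gp g'p.
have [eta1 eta1_0 uniq] := periodic_solution_unique saz.
have /choice[ez ezP] : forall l : 'I_d, exists eta : R, 0 < eta /\
    forall eps T (z : R -> R), eps != 0 -> 0 < T -> (forall t, z (t + T) = z t) ->
    (forall t, is_derive t (1 : R) z (eps * q.[z t])) ->
    (forall t, `|z t - p ord0 (lift ord0 l)| <= eta) ->
    forall t, z t = p ord0 (lift ord0 l).
  move=> l; have [eta eta0 etaP] := simple_equilibrium_isolated (qp l) (q'p l).
  by exists eta.
have [eta [eta0 etap eta_1 eta_z]] : exists eta : R,
    [/\ 0 < eta, eta < p ord0 ord0, eta <= eta1 & forall l, eta <= ez l].
  near (0 : R)^'+ => eta; exists eta; split=> //.
    by near: eta; exact: nbhs_right_le.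
  near: eta; apply: filter_forall => l; apply: nbhs_right_le.
  by have [] := ezP l.
exists eta => // eps u eps0 uD uP ur.
have u0 t : 0 < u t.
  by have := ur t; rewrite ltr_norml => /andP[? ?]; lra.
split; first exact: orbit_periodic.
exists (tube p eta); split; first exact: open_tube.
  by move=> _ [t _ <-]; exact: orbit_in_tube.
move=> G' [gam [T [gamS T0 gamT _ ->]]] gamW.
have gW t : tube p eta (gam t) by apply: gamW; exists t.
have gD := (is_solution_even g q eps gam).1 gamS.
have gz l t : gam t ord0 (iz l) = p ord0 (lift ord0 l).
  have [_ ezl] := ezP l.
  apply: (ezl eps T (fun t => gam t ord0 (iz l))) => //.
  - by move=> s; rewrite gamT.
  - by move=> s; have := gD (iz l) s; rewrite even_vfield_z.
  - move=> s; have [_ [_ /(_ l) gl]] := gW s.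
    by rewrite (le_trans (ltW gl)).
pose s t := \sum_(j < size g) radial_coef g j * `|gam t ord0 iy| ^+ j.
have [phi [r [r0 rD xE yE]]] : exists phi (r : R -> R), [/\ forall t, 0 < r t,
    forall t, is_derive t (1 : R) r (eps * (r t * s t)),
    forall t, gam t ord0 ix = r t * cos (t + phi) &
    forall t, gam t ord0 iy = r t * sin (t + phi)].
  apply: (@polar_decomposition R eps (fun t => gam t ord0 ix) (fun t => gam t ord0 iy) s).
  - by move=> t; have := gD ix t; rewrite even_vfield_x.
  - by move=> t; have := gD iy t; rewrite even_vfield_y.
  - move=> t; have [h _] := gW t; apply: le_lt_trans h; exact: sqr_ge0.
have rT t : r (t + T) = r t.
  have N (x : R) : r x ^+ 2 = gam x ord0 ix ^+ 2 + gam x ord0 iy ^+ 2.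
    by rewrite xE yE !exprMn -mulrDr cos2Dsin2 mulr1.
  by apply/eqP; rewrite -(@eqrXn2 _ 2)// ?ltW// !N gamT.
(* At time - phi the angle is 0, and it is T one period later. *)
have cT : cos T = 1.
  have := xE (- phi + T); rewrite gamT xE rT => /(mulfI (lt0r_neq0 (r0 _))).
  by rewrite addNr cos0 addrAC addNr add0r.
have [m m0 Tm] := cos_eq1_multiple T0 cT.
have vE : forall t, u t = r (t - phi).
  apply: (uniq eps u (fun t => r (t - phi)) m eps0 m0) => //.
  - move=> t.
    have sE : r (t - phi) * s (t - phi) = radial_rhs g t (r (t - phi)).
      rewrite /radial_rhs /s yE subrK normrM (gtr0_norm (r0 _)); congr (_ * _).
      by apply: eq_bigr => j _; rewrite [r _ * _]mulrC.
    have := @derive_comp R r (fun t => t - phi) _ _ t (rD (t - phi))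
      (derive_translate (- phi) t).
    by rewrite mulr1 sE.
  - by move=> t; exact: (periodic_nat m t uP).
  - by move=> t; rewrite -Tm addrAC rT.
  - by move=> t; rewrite (le_trans (ltW (ur t))).
  - move=> t; have [h1 [h2 _]] := gW (t - phi); rewrite !xE !yE in h1 h2.
    by rewrite (le_trans (ltW (tube_radius (r0 _) eta0 etap h1 h2))).
suff -> : gam = (fun t => orbit_point p (u (t + phi)) (t + phi)) by exact: orbit_shift.
apply/funext => t.
apply/rowP => i; have [->|->|[l ->]] := coordP i.
- by rewrite xE orbit_point_x vE addrK.
- by rewrite yE orbit_point_y vE addrK.
- by rewrite gz orbit_point_z.
Unshelve. all: by end_near. Qed.

Lemma enorm_orbit_sub p (r s t : R) :
  enorm (orbit_point p r t - orbit_point p s t) = `|r - s|.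
Proof.
have E i : (orbit_point p r t - orbit_point p s t) ord0 i =
    orbit_point p r t ord0 i - orbit_point p s t ord0 i.
  by rewrite mxE [X in _ + X]mxE.
rewrite /enorm (eq_bigr _ (fun i _ => congr1 (fun x => x ^+ 2) (E i))).
rewrite !big_ord_recl big1 ?addr0 => [|l _]; last first.
  by rewrite -/(iz l) !orbit_point_z subrr expr0n.
rewrite -/ix -/iy !orbit_point_x !orbit_point_y.
by rewrite -!mulrBl !exprMn -mulrDr cos2Dsin2 mulr1 sqrtr_sqr.
Qed.

Lemma enorm_coord_lt (v : 'rV[R]_d.+2) (delta : R) : 0 < delta ->
  (forall i, `|v ord0 i| <= delta / d.+2%:R) -> enorm v < delta.
Proof.
move=> delta0 vd; rewrite /enorm -[ltRHS](ger0_norm (ltW delta0)) -sqrtr_sqr.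
rewrite ltr_sqrt ?exprn_gt0//.
apply: (@le_lt_trans _ _ (\sum_(i < d.+2) (delta / d.+2%:R) ^+ 2)).
  apply: ler_sum => i _; rewrite -[leLHS]real_normK ?num_real//.
  by rewrite lerXn2r ?nnegrE// divr_ge0// ltW.
rewrite sumr_const card_ord -(mulr_natr (_ ^+ 2)).
have N0 : d.+2%:R != 0 :> R by rewrite pnatr_eq0.
rewrite (_ : (delta / d.+2%:R) ^+ 2 * d.+2%:R = delta ^+ 2 / d.+2%:R); last first.
  by move: (d.+2%:R) N0 => N N0; field.
by rewrite ltr_pdivrMr// ltr_pMr ?exprn_gt0// ltr1n.
Qed.

Lemma circle_orbit p w : 0 < p ord0 ord0 -> circle p w ->
  exists t, w = orbit_point p (p ord0 ord0) t.
Proof.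
move=> p0 [wxy wz].
have [t [ct st]] : exists t, w ord0 ix / p ord0 ord0 = cos t /\ w ord0 iy / p ord0 ord0 = sin t.
  apply: unit_vector_angle; rewrite !exprMn exprVn -mulrDl wxy mulfV//.
  by rewrite expf_neq0// gt_eqF.
exists t; apply/rowP => i; have [->|->|[l ->]] := coordP i.
- by rewrite orbit_point_x -ct mulrCA mulfV ?mulr1// gt_eqF.
- by rewrite orbit_point_y -st mulrCA mulfV ?mulr1// gt_eqF.
- by rewrite orbit_point_z wz.
Qed.

Lemma orbit_circle p t : circle p (orbit_point p (p ord0 ord0) t).
Proof.
split; last by move=> l; rewrite orbit_point_z.
by rewrite orbit_point_x orbit_point_y !exprMn -mulrDr cos2Dsin2 mulr1.
Qed.

Lemma orbit_tends_to p (U : R -> R -> R) :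
  0 < p ord0 ord0 ->
  (forall eta, 0 < eta -> \forall eps \near (0 : R)^',
     forall t, `|U eps t - p ord0 ord0| < eta) ->
  tends_to (fun eps => range (fun t => orbit_point p (U eps t) t)) (circle p).
Proof.
move=> p0 Up eta eta0; apply: filterS (Up _ eta0) => eps Ueps; split.
  move=> _ [t _ <-]; exists (orbit_point p (p ord0 ord0) t); first exact: orbit_circle.
  by rewrite enorm_orbit_sub.
move=> w /(circle_orbit p0)[t ->]; exists (orbit_point p (U eps t) t); first by exists t.
by rewrite enorm_orbit_sub.
Qed.

(** The solution is chosen as a function of eps, so that one family serves
    all statements about small eps. *)
Lemma periodic_family (rho : R) : exists U : R -> R -> R,
  0 < rho -> g.[rho] = 0 -> g^`().[rho] != 0 ->
  [/\ forall eta, 0 < eta -> \forall eps \near (0 : R)^',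
        forall t, `|U eps t - rho| < eta &
      \forall eps \near (0 : R)^',
        (forall t, U eps (t + pi) = U eps t) /\
        (forall t, is_derive t (1 : R) (U eps) (eps * radial_rhs g t (U eps t)))].
Proof.
have [[[rho0 grho] g'rho]|nh] := pselect ((0 < rho /\ g.[rho] = 0) /\ g^`().[rho] != 0); last first.
  by exists (fun _ _ => 0) => h1 h2 h3; case: nh.
have [H saz] := radial_simple_average_zero (lt0r_neq0 rho0) grho g'rho.
have [C [e0 [C0 e00 ex]]] := periodic_solution_exists saz.
have /choice[U UP] : forall eps, exists u : R -> R, `|eps| < e0 ->
    [/\ forall t, u (t + pi) = u t,
        forall t, is_derive t (1 : R) u (eps * radial_rhs g t (u t)) &
        forall t, `|u t - rho| <= C * `|eps|].
  move=> eps; have [/ex[u uP]|_] := ltP `|eps| e0; first by exists u.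
  by exists (fun=> 0).
exists U => _ _ _; split.
  move=> eta eta0.
  have eC : 0 < eta / (C + 1) by rewrite divr_gt0// ltr_wpDl.
  near=> eps => t; have e1 : `|eps| < e0 by near: eps; exact: dnbhs0_lt.
  have e2 : `|eps| < eta / (C + 1) by near: eps; exact: dnbhs0_lt.
  have [_ _ h] := UP _ e1; apply: le_lt_trans (h t) _.
  move: e2; rewrite ltr_pdivlMr ?ltr_wpDl// => e2.
  by have := normr_ge0 eps; lra.
near=> eps; have e1 : `|eps| < e0 by near: eps; exact: dnbhs0_lt.
by have [] := UP _ e1.
Unshelve. all: by end_near. Qed.

End LimitCycles.

(** * The example with the maximal number of limit cycles *)

Section Nodes.
Variables (R : realType) (s : nat -> R).

Definition nodes_poly (m : nat) : {poly R} := \prod_(k < m) ('X - (s k)%:P).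

Lemma size_nodes_poly m : size (nodes_poly m) = m.+1.
Proof. by rewrite size_prod_XsubC /index_enum -enumT size_enum_ord. Qed.

Lemma nodes_polyP m x : (nodes_poly m).[x] = 0 -> exists k : 'I_m, x = s k.
Proof.
rewrite horner_prod => /eqP/prodf_eq0[k _]; rewrite hornerXsubC subr_eq0 => /eqP ->.
by exists k.
Qed.

Lemma nodes_poly_root m (k : 'I_m) : (nodes_poly m).[s k] = 0.
Proof.
by apply/eqP; rewrite horner_prod; apply/prodf_eq0; exists k; rewrite // hornerXsubC subrr.
Qed.

Lemma nodes_poly_simple m (k : 'I_m) : injective s -> (nodes_poly m)^`().[s k] != 0.
Proof.
move=> s_inj; rewrite /nodes_poly (bigD1 k)//= derivM derivXsubC mul1r.
rewrite hornerD hornerM hornerXsubC subrr mul0r addr0 horner_prod.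
apply/prodf_neq0 => j jk; rewrite hornerXsubC subr_eq0 (inj_eq s_inj).
by rewrite eq_sym (inj_eq val_inj).
Qed.

End Nodes.

Lemma card_range_fin (I : finType) (T : choiceType) (f : I -> T) : injective f ->
  (range f #= `I_#|I|)%card.
Proof.
move=> f_inj.
have -> : range f = [set f (enum_val i) | i in [set: 'I_#|I|]].
  apply/seteqP; split=> _ [i _ <-]; last by exists (enum_val i).
  by exists (enum_rank i); rewrite ?enum_rankK.
apply: card_eq_trans (inj_card_eq _) _.
  by move=> i j _ _ /f_inj; exact: enum_val_inj.
by rewrite card_eq_sym; exact: card_II.
Qed.

Section SharpExample.
Variables (R : realType) (d n : nat) (delta : R).
Hypotheses (n0 : (0 < n)%N) (delta0 : 0 < delta).

Let a : R := delta / d.+2%:R.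
Let a0 : 0 < a. Proof. by rewrite divr_gt0. Qed.

Let s (k : nat) : R := a / 2 * (k.+1%:R / n%:R).

Let s_inj : injective s.
Proof.
move=> i j /(mulfI (lt0r_neq0 (divr_gt0 a0 (ltr0n _ 2)))) /mulIf.
rewrite invr_neq0 ?pnatr_eq0 -?lt0n// => /(_ isT) /eqP.
by rewrite eqr_nat => /eqP[].
Qed.

Let s_gt0 k : 0 < s k.
Proof. by rewrite /s mulr_gt0 ?divr_gt0 ?ltr0n. Qed.

Let s_le k : (k < n)%N -> s k <= a / 2.
Proof.
move=> kn; have a2 : 0 <= a / 2 by rewrite divr_ge0// ltW.
by rewrite /s ler_piMr// ler_pdivrMr ?ltr0n// mul1r ler_nat.
Qed.

Let g := nodes_poly s n.-1.
Let q := nodes_poly s n.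
Let index : finType := ('I_n.-1 * {ffun 'I_d -> 'I_n})%type.

Let node (x : index) : 'rV[R]_d.+1 :=
  \row_i (if unlift ord0 i is Some l then s (x.2 l) else s x.1).

Let node0 x : node x ord0 ord0 = s x.1.
Proof. by rewrite mxE unlift_none. Qed.

Let nodeS x l : node x ord0 (lift ord0 l) = s (x.2 l).
Proof. by rewrite mxE liftK. Qed.

Let node_inj : injective node.
Proof.
move=> [i f] [j h] eqn; congr (_, _).
  by have := congr1 (fun v : 'rV__ => v ord0 ord0) eqn; rewrite !node0 => /s_inj/val_inj.
apply/ffunP => l; have := congr1 (fun v : 'rV__ => v ord0 (lift ord0 l)) eqn.
by rewrite !nodeS => /s_inj/val_inj.
Qed.

Let node_simple x : simple_node g q (node x).
Proof.
split; rewrite ?node0.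
- exact: s_gt0.
- exact: nodes_poly_root.
- exact: nodes_poly_simple.
- by move=> l; rewrite nodeS; exact: nodes_poly_root.
- by move=> l; rewrite nodeS; exact: nodes_poly_simple.
Qed.

Local Notation P := (@even_radial_field R d 1 g q).
Local Notation Q := (@even_radial_field R d (-1) g q).

Let admissible_node p : admissible_zero (averaged P Q) p <-> exists x, p = node x.
Proof.
rewrite averaged_even_radial_field.
split=> [[pH fp _]|[x ->]].
  have p0 : 0 < p ord0 ord0 := pH.
  have fE i : (if i == ord0 then 2 *: (g * 'X) else (2 * pi) *: q).[p ord0 i] = 0.
    by have := congr1 (fun v : 'rV__ => v ord0 i) fp; rewrite !mxE.
  have [i pi_] : exists i : 'I_n.-1, p ord0 ord0 = s i.
    apply: nodes_polyP; have := fE ord0.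
    rewrite eqxx hornerZ hornerM hornerX => /eqP.
    by rewrite !mulf_eq0 pnatr_eq0 (gt_eqF p0) /= orbF => /eqP.
  have /choice[f fP] : forall l : 'I_d, exists k : 'I_n, p ord0 (lift ord0 l) = s k.
    move=> l; apply: nodes_polyP; have := fE (lift ord0 l).
    rewrite /= hornerZ => /eqP.
    by rewrite !mulf_eq0 pnatr_eq0 (gt_eqF (pi_gt0 R)) /= => /eqP.
  exists (i, [ffun l => f l]); apply/rowP => j.
  by case: (unliftP ord0 j) => [l ->|->]; rewrite ?nodeS ?node0 ?ffunE.
have [x0 gx g'x qx q'x] := node_simple x.
apply: (@decoupled_admissible R d
  (fun i => if i == ord0 then 2 *: (g * 'X) else (2 * pi) *: q)) => //.
  move=> i; case: (unliftP ord0 i) => [l ->|->].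
    by rewrite /= hornerZ qx mulr0.
  by rewrite eqxx hornerZ hornerM gx mul0r mulr0.
move=> i; case: (unliftP ord0 i) => [l ->|->].
  by rewrite /= derivZ hornerZ !mulf_neq0 ?pnatr_eq0// gt_eqF// pi_gt0.
rewrite eqxx derivZ hornerZ derivM derivX mulr1 hornerD gx addr0 hornerM hornerX.
by rewrite !mulf_neq0 ?pnatr_eq0// gt_eqF.
Qed.

(** The averaged function is decoupled: its radial component is 2 r * g(r),
    where g has n - 1 simple positive zeros, and each z component is 2 pi * q,
    where q has n simple zeros. The coordinates of the zeros lie in (0, a / 2],
    so that for small eps every coordinate on the cycles is at most a, whence a
    norm below delta. *)
Theorem sharp_example : exists P Q : 'I_d.+2 -> mpoly d.+2 R,
  [/\ perturbation n P, perturbation n Q,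
      ([set p | admissible_zero (averaged P Q) p] #= `I_(n ^ d * (n - 1)))%card &
      exists G : 'rV[R]_d.+1 -> R -> set 'rV[R]_d.+2,
        (\forall eps \near (0 : R)^',
           [/\ forall p, admissible_zero (averaged P Q) p ->
                 limit_cycle (vfield eps P) (vfield eps Q) (G p eps),
               forall p p', admissible_zero (averaged P Q) p ->
                 admissible_zero (averaged P Q) p' ->
                 G p eps = G p' eps -> p = p' &
               forall p, admissible_zero (averaged P Q) p ->
                 forall u, G p eps u -> enorm u < delta]) /\
        (forall p, admissible_zero (averaged P Q) p ->
           tends_to (G p) (circle p))].
Proof.
exists P, Q.
have sg : (size g <= n)%N by rewrite size_nodes_poly prednK.
have sq : (size q <= n.+1)%N by rewrite size_nodes_poly.
split; [exact: even_radial_field_perturbation|exact: even_radial_field_perturbation| |].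
  have -> : [set p | admissible_zero (averaged P Q) p] = range node.
    apply/seteqP; split=> [p /admissible_node[x ->]|_ [x _ <-]]; first by exists x.
    by apply/admissible_node; exists x.
  have := card_range_fin node_inj.
  by rewrite card_prod card_ffun !card_ord mulnC subn1.
have /choice[U UP] := @periodic_family R g.
exists (fun p eps => range (fun t => orbit_point p (U (p ord0 ord0) eps t) t)).
have Ulim x eta : 0 < eta -> \forall eps \near (0 : R)^', forall t,
    `|U (node x ord0 ord0) eps t - node x ord0 ord0| < eta.
  by have [x0 gx g'x _ _] := node_simple x; have [/(_ eta) + _] := UP _ x0 gx g'x.
split; last first.
  move=> _ /admissible_node[x ->]; apply: orbit_tends_to => [|eta eta0].
    by have [] := node_simple x.
  exact: Ulim.
(* The radii of two cycles with different nodes stay apart when each is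
   within e / 2 of its node; a radius that differs from its node by less than
   the node is positive. *)
have [e e0 gap] := finite_gap (fun i j : 'I_n.-1 => @val_inj _ _ _ i j \o @s_inj i j).
have e2 : 0 < e / 2 by rewrite divr_gt0.
have a2 : 0 < a / 2 by rewrite divr_gt0.
have : \forall eps \near (0 : R)^', forall x : index,
  [/\ limit_cycle (vfield eps P) (vfield eps Q)
        (range (fun t => orbit_point (node x) (U (node x ord0 ord0) eps t) t)),
      forall t, `|U (node x ord0 ord0) eps t - node x ord0 ord0| < e / 2,
      forall t, `|U (node x ord0 ord0) eps t - node x ord0 ord0| < a / 2 &
      forall t, `|U (node x ord0 ord0) eps t - node x ord0 ord0| < node x ord0 ord0].
  apply: filter_forall => x.
  have [x0 gx g'x _ _] := node_simple x.
  have [_ Usol] := UP _ x0 gx g'x.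
  have [eta eta0 cyc] := orbit_limit_cycle (node_simple x).
  near=> eps; split.
  - have [Uper Uode] : (forall t, U (node x ord0 ord0) eps (t + pi) = U (node x ord0 ord0) eps t) /\
      (forall t, is_derive t (1 : R) (U (node x ord0 ord0) eps)
         (eps * radial_rhs g t (U (node x ord0 ord0) eps t))) by near: eps.
    apply: cyc => //; first by near: eps; exact: nbhs_dnbhs_neq.
    by near: eps; exact: Ulim.
  - by near: eps; exact: Ulim.
  - by near: eps; exact: Ulim.
  - by near: eps; exact: Ulim.
apply: filterS => eps H; split.
- by move=> _ /admissible_node[x ->]; have [] := H x.
- move=> _ _ /admissible_node[x ->] /admissible_node[y ->] eqG.
  have [_ /(_ 0) hx _ /(_ 0) ux] := H x; have [_ hy _ uy] := H y.
  have : range (fun t => orbit_point (node y) (U (node y ord0 ord0) eps t) t)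
      (orbit_point (node x) (U (node x ord0 ord0) eps 0) 0).
    by rewrite -eqG; exists 0.
  move=> [t _ eqt]; move: {hy uy} (hy t) (uy t) eqt.
  set r := U _ eps t; set r' := U _ eps 0 in hx ux * => hy uy eqt.
  have r0 : 0 < r by move: uy; rewrite ltr_norml => /andP[? ?]; lra.
  have r'0 : 0 < r' by move: ux; rewrite ltr_norml => /andP[? ?]; lra.
  have N (p : 'rV[R]_d.+1) (c v : R) :
      orbit_point p c v ord0 ix ^+ 2 + orbit_point p c v ord0 iy ^+ 2 = c ^+ 2.
    by rewrite orbit_point_x orbit_point_y !exprMn -mulrDr cos2Dsin2 mulr1.
  have rr : r = r'.
    apply/eqP; rewrite -(@eqrXn2 _ 2)// ?ltW//.
    by rewrite -(N (node y) r t) -(N (node x) r' 0) eqt.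
  have xy1 : x.1 = y.1.
    apply/eqP; apply: contraT => /gap; rewrite leNgt => /negP; case.
    move: hx hy; rewrite rr !node0 !ltr_norml => /andP[? ?] /andP[? ?].
    by apply/andP; split; lra.
  apply/rowP => i; case: (unliftP ord0 i) => [l ->|->]; last by rewrite !node0 xy1.
  by rewrite -(orbit_point_z (node x) r' 0) -(orbit_point_z (node y) r t) eqt.
- move=> _ /admissible_node[x ->] _ [t _ <-].
  have [_ _ /(_ t) hx _] := H x; apply: enorm_coord_lt => // i; rewrite -/a.
  have sx : s x.1 <= a / 2 by apply: s_le; exact: leq_trans (ltn_ord _) (leq_pred n).
  have ur : `|U (node x ord0 ord0) eps t| <= a.
    rewrite -[U _ _ _](subrK (node x ord0 ord0)) (le_trans (ler_normD _ _))//.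
    rewrite node0 in hx *; rewrite (gtr0_norm (s_gt0 _)).
    by have := a0; lra.
  have [->|->|[l ->]] := coordP i.
  + by rewrite orbit_point_x normrM (le_trans _ ur)// ler_piMr// ler_norml cos_geN1 cos_le1.
  + by rewrite orbit_point_y normrM (le_trans _ ur)// ler_piMr// ler_norml sin_geN1 sin_le1.
  + rewrite orbit_point_z nodeS (gtr0_norm (s_gt0 _)).
    by have := s_le (ltn_ord (x.2 l)); have := a0; lra.
Unshelve. all: by end_near. Qed.

End SharpExample.

Theorem corollary4 (R : realType) (d n : nat) (hd : (1 <= d)%N) (hn : (1 <= n)%N) :
  (forall P Q : 'I_d.+2 -> mpoly.mpoly d.+2 R,
     perturbation n P -> perturbation n Q ->
     ([set p | admissible_zero (averaged P Q) p] #<= `I_(n ^ d * (n - 1)))%card) /\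
  (forall delta : R, 0 < delta ->
     exists P Q : 'I_d.+2 -> mpoly.mpoly d.+2 R,
       [/\ perturbation n P, perturbation n Q,
           ([set p | admissible_zero (averaged P Q) p] #= `I_(n ^ d * (n - 1)))%card &
           exists G : 'rV[R]_d.+1 -> R -> set 'rV[R]_d.+2,
             (\forall eps \near (0 : R)^',
                [/\ forall p, admissible_zero (averaged P Q) p ->
                      limit_cycle (vfield eps P) (vfield eps Q) (G p eps),
                    forall p q, admissible_zero (averaged P Q) p ->
                      admissible_zero (averaged P Q) q ->
                      G p eps = G q eps -> p = q &
                    forall p, admissible_zero (averaged P Q) p ->
                      forall u, G p eps u -> enorm u < delta]) /\
             (forall p, admissible_zero (averaged P Q) p ->
                tends_to (G p) (circle p))]).
Proof.
split=> [P Q hP hQ|delta delta0].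
  exact: card_admissible_zeros.
exact: sharp_example.
Qed.
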